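(* Let $M^{n-1}$ be connected and let $\lambda:M^{n-1}\to\Lambda^{2n-1}$ be a proper Dupin hypersurface with four distinct curvature spheres for which the Lie curvature is $r=-1$ and the multiplicities satisfy $m_1=m_2$ and $m_3=m_4$. If $Y:U\to G$ is a second order frame field along $\lambda$ (on a nonempty open set $U\subset M$) such that $d\omega^0_0=0$ on $U$ and $\{1\}'\neq\emptyset$, then there exists a nonempty open subset $W$ of $U$ such that the curvature sphere $[Y_0]:W\to\mathbf{RP}^{n+2}$ takes values in a constant linear subspace of codimension at least $2$. Thus, $\lambda$ is reducible on $W$.
   Context: Lie sphere geometry: $\mathbb{R}^{n+3}_2$ is $\mathbb{R}^{n+3}$ with the form $\langle x,y\rangle=-x^0y^0+x^1y^1+\dots+x^{n+1}y^{n+1}-x^{n+2}y^{n+2}$, $Q\subset\mathbf{RP}^{n+2}$ is the Lie quadric $\langle x,x\rangle=0$, and $\Lambda=\Lambda^{2n-1}$ is the manifold of projective lines contained in $Q$; $[x,y]$ is the line through $[x],[y]$. A Legendre submanifold is an immersion $\lambda:M^{n-1}\to\Lambda^{2n-1}$ such that, locally writing $\lambda=[Y_0,Y_1]$, $\langle dY_0,Y_1\rangle=0$. A curvature sphere at $p$ is a point $[rY_0(p)+sY_1(p)]$ for which some nonzero $X\in T_pM$ satisfies $r\,dY_0(X)+s\,dY_1(X)\in\mathrm{span}\{Y_0(p),Y_1(p)\}$; such $X$ (with $0$) form its principal space, of dimension its multiplicity. A curvature surface is a connected submanifold whose tangent spaces are principal spaces. $\lambda$ is Dupin if each curvature sphere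 is constant along its curvature surfaces, proper Dupin if also the number of distinct curvature spheres is constant; ''Dupin hypersurface'' here means such a Legendre submanifold. All manifolds and maps are real analytic. If the four curvature spheres, with multiplicities $m_1,\dots,m_4$ in this order, are written $[Y_0],[Y_1],[Y_0+Y_1],[rY_0+Y_1]$, then $r$ is the Lie curvature. $\lambda$ is reducible on an open subset $O\subset M$ if some curvature sphere maps $O$ into a fixed linear subspace of $\mathbf{RP}^{n+2}$ of codimension at least two. Frames: $G=O(n+1,2)$ is identified with the set of Lie frames, i.e. $(n+3)$-tuples $Y=(Y_0,\dots,Y_{n+2})$ in $\mathbb{R}^{n+3}_2$ with $\langle Y_0,Y_{n+2}\rangle=\langle Y_1,Y_{n+1}\rangle=-1$, $\langle Y_i,Y_j\rangle=\delta_{ij}$ for $2\le i,j\le n$, all other products $0$. A Lie frame field along $\lambda$ on an open $U\subset M$ is an analytic $Y:U\to G$ with $\lambda=[Y_0,Y_1]$; define 1-forms $\omega^B_A$ by $dY_A=\sum_B\omega^B_AY_B$. Index sets: $\{1\}=\{2,\dots,m_1+1\}$, and $\{2\},\{3\},\{4\}$ are the next consecutive blocks of sizes $m_2,m_3,m_4$ (so they partition $\{2,\dots,n\}$); $a\in\{1\}$, $p\in\{2\}$, $\alpha\in\{3\}$, $\mu\in\{4\}$. $Y$ is of first order if $[Y_0],[Y_1],[Y_0+Y_1],[rY_0+Y_1]$ are the curvature spheres and $\omega^a_0=0$, $\omega^p_1=0$, $\omega^\alpha_0+\omega^\alpha_1=0$, $r\omega^\mu_0+\omega^\mu_1=0$;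 its coframe is $\theta^a=\omega^a_1$, $\theta^p=\omega^p_0$, $\theta^\alpha=\omega^\alpha_0$, $\theta^\mu=\omega^\mu_0$. It is of second order if also $\omega^1_0=0$, $\omega^0_1=0$, $\omega^1_1=\omega^0_0$. For a second order frame field with $r=-1$, analytic functions $F^\alpha_{pa},F^\mu_{pa},F^\mu_{\alpha a},F^\mu_{\alpha p}$ are defined by $\omega^p_a=\sum_\alpha F^\alpha_{pa}\theta^\alpha-\sum_\mu F^\mu_{pa}\theta^\mu$, $\ \omega^\alpha_a=\sum_pF^\alpha_{pa}\theta^p-2\sum_\mu F^\mu_{\alpha a}\theta^\mu$, $\ \omega^\alpha_p=\sum_aF^\alpha_{pa}\theta^a-2\sum_\mu F^\mu_{\alpha p}\theta^\mu$, $\ \omega^\mu_a=-\sum_pF^\mu_{pa}\theta^p-2\sum_\alpha F^\mu_{\alpha a}\theta^\alpha$, $\ \omega^\mu_p=\sum_aF^\mu_{pa}\theta^a+2\sum_\alpha F^\mu_{\alpha p}\theta^\alpha$, $\ \omega^\mu_\alpha=\sum_aF^\mu_{\alpha a}\theta^a+\sum_pF^\mu_{\alpha p}\theta^p$. For a second order frame field $Y:U\to G$, $\{1\}'$ is the set of all $a\in\{1\}$ such that $F^\alpha_{pa}=0$, $F^\mu_{pa}=0$, $F^\mu_{\alpha a}=0$ on $U$ for all $p,\alpha,\mu$. *)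

(* Defs.v *)
From HB Require Import structures.
From mathcomp Require Import all_boot all_order all_algebra.
From mathcomp Require Import all_classical all_reals all_analysis.
Import Order.TTheory GRing.Theory Num.Theory.
Import numFieldNormedType.Exports.

Set Implicit Arguments.
Unset Strict Implicit.
Unset Printing Implicit Defensive.

Local Open Scope classical_set_scope.
Local Open Scope ring_scope.

Section Analytic.
Context {R : realType} {d : nat}.
Implicit Types (f : 'rV[R]_d -> R) (O : set 'rV[R]_d).

Fixpoint iter_partial (s : seq 'I_d) f : 'rV[R]_d -> R :=
  if s is i :: s' then fun x => 'D_(delta_mx 0 i) (iter_partial s' f) x else f.

Definition smooth_on O f : Prop :=
  forall (s : seq 'I_d) (x : 'rV[R]_d), O x -> differentiable (iter_partial s f) x.

(* The term (D^k f)(x) / k! * h^k of the Taylor series of f at x; the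
   multi-indices k with |k| = N are taken among the functions into {0, .., N}. *)
Definition taylor_monomial f (x h : 'rV[R]_d) N (k : {ffun 'I_d -> 'I_N.+1}) : R :=
  iter_partial (flatten [seq nseq (k i) i | i <- enum 'I_d]) f x
    / (\prod_i (k i)`!)%:R * \prod_i h 0 i ^+ k i.

(* C^oo, and near each point the sum of its absolutely convergent Taylor series. *)
Definition analytic_on O f : Prop :=
  smooth_on O f /\
  forall x, O x -> \forall y \near x,
    cvgn (series (fun N => \sum_(k : {ffun 'I_d -> 'I_N.+1} | (\sum_i k i == N)%N)
                             `|taylor_monomial f x (y - x) k|)) /\
    series (fun N => \sum_(k : {ffun 'I_d -> 'I_N.+1} | (\sum_i k i == N)%N)
                       taylor_monomial f x (y - x) k) @ \oo --> f y.

End Analytic.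

(* Both maps of a chart are total functions; only their values on
   [chart_dom] and [chart_cod] matter. *)
Record chart (R : realType) (T : topologicalType) (d : nat) := Chart {
  chart_dom : set T;
  chart_cod : set 'rV[R]_d;
  chart_map : T -> 'rV[R]_d;
  chart_inv : 'rV[R]_d -> T;
  chart_dom_open : open chart_dom;
  chart_cod_open : open chart_cod;
  chart_mapP : forall p, chart_dom p -> chart_cod (chart_map p);
  chart_invP : forall x, chart_cod x -> chart_dom (chart_inv x);
  chart_mapK : forall p, chart_dom p -> chart_inv (chart_map p) = p;
  chart_invK : forall x, chart_cod x -> chart_map (chart_inv x) = x;
  chart_map_continuous : forall p, chart_dom p -> {for p, continuous chart_map};
  chart_inv_continuous : forall x, chart_cod x -> {for x, continuous chart_inv} }.

Record analytic_manifold (R : realType) (d : nat) := AnalyticManifold {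
  mcarrier :> topologicalType;
  atlas : set (chart R mcarrier d);
  atlas_cover : forall p, exists2 c, atlas c & chart_dom c p;
  atlas_compatible : forall c c', atlas c -> atlas c' -> forall i,
    analytic_on (chart_cod c `&` chart_inv c @^-1` chart_dom c')
                (fun x => chart_map c' (chart_inv c x) 0 i);
  mcarrier_hausdorff : hausdorff_space mcarrier;
  mcarrier_second_countable : @second_countable mcarrier }.

Section Manifold.
Context {R : realType} {d : nat} {M : analytic_manifold R d}.
Implicit Types (U : set M) (c : chart R M d) (p : M) (X : 'rV[R]_d).

(* Used for open U only. *)
Definition analytic_fun U (f : M -> R) : Prop :=
  forall c, atlas c ->
    analytic_on (chart_cod c `&` chart_inv c @^-1` U) (f \o chart_inv c).

Definition analytic_mx U k l (f : M -> 'M[R]_(k, l)) : Prop :=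
  forall i j, analytic_fun U (fun p => f p i j).

(* A tangent vector at p is given by its coordinates X in a chart c around p;
   [chart_diff c f p X] is then the differential df_p(X). *)
Definition chart_diff (V : normedModType R) c (f : M -> V) p X : V :=
  'D_X (f \o chart_inv c) (chart_map c p).

(* A 1-form is given in the chart c by [eta p X]; its exterior derivative is
   evaluated on the coordinate vector fields X, X', whose bracket vanishes. *)
Definition ext_deriv c (eta : M -> 'rV[R]_d -> R) p X X' : R :=
  chart_diff c (fun q => eta q X' : R^o) p X
  - chart_diff c (fun q => eta q X : R^o) p X'.

End Manifold.

Section ManifoldMap.
Context {R : realType} {k d : nat}.
Context {N : analytic_manifold R k} {M : analytic_manifold R d}.
Implicit Types (g : N -> M).

Definition analytic_map g : Prop :=
  continuous g /\
  forall b c, atlas b -> atlas c -> forall i,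
    analytic_on (chart_cod b `&` (g \o chart_inv b) @^-1` chart_dom c)
                (fun x => chart_map c (g (chart_inv b x)) 0 i).

Definition tangent_map g (b : chart R N k) (c : chart R M d) (y : N)
    (w : 'rV[R]_k) : 'rV[R]_d :=
  chart_diff b (chart_map c \o g) y w.

End ManifoldMap.

(* Points and projective lines of RP^(n+2) are the subspaces of dimension
   1 and 2 of R^(n+3). *)

Section LieForm.
Context {R : realType} {n : nat}.

Definition lie_form (x y : 'rV[R]_n.+3) : R :=
  \sum_i (-1) ^+ ((i == ord0) || (i == ord_max)) * (x 0 i * y 0 i).

Definition line_in_quadric (L : {vspace 'rV[R]_n.+3}) : Prop :=
  \dim L = 2%N /\ forall x, x \in L -> lie_form x x = 0.

Definition ord_one : 'I_n.+3 := inord 1.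

(* The rows of Y are the vectors Y_0, .., Y_(n+2). *)
Definition lie_frame (Y : 'M[R]_n.+3) : Prop :=
  forall A B : 'I_n.+3, lie_form (row A Y) (row B Y) =
    if (minn A B <= 1)%N && (A + B == n.+2)%N then -1
    else if (A == B) && (2 <= A <= n)%N then 1 else 0.

End LieForm.

Arguments ord_one {n}.

Section Legendre.
Context {R : realType} {d n : nat} {M : analytic_manifold R d}.
Variable lam : M -> {vspace 'rV[R]_n.+3}.
Implicit Types (U : set M) (c : chart R M d) (p : M) (X : 'rV[R]_d).
Implicit Types (K : {vspace 'rV[R]_n.+3}).

(* Y0, Y1 are independent on U when lambda takes values in projective lines. *)
Definition lift_on U (Y0 Y1 : M -> 'rV[R]_n.+3) : Prop :=
  [/\ open U, analytic_mx U Y0, analytic_mx U Y1 &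
      forall p, U p -> lam p = <<[:: Y0 p; Y1 p]>>%VS].

Definition analytic_line_map : Prop :=
  forall p, exists U Y0 Y1, U p /\ lift_on U Y0 Y1.

(* The tangent space at L of the manifold of 2-planes is Hom(L, R^(n+3)/L), and
   the differential of lambda at p maps X to the map Y_i(p) |-> dY_i(X) mod L. *)
Definition line_immersion : Prop :=
  forall U Y0 Y1, lift_on U Y0 Y1 ->
  forall c p X, atlas c -> chart_dom c p -> U p ->
    chart_diff c Y0 p X \in lam p -> chart_diff c Y1 p X \in lam p -> X = 0.

Definition contact : Prop :=
  forall U Y0 Y1, lift_on U Y0 Y1 ->
  forall c p X, atlas c -> chart_dom c p -> U p ->
    lie_form (chart_diff c Y0 p X) (Y1 p) = 0.

Definition legendre : Prop :=
  [/\ forall p, line_in_quadric (lam p), analytic_line_map, line_immersion & contact].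

(* X belongs to the principal space at p of the point K of the line lambda(p). *)
Definition principal c p K X : Prop :=
  exists U Y0 Y1 (r s : R),
    [/\ lift_on U Y0 Y1, U p, (r != 0) || (s != 0),
        K = <[r *: Y0 p + s *: Y1 p]>%VS &
        r *: chart_diff c Y0 p X + s *: chart_diff c Y1 p X \in lam p].

Definition curvature_sphere p K : Prop :=
  exists c X, [/\ atlas c, chart_dom c p, X != 0 & principal c p K X].

Definition multiplicity p K (m : nat) : Prop :=
  forall c, atlas c -> chart_dom c p ->
  exists2 V : {vspace 'rV[R]_d},
    \dim V = m & forall X, X \in V <-> principal c p K X.

(* The connected submanifold is the image of the injective immersion g; K gives
   the curvature sphere whose principal space is tangent to it. *)
Definition curvature_surface k (N : analytic_manifold R k) (g : N -> M)
    (K : N -> {vspace 'rV[R]_n.+3}) : Prop :=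
  [/\ connected [set: N], injective g, analytic_map g,
      forall y, curvature_sphere (g y) (K y) &
      forall y b c, atlas b -> atlas c -> chart_dom b y -> chart_dom c (g y) ->
        injective (tangent_map g b c y) /\
        forall X, principal c (g y) (K y) X <-> exists w, X = tangent_map g b c y w].

Definition dupin : Prop :=
  legendre /\
  forall k (N : analytic_manifold R k) (g : N -> M)
      (K : N -> {vspace 'rV[R]_n.+3}),
    curvature_surface g K -> forall y y', K y = K y'.

Definition proper_dupin (k : nat) : Prop :=
  dupin /\ forall p, ([set K | curvature_sphere p K] #= `I_k)%card.

Definition four_points (r : R) (Z0 Z1 : 'rV[R]_n.+3) : seq {vspace 'rV[R]_n.+3} :=
  [:: <[Z0]>%VS; <[Z1]>%VS; <[Z0 + Z1]>%VS; <[r *: Z0 + Z1]>%VS].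

(* At each point there are four distinct curvature spheres, which in a suitable
   order have multiplicities m = (m1, .., m4) and Lie curvature r. *)
Definition lie_curvature (m : seq nat) (r : M -> R) : Prop :=
  forall p, exists Z0 Z1,
    let K := four_points (r p) Z0 Z1 in
    [/\ uniq K,
        forall L, curvature_sphere p L <-> L \in K &
        forall i, (i < 4)%N -> multiplicity p (nth 0%VS K i) (nth 0%N m i)].

Definition analytic_point_map U (K : M -> {vspace 'rV[R]_n.+3}) : Prop :=
  forall p, U p -> exists (V : set M) (k : M -> 'rV[R]_n.+3),
    [/\ open V, V p, analytic_mx V k &
        forall q, V q -> k q != 0 /\ K q = <[k q]>%VS].

(* The points of K over O lie in P(S) with P(S) of codimension at least 2. *)
Definition in_codim2 (O : set M) (K : M -> {vspace 'rV[R]_n.+3}) : Prop :=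
  exists S : {vspace 'rV[R]_n.+3},
    (\dim S + 2 <= n.+3)%N /\ forall p, O p -> (K p <= S)%VS.

Definition reducible (O : set M) : Prop :=
  exists K : M -> {vspace 'rV[R]_n.+3},
    [/\ analytic_point_map O K, forall p, O p -> curvature_sphere p (K p) &
        in_codim2 O K].

Definition lie_frame_field U (Y : M -> 'M[R]_n.+3) : Prop :=
  [/\ open U, analytic_mx U Y, forall p, U p -> lie_frame (Y p) &
      forall p, U p ->
        lam p = <<[:: row ord0 (Y p); row ord_one (Y p)]>>%VS].

(* [omega Y c A B] is the 1-form omega^B_A: the lower index comes first, so that
   dY = omega *m Y. *)
Definition omega (Y : M -> 'M[R]_n.+3) c (A B : 'I_n.+3) p X : R :=
  (chart_diff c Y p X *m invmx (Y p)) A B.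

(* For m = (m1, .., m4), block m 0, .., block m 3 are the index sets
   {1}, .., {4}; for instance block m 0 is 2 <= i <= m1 + 1. *)
Definition block (m : seq nat) (j : nat) (i : 'I_n.+3) : bool :=
  ((sumn (take j m)).+2 <= i < (sumn (take j.+1 m)).+2)%N.

Definition first_order (m : seq nat) (r : M -> R) U (Y : M -> 'M[R]_n.+3) : Prop :=
  [/\ lie_frame_field U Y,
      forall p, U p -> forall L, curvature_sphere p L <->
        L \in four_points (r p) (row ord0 (Y p)) (row ord_one (Y p)) &
      forall c p X, atlas c -> chart_dom c p -> U p ->
      let w A B := omega Y c A B p X in
      [/\ forall a, block m 0 a -> w ord0 a = 0,
          forall b, block m 1 b -> w ord_one b = 0,
          forall b, block m 2 b -> w ord0 b + w ord_one b = 0 &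
          forall b, block m 3 b -> r p * w ord0 b + w ord_one b = 0]].

Definition second_order (m : seq nat) (r : M -> R) U (Y : M -> 'M[R]_n.+3) : Prop :=
  first_order m r U Y /\
  forall c p X, atlas c -> chart_dom c p -> U p ->
    let w A B := omega Y c A B p X in
    [/\ w ord0 ord_one = 0, w ord_one ord0 = 0 & w ord_one ord_one = w ord0 ord0].

(* The indices a, p, alpha, mu in {1}, {2}, {3}, {4} are called a, s, t, u. The
   functions are F^alpha_{pa}, F^mu_{pa}, F^mu_{alpha a}, F^mu_{alpha p}, with
   the upper index as first argument; only the values at indices of the
   corresponding blocks are meaningful. *)
Record frame_coeffs := FrameCoeffs {
  F3_21 : 'I_n.+3 -> 'I_n.+3 -> 'I_n.+3 -> M -> R;
  F4_21 : 'I_n.+3 -> 'I_n.+3 -> 'I_n.+3 -> M -> R;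
  F4_31 : 'I_n.+3 -> 'I_n.+3 -> 'I_n.+3 -> M -> R;
  F4_32 : 'I_n.+3 -> 'I_n.+3 -> 'I_n.+3 -> M -> R }.

Definition frame_coeffs_of (m : seq nat) U (Y : M -> 'M[R]_n.+3)
    (F : frame_coeffs) : Prop :=
  [/\ forall t s a, block m 2 t -> block m 1 s -> block m 0 a ->
        analytic_fun U (F3_21 F t s a),
      forall u s a, block m 3 u -> block m 1 s -> block m 0 a ->
        analytic_fun U (F4_21 F u s a),
      forall u t a, block m 3 u -> block m 2 t -> block m 0 a ->
        analytic_fun U (F4_31 F u t a) &
      forall u t s, block m 3 u -> block m 2 t -> block m 1 s ->
        analytic_fun U (F4_32 F u t s)] /\
  forall c p X, atlas c -> chart_dom c p -> U p ->
  let w A B := omega Y c A B p X in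
  let th1 a := w ord_one a in
  let th2 s := w ord0 s in
  let th3 t := w ord0 t in
  let th4 u := w ord0 u in
  [/\ forall a s, block m 0 a -> block m 1 s ->
        w a s = \sum_(t | block m 2 t) F3_21 F t s a p * th3 t
                - \sum_(u | block m 3 u) F4_21 F u s a p * th4 u,
      forall a t, block m 0 a -> block m 2 t ->
        w a t = \sum_(s | block m 1 s) F3_21 F t s a p * th2 s
                - 2 * \sum_(u | block m 3 u) F4_31 F u t a p * th4 u &
      forall s t, block m 1 s -> block m 2 t ->
        w s t = \sum_(a | block m 0 a) F3_21 F t s a p * th1 a
                - 2 * \sum_(u | block m 3 u) F4_32 F u t s p * th4 u] /\
  [/\ forall a u, block m 0 a -> block m 3 u ->
        w a u = - \sum_(s | block m 1 s) F4_21 F u s a p * th2 s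
                - 2 * \sum_(t | block m 2 t) F4_31 F u t a p * th3 t,
      forall s u, block m 1 s -> block m 3 u ->
        w s u = \sum_(a | block m 0 a) F4_21 F u s a p * th1 a
                + 2 * \sum_(t | block m 2 t) F4_32 F u t s p * th3 t &
      forall t u, block m 2 t -> block m 3 u ->
        w t u = \sum_(a | block m 0 a) F4_31 F u t a p * th1 a
                + \sum_(s | block m 1 s) F4_32 F u t s p * th2 s].

(* The set {1}' of the frame field whose coefficient functions are F. *)
Definition block1' (m : seq nat) U (F : frame_coeffs) : set 'I_n.+3 :=
  [set a | block m 0 a /\
     forall p, U p ->
       [/\ forall t s, block m 2 t -> block m 1 s -> F3_21 F t s a p = 0,
           forall u s, block m 3 u -> block m 1 s -> F4_21 F u s a p = 0 &
           forall u t, block m 3 u -> block m 2 t -> F4_31 F u t a p = 0]].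

End Legendre.

(* Main.v *)
Require Import Defs.
From mathcomp Require Import all_boot all_order all_algebra.
From mathcomp Require Import all_classical all_reals all_analysis.
From mathcomp Require Import zify ring lra.
Import Order.TTheory GRing.Theory Num.Theory.
Import numFieldNormedType.Exports.

Set Implicit Arguments.
Unset Strict Implicit.
Unset Printing Implicit Defensive.

Local Open Scope classical_set_scope.
Local Open Scope ring_scope.

(* In the coframe theta, all forms omega_0^i = x_i theta^i and
   omega_1^i = y_i theta^i have constant coefficients, and the functions F are
   the components of one totally symmetric tensor S.  If a lies in {1}', the
   structure equations give functions A and B with omega_j^1 =
   - (x_j A + y_j B) theta^j for j outside {1}, and a symmetric matrix P on {1}
   with omega_b^1 = sum_c P_bc theta^c for b in {1}.  They also give P^2 = B^2,
   and ker (P - B) is the common kernel K of all the F's: on this kernel a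
   quadratic form of the F's must vanish that is nonnegative when computed in
   block {3} and nonpositive when computed in block {4}.  Set
   Z = Y_(n+1) + A Y_0 + B Y_1.  Where B <> 0, P is parallel, so that Z and the
   vectors of K (seen in the span of the Y_b, b in {1}) span a space that does
   not depend on the point; where B vanishes identically, so does P, and Z and
   all the Y_b do the same.  This constant space contains Z and Y_a and is
   orthogonal to Y_0. *)

(** * Calculus *)

(** Why P^2 = B^2: differentiating omega_j^1 for j outside {1} puts the columns of P + B into K. For
    v in K the structure equations of the omega_b^j leave Q v + y_j (P - B) v = 0, where Q is the
    analogue of P - B for the omega_b^0; the values -1 and 1 of y_j on {3} and {4} separate the two
    terms. Hence (P - B)(P + B) = 0.

    The constant space is never formed. Z and the vectors q_c = sum_b q_bc Y_b, with q = P + B or q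
    = 1, satisfy a closed linear system, and so do their products with a fixed vector v. For v =
    Y_0(x1) these products vanish at x1, because Y_0 is orthogonal to every frame vector except
    Y_(n+2); uniqueness along the segment from x1 to a base point x0 makes them vanish at x0. So the
    fixed vectors Z(x0) and Y_a(x0) are orthogonal to Y_0(x1) for all x1 near x0, which is all that
    codimension 2 requires. As v depends on x1, the neighbourhood has to be chosen before the
    solution. The base point is one with B <> 0 if there is any, so the final open set may miss the
    point first given. *)

Section Calculus.
Context {R : realType} {V : normedModType R}.
Implicit Types (f : V -> R) (x u v : V).

Lemma differentiable_approx f x : differentiable f x ->
  forall e : R, 0 < e ->
  \forall w \near (0 : V), `|f (x + w) - f x - 'd f x w| <= e * `|w|.
Proof.
move=> fx e e0; have /diff_locally/eqaddoP/(_ e e0) := fx.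
apply: filterS => w /=.
by rewrite !fctE /= opprD addrA [w + x]addrC.
Qed.

Lemma near_shift (P : set V) x : (\forall z \near x, P z) ->
  \forall w \near (0 : V), P (x + w).
Proof.
move=> nP; have : (fun w => x + w) @ (0 : V) --> x.
  by rewrite -[X in _ --> X]addr0; apply: cvgD; [exact: cvg_cst|exact: cvg_id].
by move=> /(_ _ nP).
Qed.

Lemma is_derive_line f x u (s : R) : differentiable f (x + s *: u) ->
  is_derive s 1 (fun t : R => f (x + t *: u)) ('D_u f (x + s *: u)).
Proof.
move=> /(@diff_derivable _ _ _ _ _ u) df.
have E : (fun h : R => h^-1 *: (f (x + (h *: 1 + s) *: u) - f (x + s *: u))) =
         (fun h : R => h^-1 *: (f (h *: u + (x + s *: u)) - f (x + s *: u))).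
  apply/funext => h; congr (_ *: (f _ - _)).
  by rewrite [h *: 1]mulr1 scalerDl addrCA.
apply: DeriveDef; first by rewrite /derivable /= E.
by rewrite /derive /= E.
Qed.

(** The mean value theorem for s -> f (x + h v + s u) - f (x + s u) turns the second difference into
    h times a difference of two values of ['D_u f], which differentiability at the single point x
    evaluates up to o(h). *)
Lemma schwarz_approx f x u v :
  (\forall z \near x, differentiable f z) -> differentiable ('D_u f) x ->
  forall e : R, 0 < e -> \forall h \near (0 : R)^'+,
  `|f (x + h *: u + h *: v) - f (x + h *: u) - f (x + h *: v) + f x
     - h ^+ 2 * 'D_v ('D_u f) x| <= e * h ^+ 2.
Proof.
move=> df ddf e e0.
pose N : R := `|u| + `|v| + 1.
have N0 : 0 < N by rewrite /N; have := normr_ge0 u; have := normr_ge0 v; lra.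
have /nbhs_normP[r1 /= r10 b1] : \forall w \near (0 : V), differentiable f (x + w).
  exact: (near_shift df).
(* Each of the two increments of ['D_u f] below errs by at most e / (2N) times hN, that is e h /
   2. *)
have N20 : 0 < e / (2 * N) by rewrite divr_gt0// mulr_gt0.
have /nbhs_normP[r2 /= r20 b2] := differentiable_approx ddf N20.
near=> h.
have h0 : 0 < h by [].
have hN : h * N < Num.min r1 r2.
  rewrite -ltr_pdivlMr//; near: h; apply: nbhs_right_lt.
  by rewrite divr_gt0// lt_min r10.
have nrm a b : 0 <= a <= h -> 0 <= b <= h -> `|a *: u + b *: v| <= h * N.
  move=> /andP[a0 ah] /andP[b0 bh].
  rewrite (le_trans (ler_normD _ _))// !normrZ !ger0_norm// /N !mulrDr.
  by rewrite -[leLHS]addr0 ?lerD ?ler_wpM2r// mulr1 ltW.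
have dom a b : 0 <= a <= h -> 0 <= b <= h -> differentiable f (x + (a *: u + b *: v)).
  move=> ha hb; apply: b1; rewrite /ball_ /= sub0r normrN.
  by rewrite (le_lt_trans (nrm _ _ ha hb))// (lt_le_trans hN)// ge_min lexx.
have apx a b : 0 <= a <= h -> 0 <= b <= h ->
   `|'D_u f (x + (a *: u + b *: v)) - 'D_u f x - 'd ('D_u f) x (a *: u + b *: v)| <= e / 2 * h.
  move=> ha hb; apply: le_trans (b2 _ _) _.
    rewrite /ball_ /= sub0r normrN.
    by rewrite (le_lt_trans (nrm _ _ ha hb))// (lt_le_trans hN)// ge_min lexx orbT.
  rewrite (le_trans (ler_wpM2l _ (nrm _ _ ha hb)))//.
    by rewrite ltW// divr_gt0// mulr_gt0.
  by rewrite le_eqVlt; apply/orP; left; apply/eqP; field; rewrite gt_eqF.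
pose G (s : R) := f (x + h *: v + s *: u) - f (x + s *: u).
have dG s : 0 <= s <= h -> is_derive s 1 G ('D_u f (x + h *: v + s *: u) - 'D_u f (x + s *: u)).
  move=> hs; apply: is_deriveB; apply: is_derive_line.
    by rewrite -addrA [h *: v + _]addrC; apply: dom => //; rewrite lexx ltW.
  by rewrite -[s *: u]addr0 -(scale0r v); apply: dom => //; rewrite lexx ltW.
have [|c|s] := @MVT R G (fun s => 'D_u f (x + h *: v + s *: u) - 'D_u f (x + s *: u)) 0 h h0.
- by move=> s; rewrite in_itv /= => /andP[? ?]; apply: dG; rewrite !ltW.
- apply: derivable_within_continuous => s; rewrite in_itv /= => hs.
  by have := dG s hs => -[].
rewrite in_itv /= subr0 => /andP[s0 sh] Gs.
have hs : 0 <= s <= h by rewrite !ltW.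
have h00 : 0 <= (0 : R) <= h by rewrite lexx ltW.
have hh : 0 <= h <= h by rewrite lexx ltW.
have := apx s h hs hh; have := apx s 0 hs h00.
rewrite scale0r addr0.
have -> : f (x + h *: u + h *: v) - f (x + h *: u) - f (x + h *: v) + f x = G h - G 0.
  by rewrite /G scale0r !addr0 [x + h *: v + _]addrAC; ring.
rewrite Gs (deriveE v ddf).
rewrite [x + (s *: u + h *: v)]addrA [x + h *: v + s *: u]addrAC.
set D1 := 'D_u f (x + s *: u + _); set D2 := 'D_u f (x + s *: u); set D0 := 'D_u f x.
have -> : 'd ('D_u f) x (s *: u + h *: v) = s * 'd ('D_u f) x u + h * 'd ('D_u f) x v.
  by rewrite linearD !linearZ.
have -> : 'd ('D_u f) x (s *: u) = s * 'd ('D_u f) x u by rewrite linearZ.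
move: ('d _ x u) ('d _ x v) => a b /= A1 A2.
have -> : (D1 - D2) * h - h ^+ 2 * b =
  h * ((D1 - D0 - (s * a + h * b)) - (D2 - D0 - s * a)) by ring.
rewrite normrM gtr0_norm// expr2 mulrA [e * h]mulrC -mulrA ler_pM2l//.
apply: le_trans (ler_normB _ _) _.
by apply: le_trans (lerD A2 A1) _; rewrite -mulrDl -splitr.
Unshelve. all: by end_near.
Qed.

(** Young's form: the second difference is symmetric in u and v and approximates both mixed
    derivatives, without continuity of the second derivatives. *)
Lemma schwarz f x u v :
  (\forall z \near x, differentiable f z) ->
  differentiable ('D_u f) x -> differentiable ('D_v f) x ->
  'D_v ('D_u f) x = 'D_u ('D_v f) x.
Proof.
move=> df du dv; apply/eqP; rewrite -subr_eq0 -normr_eq0 eq_le normr_ge0 andbT.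
apply/ler_addgt0Pr => e e0; rewrite add0r.
have e20 : 0 < e / 2 by rewrite divr_gt0.
have nA := schwarz_approx v df du e20; have nB := schwarz_approx u df dv e20.
have n0 : \forall h \near (0 : R)^'+, 0 < h by exact: nbhs_right_gt.
have [h [h0 [A B]]] := filter_ex (filterI n0 (filterI nA nB)).
have h20 : 0 < h ^+ 2 by rewrite exprn_gt0.
rewrite -(ler_pM2l h20) -[X in X * `|_|]gtr0_norm// -normrM [h ^+ 2 * e]mulrC.
move: A B; rewrite [x + h *: v + _]addrAC.
set g1 := f (x + h *: u + h *: v); set a := 'D_v _ _; set b := 'D_u _ _ => A B.
set f1 := f (x + h *: u) in A B *; set f2 := f (x + h *: v) in A B *.
rewrite (_ : h ^+ 2 * (a - b) =
  (g1 - f2 - f1 + f x - h ^+ 2 * b) - (g1 - f1 - f2 + f x - h ^+ 2 * a)); last by ring.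
apply: le_trans (ler_normB _ _) _.
by apply: le_trans (lerD B A) _; rewrite -mulrDl -splitr.
Qed.

End Calculus.

Section Calculus2.
Context {R : realType} {V : normedModType R}.
Implicit Types (f g : V -> R) (x u v : V).

Lemma differentiable_fD f g x : differentiable f x -> differentiable g x ->
  differentiable (fun y => f y + g y) x.
Proof. exact: differentiableD. Qed.

Lemma differentiable_fN f x : differentiable f x -> differentiable (fun y => - f y) x.
Proof. exact: differentiableN. Qed.

Lemma differentiable_fM f g x : differentiable f x -> differentiable g x ->
  differentiable (fun y => f y * g y) x.
Proof. exact: differentiableM. Qed.

Lemma differentiable_fsum (I : Type) (r : seq I) (P : pred I) (F : I -> V -> R) x :
  (forall i, P i -> differentiable (F i) x) ->
  differentiable (fun y => \sum_(i <- r | P i) F i y) x.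
Proof.
move=> dF; elim: r => [|i r IH].
  by under eq_fun do rewrite big_nil; exact: differentiable_cst.
under eq_fun do rewrite big_cons.
case: (boolP (P i)) => // Pi.
by apply: differentiable_fD => //; exact: dF.
Qed.

Lemma differentiable_fprod (I : Type) (r : seq I) (P : pred I) (F : I -> V -> R) x :
  (forall i, P i -> differentiable (F i) x) ->
  differentiable (fun y => \prod_(i <- r | P i) F i y) x.
Proof.
move=> dF; elim: r => [|i r IH].
  by under eq_fun do rewrite big_nil; exact: differentiable_cst.
under eq_fun do rewrite big_cons.
case: (boolP (P i)) => // Pi.
by apply: differentiable_fM => //; exact: dF.
Qed.

Lemma derive_fD f g x v : differentiable f x -> differentiable g x ->
  'D_v (fun y => f y + g y) x = 'D_v f x + 'D_v g x.
Proof. by move=> df dg; apply: deriveD; exact: diff_derivable. Qed.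

Lemma derive_fN f x v : differentiable f x ->
  'D_v (fun y => - f y) x = - 'D_v f x.
Proof. by move=> df; apply: deriveN; exact: diff_derivable. Qed.

Lemma derive_fM f g x v : differentiable f x -> differentiable g x ->
  'D_v (fun y => f y * g y) x = 'D_v f x * g x + f x * 'D_v g x.
Proof.
move=> df dg; rewrite (@deriveM _ _ f g); [|exact: diff_derivable..].
by rewrite /GRing.scale /= addrC [g x * _]mulrC.
Qed.

Lemma derive_fsum (I : Type) (r : seq I) (P : pred I) (F : I -> V -> R) x v :
  (forall i, P i -> differentiable (F i) x) ->
  'D_v (fun y => \sum_(i <- r | P i) F i y) x = \sum_(i <- r | P i) 'D_v (F i) x.
Proof.
move=> dF; elim: r => [|i r IH].
  by under eq_fun do rewrite big_nil; rewrite big_nil derive_cst.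
under eq_fun do rewrite big_cons.
rewrite big_cons; case: (boolP (P i)) => // Pi.
by rewrite derive_fD ?IH//; [exact: dF|exact: differentiable_fsum].
Qed.

End Calculus2.

(** * Uniqueness for linear systems along a segment *)

Section ODE.
Context {R : realType} {V : normedModType R}.
Implicit Types (f g : V -> R) (x u v : V).

(** Gronwall for the sum of squares [U]: its derivative is at most c [U] with c = 2 |L| m, so exp(-c
    s) [U] does not increase from its initial value 0. *)
Lemma linear_ode_zero (T : finType) (u : T -> V -> R) (L : R) x w :
  (forall s : R, 0 <= s <= 1 -> forall j,
     differentiable (u j) (x + s *: w) /\
     `|'D_w (u j) (x + s *: w)| <= L * \sum_k `|u k (x + s *: w)|) ->
  (forall j, u j x = 0) -> forall j, u j (x + w) = 0.
Proof.
move=> du u0.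
pose m : R := #|T|%:R.
pose U (s : R) := \sum_j u j (x + s *: w) ^+ 2.
have dus (s : R) j : 0 <= s <= 1 ->
    is_derive s 1 (fun t => u j (x + t *: w)) ('D_w (u j) (x + s *: w)).
  by move=> /du/(_ j)[? _]; exact: is_derive_line.
have dfs (s : R) j : 0 <= s <= 1 -> differentiable (fun t : R => u j (x + t *: w)) s.
  by move=> hs; have [/derivable1_diffP] := dus s j hs.
have dUs (s : R) : 0 <= s <= 1 -> differentiable U s.
  move=> hs; apply: differentiable_fsum => j _.
  by under eq_fun do rewrite expr2; apply: differentiable_fM; apply: dfs.
have DU (s : R) : 0 <= s <= 1 -> 'D_1 U s <= 2 * (`|L| * m) * U s.
  move=> hs; rewrite derive_fsum; last first.
    by move=> j _; under eq_fun do rewrite expr2; apply: differentiable_fM; apply: dfs.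
  have -> : \sum_(i : T) 'D_1 (fun y : R => u i (x + y *: w) ^+ 2) s =
      \sum_i 2 * (u i (x + s *: w) * 'D_w (u i) (x + s *: w)).
    apply: eq_bigr => i _; under eq_fun do rewrite expr2.
    rewrite derive_fM; [|exact: dfs..].
    have [_ ->] := dus s i hs.
    by ring.
  rewrite -mulr_sumr -mulrA ler_pM2l//.
  apply: (@le_trans _ _ (\sum_i \sum_k `|L| * (`|u i (x + s *: w)| * `|u k (x + s *: w)|))).
    apply: ler_sum => i _; rewrite -mulr_sumr -mulr_sumr mulrCA.
    apply: le_trans (ler_norm _) _; rewrite normrM ler_wpM2l//.
    have [_ b] := du s hs i; apply: le_trans b _.
    by rewrite ler_wpM2r ?ler_norm// sumr_ge0.
  under eq_bigr do rewrite -mulr_sumr.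
  rewrite -mulr_sumr -mulrA ler_wpM2l//.
  (* By 2ab <= a^2 + b^2 the double sum is at most m times [U]. *)
  apply: (@le_trans _ _ (\sum_i \sum_k (u i (x + s *: w) ^+ 2 + u k (x + s *: w) ^+ 2) / 2)).
    apply: ler_sum => i _; apply: ler_sum => k _.
    rewrite -[u i _ ^+ 2]real_normK ?num_real// -[u k _ ^+ 2]real_normK ?num_real//.
    set a := `|u i _|; set b := `|u k _|.
    by have := sqr_ge0 (a - b); rewrite sqrrB; lra.
  rewrite le_eqVlt; apply/orP; left; apply/eqP.
  under eq_bigr do rewrite -mulr_suml big_split /= sumr_const.
  rewrite -mulr_suml big_split /= sumr_const -/(U s).
  under eq_bigr do rewrite -mulr_natl.
  by rewrite -mulr_sumr -/(U s) -[U s *+ _]mulr_natl cardT -cardE -/m; field.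
pose c := 2 * (`|L| * m).
pose g (s : R) := expR (- c * s) * U s.
have dexp (s : R) : is_derive s 1 (fun t : R => expR (- c * t)) (- c * expR (- c * s)).
  have hc : is_derive s 1 (fun t : R => - c * t) (- c).
    have := @is_deriveZ R R R (id : R -> R) (- c) s 1 1 (is_derive_id s 1).
    by rewrite [_ *: 1]mulr1.
  have := @is_derive1_comp R expR (fun t : R => - c * t) s _ _ (is_derive_expR _) hc.
  by rewrite mulrC.
have dg (s : R) : 0 <= s <= 1 -> differentiable g s.
  move=> hs; apply: differentiable_fM; last exact: dUs.
  by apply/derivable1_diffP; have [] := dexp s.
have g1 : g 1 <= g 0.
  apply: (@ler0_derive1_le_cc R g 0 1).
  - by move=> s; rewrite in_itv /= => /andP[? ?]; apply/derivable1_diffP; apply: dg; rewrite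
    !ltW.
  - move=> s; rewrite in_itv /= => /andP[s0 s1]; rewrite derive1E derive_fM.
    + have [_ ->] := dexp s.
      have hs : 0 <= s <= 1 by rewrite !ltW.
      have := DU s hs; rewrite -/c => D.
      by have := expR_gt0 (- c * s) => /ltW e0; have := ler_wpM2l e0 D; lra.
    + by apply/derivable1_diffP; have [] := dexp s.
    + by apply: dUs; rewrite !ltW.
  - apply: derivable_within_continuous => s; rewrite in_itv /= => hs.
    by apply/derivable1_diffP; exact: dg.
  - by rewrite in_itv /= lexx ler01.
  - by rewrite in_itv /= lexx ler01.
  - exact: ler01.
have U0 : U 0 = 0 by rewrite /U big1// => j _; rewrite scale0r addr0 u0 expr0n.
have U1 : U 1 = 0.
  apply/eqP; rewrite eq_le; apply/andP; split; last by apply: sumr_ge0 => j _; exact: sqr_ge0.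
  by move: g1; rewrite /g U0 mulr0 pmulr_rle0 ?expR_gt0.
move=> j; apply/eqP; rewrite -sqrf_eq0; apply/eqP.
have /psumr_eq0P := U1; rewrite scale1r; apply => // k _; exact: sqr_ge0.
Qed.

End ODE.

(** * Differential forms on an open set *)

Section Forms.
Context {R : realType} {d : nat}.
Local Notation E := 'rV[R]_d.
Implicit Types (O : set E) (f g : E -> R) (eta : E -> E -> R) (x X : E).

Record form_on O eta : Prop := FormOn {
  form_lin : forall x, O x -> forall (c : R) X X', eta x (c *: X + X') = c * eta x X + eta x X';
  form_diff : forall x, O x -> forall X, differentiable (eta^~ X) x }.

(** X and X' are constant vector fields, so there is no bracket term. For a form the value is
    bilinear in X and X', which allows the values at x of a moving frame to be inserted. *)
Definition dform eta x X X' : R := 'D_X (eta^~ X') x - 'D_X' (eta^~ X) x.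

Definition wedge eta1 eta2 x X X' : R := eta1 x X * eta2 x X' - eta1 x X' * eta2 x X.

Section OneForm.
Variables (O : set E) (eta : E -> E -> R).
Hypothesis etaO : form_on O eta.

Lemma form0 x : O x -> eta x 0 = 0.
Proof.
move=> Ox; have := form_lin etaO Ox 1 0 0.
by rewrite scale1r addr0 mul1r; lra.
Qed.

Lemma formD x X X' : O x -> eta x (X + X') = eta x X + eta x X'.
Proof. by move=> Ox; have := form_lin etaO Ox 1 X X'; rewrite scale1r mul1r. Qed.

Lemma formZ x (c : R) X : O x -> eta x (c *: X) = c * eta x X.
Proof. by move=> Ox; have := form_lin etaO Ox c X 0; rewrite form0// !addr0. Qed.

Lemma form_sum x (I : Type) (r : seq I) (P : pred I) (F : I -> E) : O x ->
  eta x (\sum_(i <- r | P i) F i) = \sum_(i <- r | P i) eta x (F i).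
Proof.
move=> Ox; elim: r => [|i r IH]; first by rewrite !big_nil form0.
by rewrite !big_cons; case: ifP => // _; rewrite formD// IH.
Qed.

Lemma form_coord x X : O x -> eta x X = \sum_k X 0 k * eta x (delta_mx 0 k).
Proof.
move=> Ox; rewrite [in LHS](row_sum_delta X) form_sum//.
by apply: eq_bigr => k _; rewrite formZ.
Qed.

Lemma form_bounded x0 : O x0 ->
  exists C : R, \forall x \near x0, O x -> forall X, `|eta x X| <= C * `|X|.
Proof.
move=> Ox0.
pose C k : R := `|eta x0 (delta_mx 0 k)| + 1.
exists (\sum_k C k).
have near_k k : \forall x \near x0, `|eta x (delta_mx 0 k)| <= C k.
  have /differentiable_continuous/cvgr_dist_le c := form_diff etaO Ox0 (delta_mx 0 k).
  have := c 1 ltr01; apply: filterS => x /= b.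
  by rewrite /C -[X in `|X|](subrK (eta x0 (delta_mx 0 k))) addrC (le_trans (ler_normD _
    _))// lerD2l distrC.
have : \forall x \near x0, forall k, `|eta x (delta_mx 0 k)| <= C k.
  exact: filter_forall near_k.
apply: filterS => x bx Ox X; rewrite form_coord//.
rewrite (le_trans (ler_norm_sum _ _ _))// mulr_suml; apply: ler_sum => k _.
rewrite normrM mulrC; apply: ler_pM => //.
rewrite [leRHS]mx_normrE.
exact: (le_bigmax _ (fun ij : 'I_1 * 'I_d => `|X ij.1 ij.2|) (0, k)).
Qed.
End OneForm.

Lemma form_onD O eta1 eta2 : form_on O eta1 -> form_on O eta2 ->
  form_on O (fun x X => eta1 x X + eta2 x X).
Proof.
move=> h1 h2; split => x Ox.
  by move=> c X X'; rewrite (form_lin h1 Ox) (form_lin h2 Ox); ring.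
by move=> X; apply: differentiable_fD; [exact: (form_diff h1)|exact: (form_diff h2)].
Qed.

Lemma form_onM O f eta : (forall x, O x -> differentiable f x) -> form_on O eta ->
  form_on O (fun x X => f x * eta x X).
Proof.
move=> df h; split => x Ox.
  by move=> c X X'; rewrite (form_lin h)//; ring.
by move=> X; apply: differentiable_fM; [exact: df|exact: (form_diff h)].
Qed.

Lemma form_on0 O : form_on O (fun _ _ => 0).
Proof. by split=> [x _ c X X'|x _ X]; [ring|exact: differentiable_cst]. Qed.

Lemma form_on_sum O (I : Type) (r : seq I) (P : pred I) (eta : I -> E -> E -> R) :
  (forall i, P i -> form_on O (eta i)) ->
  form_on O (fun x X => \sum_(i <- r | P i) eta i x X).
Proof.
move=> h; split => x Ox.
  move=> c X X'; rewrite mulr_sumr -big_split; apply: eq_bigr => i Pi.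
  exact: (form_lin (h i Pi)).
by move=> X; apply: differentiable_fsum => i Pi; exact: (form_diff (h i Pi)).
Qed.

Section Open.
Variables (O : set E) (Oo : open O).

Lemma derive_eq_on f g x X : O x -> (forall y, O y -> f y = g y) -> 'D_X f x = 'D_X g x.
Proof.
move=> Ox fg; apply: near_eq_derive.
have : \forall y \near x, O y by exact: open_nbhs_nbhs.
by apply: filterS => y /fg.
Qed.

Lemma derive_eq0_on f x X : O x -> (forall y, O y -> f y = 0) -> 'D_X f x = 0.
Proof. by move=> Ox f0; rewrite (derive_eq_on X Ox f0) derive_cst. Qed.

Lemma dform_eq_on eta1 eta2 x X X' : O x -> (forall y Z, O y -> eta1 y Z = eta2 y Z) ->
  dform eta1 x X X' = dform eta2 x X X'.
Proof. by move=> Ox h; congr (_ - _); apply: derive_eq_on => // y /h. Qed.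

Lemma dform_eq0_on eta x X X' : O x -> (forall y Z, O y -> eta y Z = 0) ->
  dform eta x X X' = 0.
Proof. by move=> Ox h; rewrite /dform !derive_eq0_on ?subr0// => y /h. Qed.

Lemma dformM f eta x X X' : differentiable f x -> form_on O eta -> O x ->
  dform (fun y Z => f y * eta y Z) x X X' =
    'D_X f x * eta x X' - 'D_X' f x * eta x X + f x * dform eta x X X'.
Proof.
move=> df h Ox; rewrite /dform !derive_fM//; try exact: (form_diff h).
by ring.
Qed.

Lemma dform_sum (I : Type) (r : seq I) (P : pred I) (eta : I -> E -> E -> R) x X X' : O x ->
  (forall i, P i -> form_on O (eta i)) ->
  dform (fun y Z => \sum_(i <- r | P i) eta i y Z) x X X' =
    \sum_(i <- r | P i) dform (eta i) x X X'.
Proof.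
move=> Ox h; rewrite /dform !derive_fsum ?sumrB// => i Pi; exact: (form_diff (h i Pi)).
Qed.

(** [O'] is chosen before the solution u, which in the application depends on x1. A ball on which
    the coefficients are bounded works: it contains the segment from x1 to x0. *)
Lemma parallel_vanish (T : finType) (M : T -> T -> E -> E -> R) x0 : O x0 ->
  (forall j k, form_on O (M j k)) ->
  exists O', [/\ open O', O' x0, O' `<=` O &
    forall u : T -> E -> R,
      (forall j x, O x -> differentiable (u j) x) ->
      (forall j x X, O x -> 'D_X (u j) x = \sum_k M j k x X * u k x) ->
      forall x1, O' x1 -> (forall j, u j x1 = 0) -> forall j, u j x0 = 0].
Proof.
move=> Ox0 hM.
have [C hC] : exists C : R, \forall x \near x0, O x -> forall j k X, `|M j k x X| <= C * `|X|.
  have /choice[C hC] : forall jk : T * T, exists C : R, \forall x \near x0, O x ->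
      forall X, `|M jk.1 jk.2 x X| <= C * `|X|.
    by move=> jk; exact: form_bounded.
  exists (\sum_jk `|C jk|).
  have : \forall x \near x0, forall jk, O x -> forall X, `|M jk.1 jk.2 x X| <= C jk * `|X|.
    exact: filter_forall hC.
  apply: filterS => x b Ox j k X; apply: le_trans (b (j, k) Ox X) _.
  rewrite ler_wpM2r// (le_trans (ler_norm _))// (bigD1 (j, k))//= lerDl sumr_ge0//.
have /nbhs_ballP[r /= r0 br] : nbhs x0 (O `&` [set x | O x -> forall j k X, `|M j k x X| <= C
  * `|X|]).
  by apply: filterI => //; exact: open_nbhs_nbhs.
exists (ball x0 r); split; [exact: ball_open|exact: ballxx|by move=> x /br[]|].
move=> u du Du x1 x1r u0 j.
have inb s : 0 <= s <= 1 -> ball x0 r (x1 + s *: (x0 - x1)).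
  move=> /andP[s0 s1]; rewrite -ball_normE /ball_ /=.
  have -> : x0 - (x1 + s *: (x0 - x1)) = (1 - s) *: (x0 - x1).
    by rewrite scalerBl scale1r opprD addrA.
  rewrite normrZ ger0_norm ?subr_ge0//.
  move: x1r; rewrite -ball_normE /ball_ /=; apply: le_lt_trans.
  by rewrite ler_piMl// lerBlDr lerDl.
rewrite -[x0](subrKC x1).
apply: (@linear_ode_zero _ _ _ u (`|C| * `|x0 - x1|)) => // s hs k.
have [Oy /(_ Oy) bM] := br _ (inb s hs).
split; first exact: du.
rewrite Du// (le_trans (ler_norm_sum _ _ _))// mulr_sumr; apply: ler_sum => i _.
rewrite normrM ler_wpM2r// (le_trans (bM _ _ _))// ler_wpM2r//.
exact: ler_norm.
Qed.
End Open.
End Forms.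

Lemma sum_deltaL (R : pzRingType) (I : finType) (f : I -> R) i :
  \sum_k (k == i)%:R * f k = f i.
Proof.
rewrite (bigD1 i)//= eqxx mul1r big1 ?addr0// => k /negPf ->.
by rewrite mul0r.
Qed.

Lemma sum_deltaP (R : pzRingType) (I : finType) (p : pred I) (f : I -> R) i : p i ->
  \sum_(k | p k) (k == i)%:R * f k = f i.
Proof.
move=> pi; rewrite (bigD1 i)//= eqxx mul1r big1 ?addr0// => k /andP[_ /negPf ->].
by rewrite mul0r.
Qed.

Lemma natb (R : pzSemiRingType) : ((true%:R = 1 :> R) * (false%:R = 0 :> R))%type.
Proof. by []. Qed.

(** * Consequences of the structure equations *)

Section Core.
Context {R : realType} {d : nat}.
Local Notation E := 'rV[R]_d.
Variables (O : set E) (Oo : open O).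
Variable bl : 'I_d -> nat.
Hypothesis bl_lt : forall i, (bl i < 4)%N.

(* [bl] numbers the blocks {1}, .., {4} from 0, and omega_0^i = x_i theta^i,
   omega_1^i = y_i theta^i with (x_i, y_i) = (0, 1), (1, 0), (1, -1), (1, 1) on
   the four blocks.  [Delta i j] vanishes exactly when i and j share a block. *)
Definition blx i : R := if bl i == 0%N then 0 else 1.
Definition bly i : R := [:: 1; 0; -1; 1]`_(bl i).
Definition Delta i j : R := blx i * bly j - bly i * blx j.
Local Notation b0 i := (bl i == 0%N).

Lemma sum_delta0 (f : 'I_d -> R) i : b0 i ->
  \sum_(k | b0 k) (k == i)%:R * f k = f i.
Proof. exact: (@sum_deltaP _ _ (fun k => b0 k)). Qed.

Lemma Delta_eq0 i j : bl i = bl j -> Delta i j = 0.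
Proof. by move=> h; rewrite /Delta /blx /bly h; ring. Qed.

(** [Delta] is the determinant of (x_i, y_i) and (x_j, y_j), and the four blocks give four different
    points of the projective line. *)
Lemma Delta_neq0 i j : bl i <> bl j -> Delta i j != 0.
Proof.
rewrite /Delta /blx /bly; have := bl_lt i; have := bl_lt j.
case: (bl i) => [|[|[|[|//]]]]; case: (bl j) => [|[|[|[|//]]]] //= _ _ _; lra.
Qed.

Lemma DeltaC i j : Delta j i = - Delta i j.
Proof. by rewrite /Delta; ring. Qed.

Lemma blx0 i : b0 i -> blx i = 0. Proof. by rewrite /blx => ->. Qed.
Lemma bly0 i : b0 i -> bly i = 1. Proof. by rewrite /bly => /eqP ->. Qed.
Lemma blx1 i : ~~ b0 i -> blx i = 1. Proof. by rewrite /blx => /negPf ->. Qed.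

Lemma blx_eq i j : bl i = bl j -> blx i = blx j.
Proof. by rewrite /blx => ->. Qed.
Lemma bly_eq i j : bl i = bl j -> bly i = bly j.
Proof. by rewrite /bly => ->. Qed.

Lemma b0Nbl i j : b0 i -> ~~ b0 j -> bl i <> bl j.
Proof. by move=> /eqP -> /eqP h /esym. Qed.

(* phi = omega_0^0 = omega_1^1, kap = omega_(n+1)^0, al_i = omega_i^0,
   be_i = omega_i^1, om_ij = omega_i^j, and e is the frame dual to th. *)
Variables (phi kap : E -> E -> R) (th al be : 'I_d -> E -> E -> R).
Variables (om : 'I_d -> 'I_d -> E -> E -> R) (S : 'I_d -> 'I_d -> 'I_d -> E -> R).
Variable e : 'I_d -> E -> E.

Hypothesis phiF : form_on O phi.
Hypothesis kapF : form_on O kap.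
Hypothesis thF : forall i, form_on O (th i).
Hypothesis alF : forall i, form_on O (al i).
Hypothesis beF : forall i, form_on O (be i).
Hypothesis omF : forall i j, form_on O (om i j).
Hypothesis dS : forall i j k x, O x -> differentiable (S i j k) x.
Hypothesis de : forall i k x, O x -> differentiable (fun y => e i y 0 k) x.

Hypothesis thE : forall x i j, O x -> th i x (e j x) = (i == j)%:R.
Hypothesis eE : forall x X, O x -> X = \sum_i th i x X *: e i x.

Hypothesis omC : forall x X i j, O x -> om j i x X = - om i j x X.
Hypothesis omS : forall x X i j, O x ->
  Delta i j * om i j x X = \sum_k S i j k x * th k x X.
Hypothesis SC12 : forall i j k x, S j i k x = S i j k x.
Hypothesis SC23 : forall i j k x, S i k j x = S i j k x.
Hypothesis S0 : forall i j k x, bl i = bl j -> S i j k x = 0.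

(** The structure equations of omega_0^i and omega_1^i. On {1} only the second contains d theta^i,
    on {2} only the first. *)
Hypothesis sth0 : forall x X X' i, O x ->
  blx i * dform (th i) x X X' =
    blx i * wedge phi (th i) x X X' + \sum_j blx j * wedge (th j) (om j i) x X X'.
Hypothesis sth1 : forall x X X' i, O x ->
  bly i * dform (th i) x X X' =
    bly i * wedge phi (th i) x X X' + \sum_j bly j * wedge (th j) (om j i) x X X'.
(** What remains of the structure equations of omega_0^0, omega_0^1, omega_1^0, omega_1^1: the
    second order conditions and d omega_0^0 = 0 remove all other terms. *)
Hypothesis s00 : forall x X X', O x -> \sum_i blx i * wedge (th i) (al i) x X X' = 0.
Hypothesis s01 : forall x X X', O x -> \sum_i blx i * wedge (th i) (be i) x X X' = 0.
Hypothesis s10 : forall x X X', O x -> \sum_i bly i * wedge (th i) (al i) x X X' = 0.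
Hypothesis s11 : forall x X X', O x -> \sum_i bly i * wedge (th i) (be i) x X X' = 0.
Hypothesis som : forall x X X' i j, O x ->
  dform (om i j) x X X' =
    blx j * wedge (al i) (th j) x X X' + bly j * wedge (be i) (th j) x X X'
    + bly i * wedge (th i) (be j) x X X' + blx i * wedge (th i) (al j) x X X'
    + \sum_k wedge (om i k) (om k j) x X X'.
Hypothesis sbe : forall x X X' j, O x ->
  dform (be j) x X X' =
    wedge (be j) phi x X X' + \sum_k wedge (om j k) (be k) x X X'
    - blx j * wedge (th j) kap x X X'.

Variable a : 'I_d.
Hypothesis a0 : b0 a.
Hypothesis Sa : forall x j k, O x -> S a j k x = 0.
Variables i1 i2 i3 : 'I_d.
Hypothesis bi1 : bl i1 = 1%N.
Hypothesis bi2 : bl i2 = 2%N.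
Hypothesis bi3 : bl i3 = 3%N.

Lemma S_eq23 i j k x : bl j = bl k -> S i j k x = 0.
Proof. by move=> h; rewrite -SC12 -SC23 -SC12 S0. Qed.

Lemma S_eq13 i j k x : bl i = bl k -> S i j k x = 0.
Proof. by move=> h; rewrite -SC23 S0. Qed.

Lemma sum_wedge_th (c : 'I_d -> R) (eta : 'I_d -> E -> E -> R) x i j : O x ->
  \sum_k c k * wedge (th k) (eta k) x (e i x) (e j x) =
  c i * eta i x (e j x) - c j * eta j x (e i x).
Proof.
move=> Ox; rewrite -(sum_deltaL (fun k => c k * eta k x (e j x))).
rewrite -(sum_deltaL (fun k => c k * eta k x (e i x))) -sumrB.
by apply: eq_bigr => k _; rewrite /wedge !thE//; ring.
Qed.

Lemma omE x i j k : O x -> bl i <> bl j -> om i j x (e k x) = S i j k x / Delta i j.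
Proof.
move=> Ox /Delta_neq0 D0; apply: (mulfI D0); rewrite omS// [RHS]mulrC divfK//.
under eq_bigr do rewrite thE// mulrC.
by rewrite sum_deltaL.
Qed.

Lemma omii x X i : O x -> om i i x X = 0.
Proof. by move=> Ox; have := omC X i i Ox; lra. Qed.

Section Offdiag.
Variable eta : 'I_d -> E -> E -> R.
Hypothesis s0 : forall x X X', O x -> \sum_i blx i * wedge (th i) (eta i) x X X' = 0.
Hypothesis s1 : forall x X X', O x -> \sum_i bly i * wedge (th i) (eta i) x X X' = 0.

(** On (e_i, e_j) the two relations are a homogeneous linear system for eta_i(e_j) and eta_j(e_i),
    with determinant [Delta i j] up to sign. *)
Lemma eta_off x i j : O x -> bl i <> bl j -> eta i x (e j x) = 0.
Proof.
move=> Ox /Delta_neq0; have := s0 (e i x) (e j x) Ox; have := s1 (e i x) (e j x) Ox.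
rewrite !sum_wedge_th// => h1 h0 D0; apply/(mulfI D0); rewrite mulr0 /Delta.
have -> : (blx i * bly j - bly i * blx j) * eta i x (e j x) =
  bly j * (blx i * eta i x (e j x) - blx j * eta j x (e i x))
  - blx j * (bly i * eta i x (e j x) - bly j * eta j x (e i x)) by ring.
by rewrite h0 h1; ring.
Qed.

Lemma eta_sym x i j : O x -> eta i x (e j x) = eta j x (e i x).
Proof.
move=> Ox; case: (eqVneq (bl i) (bl j)) => [bij|/eqP bij]; last first.
  by rewrite !eta_off//; exact/nesym.
have := s0 (e i x) (e j x) Ox; have := s1 (e i x) (e j x) Ox.
rewrite !sum_wedge_th// (blx_eq bij) (bly_eq bij).
case: (boolP (b0 j)) => bj; first by rewrite (bly0 bj); lra.
by rewrite (blx1 bj); lra.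
Qed.
End Offdiag.

Definition al_off := eta_off s00 s10.
Definition be_off := eta_off s01 s11.
Definition be_sym := eta_sym s01 s11.

(* Equal to [eta x (e i x)] on O only, but visibly differentiable. *)
Definition eval_at (eta : E -> E -> R) i x := \sum_k e i x 0 k * eta x (delta_mx 0 k).
Definition coefA := eval_at (al a) a.
Definition coefB := eval_at (be a) a.
Definition beM b := eval_at (be b).
Definition alM b := eval_at (al b).
Definition coefH j x := coefA x + bly j * coefB x.

Lemma eval_atE eta i x : form_on O eta -> O x -> eval_at eta i x = eta x (e i x).
Proof. by move=> h Ox; rewrite [RHS](form_coord h). Qed.

Lemma eval_at_diff eta i x : form_on O eta -> O x -> differentiable (eval_at eta i) x.
Proof.
move=> h Ox; apply: differentiable_fsum => k _; apply: differentiable_fM; first exact: de.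
exact: (form_diff h).
Qed.

Lemma coefH_diff j x : O x -> differentiable (coefH j) x.
Proof.
move=> Ox; apply: differentiable_fD; first exact: eval_at_diff.
by apply: differentiable_fM; [exact: differentiable_cst|exact: eval_at_diff].
Qed.

Lemma form_basis eta x X : form_on O eta -> O x ->
  eta x X = \sum_i th i x X * eta x (e i x).
Proof.
move=> h Ox; rewrite [in LHS](eE X Ox) (form_sum h)//.
by apply: eq_bigr => i _; rewrite (formZ h).
Qed.

Lemma om_a x X j : O x -> ~~ b0 j -> om a j x X = 0.
Proof.
move=> Ox bj; apply: (mulfI (Delta_neq0 (b0Nbl a0 bj))).
by rewrite omS// mulr0 big1// => k _; rewrite Sa// mul0r.
Qed.

(** As omega_a^j = 0, its structure equation on (e_a, e_k) is algebraic. The quadratic terms drop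
    out: omega_a^l = 0 for l outside {1}, and for l in {1} the form omega_l^j kills e_a and e_k,
    since S vanishes when two indices share a block. This is where A and B come from. *)
Lemma be_diag x j k : O x -> ~~ b0 j -> be j x (e k x) = - ((j == k)%:R * coefH j x).
Proof.
move=> Ox bj; case: (eqVneq (bl j) (bl k)) => [bjk|/eqP bjk]; last first.
  rewrite be_off//; case: eqP => [jk|_]; first by rewrite jk in bjk.
  by rewrite mul0r oppr0.
have bk : ~~ b0 k by rewrite -bjk.
have ak : (a == k) = false by apply/eqP => h; rewrite -h a0 in bk.
have ja : (j == a) = false by apply/eqP => h; rewrite h a0 in bj.
have := som (e a x) (e k x) a j Ox.
rewrite (dform_eq0_on Oo _ _ Ox); last by move=> y Z Oy; exact: om_a.
rewrite big1; last first.
  move=> l _; rewrite /wedge; case: (boolP (b0 l)) => bl0; last first.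
    by rewrite !om_a//; ring.
  have lj := b0Nbl bl0 bj.
  by rewrite !(omE _ Ox lj) (S_eq23 _ _ bjk) (S_eq13 _ _ (etrans (eqP bl0) (esym (eqP a0))))
    mul0r; ring.
rewrite /wedge !thE// eqxx ak ja (blx0 a0) (bly0 a0) (blx1 bj) /coefH /coefA /coefB !eval_atE//.
by rewrite !natb => h; lra.
Qed.

Lemma be_nonprime x X j : O x -> ~~ b0 j -> be j x X = - coefH j x * th j x X.
Proof.
move=> Ox bj; rewrite (form_basis X (beF j) Ox).
rewrite -(sum_deltaL (fun i => - coefH i x * th i x X) j).
apply: eq_bigr => i _; rewrite be_diag// [j == i]eq_sym.
by case: eqP => [->|_]; rewrite natb; ring.
Qed.

Lemma block0_form eta b x X : (forall i j, O x -> bl i <> bl j -> eta i x (e j x) = 0) ->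
  form_on O (eta b) -> b0 b -> O x ->
  eta b x X = \sum_(c | b0 c) eval_at (eta b) c x * th c x X.
Proof.
move=> off h bb Ox; rewrite (form_basis X h Ox) [RHS]big_mkcond; apply: eq_bigr => c _.
case: ifPn => bc; first by rewrite eval_atE// mulrC.
by rewrite off ?mulr0//; exact: b0Nbl.
Qed.

Lemma be_block0 x X b : O x -> b0 b -> be b x X = \sum_(c | b0 c) beM b c x * th c x X.
Proof. by move=> Ox bb; apply: block0_form => // i j; exact: be_off. Qed.

Lemma al_block0 x X b : O x -> b0 b -> al b x X = \sum_(c | b0 c) alM b c x * th c x X.
Proof. by move=> Ox bb; apply: block0_form => // i j; exact: al_off. Qed.

Lemma Delta_block0 b j : b0 b -> ~~ b0 j -> Delta b j = -1.
Proof. by move=> bb bj; rewrite /Delta (blx0 bb) (bly0 bb) (blx1 bj); ring. Qed.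

Lemma om_block0 x X b j : O x -> b0 b -> ~~ b0 j ->
  om b j x X = \sum_k - S b j k x * th k x X.
Proof.
move=> Ox bb bj; have := omS X b j Ox; rewrite Delta_block0// mulN1r => /eqP.
by rewrite eqr_oppLR => /eqP ->; rewrite -sumrN; apply: eq_bigr => k _; rewrite mulNr.
Qed.

(* The component of the structure equation of om_bj on (e_c, e_j). *)
Lemma gauss_eq x b c j : O x -> b0 b -> b0 c -> ~~ b0 j ->
  2 * \sum_k S b j k x * S c j k x / Delta j k =
  (alM b c x - (b == c)%:R * coefA x) + bly j * (beM b c x - (b == c)%:R * coefB x).
Proof.
move=> Ox bb bc bj.
have cj : (c == j) = false by apply/eqP => h; rewrite -h bc in bj.
have bj' : (b == j) = false by apply/eqP => h; rewrite -h bb in bj.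
have := som (e c x) (e j x) b j Ox.
rewrite (dform_eq_on Oo (e c x) (e j x) Ox
  (eta2 := fun y Z => \sum_k - S b j k y * th k y Z)); last first.
  by move=> y Z Oy; exact: om_block0.
rewrite (dform_sum (O := O))//; last first.
  by move=> k _; apply: form_onM => // y Oy; apply: differentiable_fN; exact: dS.
have -> : \sum_k dform (fun y Z => - S b j k y * th k y Z) x (e c x) (e j x) =
    \sum_k S b j k x * S c j k x / Delta j k.
  apply: eq_bigr => k _; rewrite (dformM (O := O))//; last by apply: differentiable_fN;
    exact: dS.
  rewrite !thE//.
  (* Derivatives of S could appear only for k = j or k = c, but S_bjj and S_bjc repeat a block and
     vanish identically. *)
  have z1 X : 'D_X (fun y => - S b j k y) x * (k == j)%:R = 0.
    case: eqP => [->|]; last by rewrite mulr0.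
    by rewrite (derive_eq0_on Oo) ?mul0r// => y _; rewrite S_eq23 ?oppr0.
  have z2 X : 'D_X (fun y => - S b j k y) x * (k == c)%:R = 0.
    case: eqP => [->|]; last by rewrite mulr0.
    rewrite (derive_eq0_on Oo) ?mul0r// => y _; rewrite S_eq13 ?oppr0//.
    by rewrite (eqP bb) (eqP bc).
  rewrite z1 z2 subr0 add0r.
  case: (eqVneq (bl j) (bl k)) => [jk|/eqP jk]; first by rewrite (S_eq23 _ _ jk) oppr0 !mul0r.
  case: (boolP (b0 k)) => bk.
    by rewrite (S_eq13 j x (etrans (eqP bb) (esym (eqP bk)))) oppr0 !mul0r.
  have := sth0 (e c x) (e j x) k Ox.
  rewrite sum_wedge_th// (blx1 bk) (blx1 bj) (blx0 bc) /wedge !thE// (omE _ Ox jk).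
  have -> : (k == j) = false by apply/eqP => h; rewrite h in jk.
  have -> : (k == c) = false by apply/eqP => h; rewrite h bc in bk.
  have -> : S j k c x = S c j k x by rewrite -SC23 SC12.
  rewrite !natb => h.
  have {}h : dform (th k) x (e c x) (e j x) = - (S c j k x / Delta j k) by lra.
  by rewrite h; ring.
(* The products of connection forms reproduce the sum obtained from d theta^k with the opposite
   sign; hence the factor 2. *)
have -> : \sum_k wedge (om b k) (om k j) x (e c x) (e j x) =
    - \sum_k S b j k x * S c j k x / Delta j k.
  rewrite -sumrN; apply: eq_bigr => k _; rewrite /wedge.
  case: (boolP (b0 k)) => bk.
    have kj := b0Nbl bk bj.
    rewrite !(omE _ Ox kj) (S_eq23 k x erefl) (S_eq13 j x (etrans (eqP bk) (esym (eqP bc)))).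
    by rewrite (S_eq13 j x (etrans (eqP bb) (esym (eqP bk)))); ring.
  have bkb := b0Nbl bb bk.
  rewrite !(omE _ Ox bkb) (S_eq13 k x (etrans (eqP bb) (esym (eqP bc)))) (Delta_block0 bb bk).
  case: (eqVneq (bl j) (bl k)) => [jk|/eqP jk].
    by rewrite (S_eq23 _ _ (esym jk)) (S_eq23 _ _ jk); ring.
  rewrite !(omE _ Ox (nesym jk)) DeltaC -[S b k j x]SC23.
have -> : S k j c x = S c j k x by rewrite -SC12 -SC23 -SC12.
  by rewrite !invrN invr1; ring.
rewrite /wedge !thE// !(be_diag _ Ox bj) eqxx bj' [j == c]eq_sym cj (blx0 bb) (bly0 bb) (blx1
  bj) !natb.
rewrite /alM /beM !eval_atE// /coefH => h.
lra.
Qed.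

Lemma beM_sym x b c : O x -> beM b c x = beM c b x.
Proof. by move=> Ox; rewrite /beM !eval_atE//; exact: be_sym. Qed.

(** * The common kernel K of the F's in block {1} *)

Section Kernel.
Variables (x : E) (v : 'I_d -> R).
Hypothesis Ox : O x.
Definition kerS j k := \sum_(b | b0 b) v b * S b j k x.
(** The entries of (P - B) v; [kerQ] is the same for the matrix of the omega_b^0 and A. *)
Definition kerP c := \sum_(b | b0 b) v b * (beM b c x - (b == c)%:R * coefB x).
Definition kerQ c := \sum_(b | b0 b) v b * (alM b c x - (b == c)%:R * coefA x).

Lemma gauss_eq_ker c j : b0 c -> ~~ b0 j ->
  2 * \sum_k kerS j k * S c j k x / Delta j k = kerQ c + bly j * kerP c.
Proof.
move=> bc bj; rewrite /kerQ /kerP [X in _ = _ + X]mulr_sumr -big_split /=.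
have -> : \sum_(b | b0 b) (v b * (alM b c x - (b == c)%:R * coefA x) +
    bly j * (v b * (beM b c x - (b == c)%:R * coefB x))) =
  \sum_(b | b0 b) v b * (2 * \sum_k S b j k x * S c j k x / Delta j k).
  by apply: eq_bigr => b bb; rewrite gauss_eq//; ring.
under [RHS]eq_bigr do rewrite mulrCA mulr_sumr.
rewrite -mulr_sumr exchange_big /=; congr (_ * _); apply: eq_bigr => k _.
by rewrite /kerS !mulr_suml; apply: eq_bigr => b _; ring.
Qed.

Lemma kerSC j k : kerS j k = kerS k j.
Proof. by apply: eq_bigr => b _; rewrite SC23. Qed.

Lemma kerS0 j k : bl j = bl k -> kerS j k = 0.
Proof. by move=> jk; apply: big1 => b _; rewrite (S_eq23 _ _ jk) mulr0. Qed.

(** The left side of [gauss_eq_ker] vanishes for every j outside {1}, and y_j = -1 on {3}, y_j = 1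
    on {4} separate the two summands on the right. *)
Lemma kerS_kerPQ : (forall j k, ~~ b0 j -> ~~ b0 k -> kerS j k = 0) ->
  forall c, b0 c -> kerP c = 0 /\ kerQ c = 0.
Proof.
move=> f0 c bc.
have z j : ~~ b0 j -> kerQ c + bly j * kerP c = 0.
  move=> bj; rewrite -gauss_eq_ker// big1 ?mulr0// => k _.
  case: (boolP (b0 k)) => bk; last by rewrite f0// !mul0r.
  by rewrite (S_eq13 j x (etrans (eqP bc) (esym (eqP bk)))) mulr0 mul0r.
have := z i2; have := z i3; rewrite bi2 bi3 /bly bi2 bi3 /= => /(_ isT) z1 /(_ isT) z2.
by split; lra.
Qed.

(* The sum of the [kerS j k ^+ 2 / Delta j k] over k is then the same for all j,
   nonnegative for j in {3} and nonpositive for j in {4}. *)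
Lemma kerP_kerS : (forall c, b0 c -> kerP c = 0) ->
  forall j k, ~~ b0 j -> ~~ b0 k -> kerS j k = 0.
Proof.
move=> p0.
pose N j := \sum_(k | ~~ b0 k) kerS j k ^+ 2 / Delta j k.
pose q := \sum_(c | b0 c) v c * kerQ c.
have Nq j : ~~ b0 j -> 2 * N j = q.
  move=> bj; rewrite /q.
  have -> : \sum_(c | b0 c) v c * kerQ c =
      \sum_(c | b0 c) v c * (2 * \sum_k kerS j k * S c j k x / Delta j k).
    by apply: eq_bigr => c bc; rewrite gauss_eq_ker// p0// mulr0 addr0.
  under [RHS]eq_bigr do rewrite mulrCA mulr_sumr.
  rewrite -mulr_sumr exchange_big /=; congr (_ * _).
  rewrite /N big_mkcond /=; apply: eq_bigr => k _.
  case: ifPn => bk; last first.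
    rewrite negbK in bk; rewrite big1// => c bc.
    by rewrite (S_eq13 j x (etrans (eqP bc) (esym (eqP bk)))) mulr0 mul0r mulr0.
  rewrite expr2 {2}/kerS mulr_sumr mulr_suml; apply: eq_bigr => c _.
  by ring.
have D2 j k : bl j = 2 -> ~~ b0 k -> 0 <= Delta j k.
  move=> bj bk; rewrite /Delta (blx1 bk) blx1 ?bj// /bly bj; move: bk (bl_lt k).
  by case: (bl k) => [|[|[|[|//]]]] //= _ _; lra.
have D3 j k : bl j = 3 -> ~~ b0 k -> 0 <= - Delta j k.
  move=> bj bk; rewrite /Delta (blx1 bk) blx1 ?bj// /bly bj; move: bk (bl_lt k).
  by case: (bl k) => [|[|[|[|//]]]] //= _ _; lra.
have t2 j k : bl j = 2 -> ~~ b0 k -> 0 <= kerS j k ^+ 2 / Delta j k.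
  by move=> bj bk; rewrite divr_ge0 ?sqr_ge0// D2.
have t3 j k : bl j = 3 -> ~~ b0 k -> 0 <= - (kerS j k ^+ 2 / Delta j k).
  by move=> bj bk; rewrite -mulrN -invrN divr_ge0 ?sqr_ge0// D3.
have N2 j : bl j = 2 -> 0 <= N j by move=> bj; apply: sumr_ge0 => k; exact: t2.
have N3 j : bl j = 3 -> 0 <= - N j.
  by move=> bj; rewrite -sumrN; apply: sumr_ge0 => k; exact: t3.
have q0 : q = 0.
  have := Nq i2; have := Nq i3; rewrite bi2 bi3 => /(_ isT) h3 /(_ isT) h2.
  by have := N2 _ bi2; have := N3 _ bi3; lra.
have {}N0 j : ~~ b0 j -> N j = 0 by move=> bj; have := Nq j bj; rewrite q0; lra.
(* Within a block [Delta j k] is 0, as is its inverse, and the quotient carries no information;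
   [kerS0] covers those pairs. *)
have sq0 j k : bl j <> bl k -> kerS j k ^+ 2 / Delta j k = 0 -> kerS j k = 0.
  move=> /Delta_neq0 D0 /eqP; rewrite mulf_eq0 invr_eq0 (negPf D0) orbF sqrf_eq0.
  by move/eqP.
have f2 j k : bl j = 2 -> ~~ b0 k -> kerS j k = 0.
  move=> bj bk; case: (eqVneq (bl j) (bl k)) => [/kerS0//|/eqP jk].
  apply: (sq0 _ _ jk); have /N0 : ~~ b0 j by rewrite bj.
  by move=> /psumr_eq0P; apply => // l; exact: t2.
have f3 j k : bl j = 3 -> ~~ b0 k -> kerS j k = 0.
  move=> bj bk; case: (eqVneq (bl j) (bl k)) => [/kerS0//|/eqP jk].
  apply: (sq0 _ _ jk); have /N0 : ~~ b0 j by rewrite bj.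
  move=> /eqP; rewrite -oppr_eq0 -sumrN => /eqP/psumr_eq0P h.
  by apply/eqP; rewrite -oppr_eq0; apply/eqP; apply: h => // l; exact: t3.
(* A pair without an index in {3} or {4} lies in {2} twice, which [jk] excludes. *)
move=> j k bj bk; case: (eqVneq (bl j) (bl k)) => [/kerS0//|jk].
have := bl_lt j; have := bl_lt k.
case Ej: (bl j) => [|[|[|[|//]]]]; [by rewrite Ej in bj| |by move=> _ _; exact: f2|by move=>
  _ _; exact: f3].
rewrite kerSC.
case Ek: (bl k) => [|[|[|[|//]]]]; [by rewrite Ek in bk| |by move=> _ _; exact: f2|by move=>
  _ _; exact: f3].
by rewrite Ej Ek in jk.
Qed.
End Kernel.

(** The columns of P + B lie in K. This is the structure equation of omega_j^1 on (e_k, e_c): the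
    difference H_j - H_k = - Delta_jk B cancels the denominator of omega_j^k(e_c) = S_jkc /
    Delta_jk. *)
Lemma beM_ker x c j k : O x -> b0 c -> ~~ b0 j -> ~~ b0 k ->
  \sum_(b | b0 b) (beM b c x + (b == c)%:R * coefB x) * S b j k x = 0.
Proof.
move=> Ox bc bj bk.
case: (eqVneq (bl j) (bl k)) => [jk|/eqP jk].
  by apply: big1 => b _; rewrite (S_eq23 _ _ jk) mulr0.
have jc : (j == c) = false by apply/eqP => h; rewrite h bc in bj.
have kc : (k == c) = false by apply/eqP => h; rewrite h bc in bk.
have jk' : (j == k) = false by apply/eqP => h; rewrite h in jk.
have := sbe (e k x) (e c x) j Ox.
rewrite (dform_eq_on Oo (e k x) (e c x) Ox
  (eta2 := fun y Z => - coefH j y * th j y Z)); last by move=> y Z Oy; exact: be_nonprime.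
rewrite (dformM (O := O))//; last by apply: differentiable_fN; exact: coefH_diff.
have := sth0 (e k x) (e c x) j Ox.
rewrite sum_wedge_th// (blx1 bj) (blx1 bk) (blx0 bc) mul1r mul0r subr0 => ->.
have -> : \sum_l wedge (om j l) (be l) x (e k x) (e c x) =
   \sum_(b | b0 b) beM b c x * S b j k x + coefH k x * om j k x (e c x).
  have -> : coefH k x * om j k x (e c x) = \sum_l (l == k)%:R * (coefH l x * om j l x (e c x)).
    by rewrite sum_deltaL.
  rewrite [X in _ = X + _]big_mkcond -big_split /=; apply: eq_bigr => l _; rewrite /wedge.
  case: ifPn => bl0.
    have lk : (l == k) = false by apply/eqP => h; rewrite -h bl0 in bk.
    rewrite (be_off Ox (b0Nbl bl0 bk)) lk omC// (om_block0 _ Ox bl0 bj) /beM eval_atE//.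
    have -> : \sum_i - S l j i x * th i x (e k x) = - S l j k x.
      rewrite -(sum_deltaL (fun i => - S l j i x)); apply: eq_bigr => i _.
      by rewrite thE// mulrC.
    by rewrite natb; ring.
  have lc : (l == c) = false by apply/eqP => h; rewrite h bc in bl0.
  by rewrite !(be_diag _ Ox bl0) lc natb; ring.
rewrite /wedge !thE// !(be_diag _ Ox bj) jc jk' !natb => h.
have {}h : (coefH j x - coefH k x) * om j k x (e c x) = \sum_(b | b0 b) beM b c x * S b j k x.
  by move: h; rewrite (omC _ k j)//; lra.
under eq_bigr do rewrite mulrDl.
rewrite big_split /= -h.
under eq_bigr do rewrite -mulrA.
rewrite sum_deltaP//.
have HD : coefH j x - coefH k x = - (Delta j k * coefB x).
  by rewrite /coefH /Delta (blx1 bj) (blx1 bk); ring.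
rewrite HD (omE _ Ox jk).
have -> : S c j k x = S j k c x by rewrite -SC12 SC23.
by field; exact: Delta_neq0.
Qed.

(** (P - B)(P + B) = 0, because the columns of P + B lie in K and P acts on K as B. *)
Lemma beM_sqr x b c : O x -> b0 b -> b0 c ->
  \sum_(k | b0 k) beM b k x * beM k c x = (b == c)%:R * coefB x ^+ 2.
Proof.
move=> Ox bb bc.
have [+ _] := kerS_kerPQ Ox (v := fun b => beM b c x + (b == c)%:R * coefB x)
  (fun j k bj bk => beM_ker Ox bc bj bk) bb.
rewrite /kerP.
have -> : \sum_(k | b0 k) (beM k c x + (k == c)%:R * coefB x) * (beM k b x - (k == b)%:R *
  coefB x) =
    \sum_(k | b0 k) (beM b k x * beM k c x + (k == c)%:R * (coefB x * beM k b x)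
      - (k == b)%:R * (beM k c x * coefB x) - (k == b)%:R * ((k == c)%:R * coefB x ^+ 2)).
  by apply: eq_bigr => k bk; rewrite (beM_sym b k Ox); ring.
rewrite !sumrB big_split /= !sum_deltaP// (beM_sym c b Ox) => h.
lra.
Qed.

(** With omega_j^1 = - H_j theta^j, its structure equation on (e_i, e_j) contains the derivative of
    H_j along e_i. *)
Lemma derive_coefH x j i : O x -> ~~ b0 j -> i != j ->
  'D_(e i x) (coefH j) x = - 2 * coefH j x * phi x (e i x) - kap x (e i x).
Proof.
move=> Ox bj ij.
have := sbe (e i x) (e j x) j Ox.
rewrite (dform_eq_on Oo (e i x) (e j x) Ox
  (eta2 := fun y Z => - coefH j y * th j y Z)); last by move=> y Z Oy; exact: be_nonprime.
rewrite (dformM (O := O))//; last by apply: differentiable_fN; exact: coefH_diff.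
have := sth0 (e i x) (e j x) j Ox.
rewrite sum_wedge_th// (blx1 bj) !mul1r omii// subr0 => ->.
have -> : \sum_l wedge (om j l) (be l) x (e i x) (e j x) =
    blx i * coefH i x * om j i x (e j x).
  rewrite -(sum_deltaL (fun l => blx l * coefH l x * om j l x (e j x))).
  apply: eq_bigr => l _; rewrite /wedge; case: (boolP (b0 l)) => bl0.
    rewrite (be_off Ox (b0Nbl bl0 bj)) (omC (e j x) l j)// (omE _ Ox (b0Nbl bl0 bj)).
    rewrite (S_eq23 l x (erefl (bl j))) (blx0 bl0).
    by ring.
  rewrite !(be_diag _ Ox bl0) (blx1 bl0).
  case: (eqVneq l j) => [->|_]; first by rewrite omii// natb; ring.
  by rewrite natb; ring.
have HH : blx i * coefH i x * om j i x (e j x) = - (blx i * coefH j x * om i j x (e j x)).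
  case: (eqVneq (bl i) (bl j)) => [bij|/eqP bij].
    by rewrite (omC _ i j)// /coefH (bly_eq bij); ring.
  by rewrite (omC _ i j)// (omE _ Ox bij) S_eq23//; ring.
rewrite HH /wedge !thE// !(be_diag _ Ox bj) eqxx [j == i]eq_sym (negPf ij) !natb.
rewrite derive_fN; last exact: coefH_diff.
by move=> h; lra.
Qed.

(** * Derivatives of A, B and P *)

Lemma derive_basis f x X : O x -> differentiable f x ->
  'D_X f x = \sum_i th i x X * 'D_(e i x) f x.
Proof.
move=> Ox df; rewrite deriveE// [in LHS](eE X Ox) linear_sum; apply: eq_bigr => i _.
by rewrite linearZ deriveE.
Qed.

Lemma coefA_diff x : O x -> differentiable coefA x. Proof. exact: eval_at_diff. Qed.
Lemma coefB_diff x : O x -> differentiable coefB x. Proof. exact: eval_at_diff. Qed.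
Lemma beM_diff b c x : O x -> differentiable (beM b c) x. Proof. exact: eval_at_diff. Qed.

(** Two indices different from i, in different blocks outside {1}, give equations with different
    y_j, which separate A from B. Among [i1], [i2], [i3] there is always such a pair. *)
Lemma derive_coef_basis x i : O x ->
  'D_(e i x) coefA x = - 2 * coefA x * phi x (e i x) - kap x (e i x) /\
  'D_(e i x) coefB x = - 2 * coefB x * phi x (e i x).
Proof.
move=> Ox.
have h j : ~~ b0 j -> i != j ->
  ('D_(e i x) coefA x + 2 * coefA x * phi x (e i x) + kap x (e i x))
  + bly j * ('D_(e i x) coefB x + 2 * coefB x * phi x (e i x)) = 0.
  move=> bj ij; have := derive_coefH Ox bj ij.
  rewrite derive_fD; [|exact: coefA_diff|apply: differentiable_fM; [exact:
    differentiable_cst|exact: coefB_diff]].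
  rewrite derive_fM; [|exact: differentiable_cst|exact: coefB_diff].
  by rewrite derive_cst /coefH; lra.
have := h i1; have := h i2; have := h i3; rewrite /bly bi1 bi2 bi3 /=.
case: (eqVneq i i1) => [->|n1].
  have -> : i1 != i2 by apply/eqP => E; move: bi2; rewrite -E bi1.
  have -> : i1 != i3 by apply/eqP => E; move: bi3; rewrite -E bi1.
  by move=> /(_ isT isT) ? /(_ isT isT) ? _; split; lra.
case: (eqVneq i i2) => [->|n2].
  have -> : i2 != i3 by apply/eqP => E; move: bi3; rewrite -E bi2.
  by move=> /(_ isT isT) ? _ /(_ isT isT) ?; split; lra.
by move=> _ /(_ isT isT) ? /(_ isT isT) ?; split; lra.
Qed.

Lemma derive_coefA x X : O x -> 'D_X coefA x = - 2 * coefA x * phi x X - kap x X.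
Proof.
move=> Ox; rewrite (derive_basis X Ox (coefA_diff Ox)).
rewrite [in RHS](form_basis X phiF Ox) [in RHS](form_basis X kapF Ox).
rewrite mulr_sumr -sumrB; apply: eq_bigr => i _.
by have [-> _] := derive_coef_basis i Ox; ring.
Qed.

Lemma derive_coefB x X : O x -> 'D_X coefB x = - 2 * coefB x * phi x X.
Proof.
move=> Ox; rewrite (derive_basis X Ox (coefB_diff Ox)).
rewrite [in RHS](form_basis X phiF Ox).
rewrite mulr_sumr; apply: eq_bigr => i _.
by have [_ ->] := derive_coef_basis i Ox; ring.
Qed.

(* The covariant derivative of P along e_i, for a weight 2 action of phi. *)
Definition covP b c i x := 'D_(e i x) (beM b c) x + 2 * beM b c x * phi x (e i x)
  - \sum_(k | b0 k) (beM b k x * om c k x (e i x) + om b k x (e i x) * beM k c x).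

(** A Codazzi equation: the structure equation of omega_b^1 = sum_k P_bk theta^k on (e_i, e_c). Here
    d theta^k comes from [sth1], since [sth0] is void on {1}. *)
Lemma covP_swap x b c i : O x -> b0 b -> b0 c ->
  covP b c i x = if b0 i then covP b i c x else 0.
Proof.
move=> Ox bb bc.
have := sbe (e i x) (e c x) b Ox.
rewrite (dform_eq_on Oo (e i x) (e c x) Ox
  (eta2 := fun y Z => \sum_(k | b0 k) beM b k y * th k y Z)); last first.
  by move=> y Z Oy; exact: be_block0.
rewrite (dform_sum (O := O))//; last first.
  by move=> k _; apply: form_onM => // y Oy; exact: beM_diff.
have -> : \sum_(k | b0 k) dform (fun y Z => beM b k y * th k y Z) x (e i x) (e c x) =
  \sum_(k | b0 k) ((k == c)%:R * ('D_(e i x) (beM b k) x + beM b k x * phi x (e i x))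
    - (k == i)%:R * ('D_(e c x) (beM b k) x + beM b k x * phi x (e c x))
    + bly i * (beM b k x * om i k x (e c x)) - beM b k x * om c k x (e i x)).
  apply: eq_bigr => k bk; rewrite (dformM (O := O))//; last exact: beM_diff.
  have := sth1 (e i x) (e c x) k Ox.
  rewrite sum_wedge_th// (bly0 bk) (bly0 bc) !mul1r => ->.
  by rewrite /wedge !thE//; ring.
have -> : \sum_k wedge (om b k) (be k) x (e i x) (e c x) =
  \sum_(k | b0 k) (om b k x (e i x) * beM k c x - om b k x (e c x) * be k x (e i x)).
  rewrite [RHS]big_mkcond; apply: eq_bigr => k _; rewrite /wedge.
  case: ifPn => bk; first by rewrite /beM eval_atE.
  rewrite !(omE _ Ox (b0Nbl bb bk)) (be_off Ox (nesym (b0Nbl bc bk))).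
  by rewrite (S_eq13 k x (etrans (eqP bb) (esym (eqP bc)))); ring.
rewrite sumrB big_split sumrB /= sum_deltaP// (blx0 bb) mul0r subr0.
rewrite -mulr_sumr sumrB /wedge /covP big_split /=.
have Pb : be b x (e c x) = beM b c x by rewrite /beM eval_atE.
rewrite Pb.
case: ifPn => bi.
  have Pbi : be b x (e i x) = beM b i x by rewrite /beM eval_atE.
  rewrite sum_deltaP// (bly0 bi) big_split /= Pbi.
  have -> : \sum_(k | b0 k) om b k x (e c x) * be k x (e i x) =
    \sum_(k | b0 k) om b k x (e c x) * beM k i x.
    by apply: eq_bigr => k _; rewrite /beM eval_atE.
  by move=> h; lra.
have -> : \sum_(k | b0 k) (k == i)%:R * ('D_(e c x) (beM b k) x + beM b k x * phi x (e c x))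
  = 0.
  apply: big1 => k bk; have -> : (k == i) = false by apply/eqP => E; rewrite -E bk in bi.
  by rewrite mul0r.
have -> : \sum_(k | b0 k) beM b k x * om i k x (e c x) = 0.
  apply: big1 => k bk; rewrite omC// (omE _ Ox (b0Nbl bk bi)).
  by rewrite (S_eq13 i x (etrans (eqP bk) (esym (eqP bc)))); ring.
have -> : \sum_(k | b0 k) om b k x (e c x) * be k x (e i x) = 0.
  by apply: big1 => k bk; rewrite (be_off Ox (b0Nbl bk bi)) mulr0.
rewrite (be_off Ox (b0Nbl bb bi)).
by move=> h; lra.
Qed.

Lemma covP_sym x b c i : O x -> covP b c i x = covP c b i x.
Proof.
move=> Ox; rewrite /covP (beM_sym b c Ox).
rewrite (derive_eq_on Oo (g := beM c b) (e i x) Ox); last by move=> y; exact: beM_sym.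
congr (_ - _); apply: eq_bigr => k _.
by rewrite (beM_sym b k Ox) (beM_sym k c Ox); ring.
Qed.

(** The covariant derivative of P^2 = B^2. The connection terms cancel because P^2 is scalar and
    omega is skew, the weight terms because dB = - 2 B phi. *)
Lemma covP_anticomm x b c i : O x -> b0 b -> b0 c ->
  \sum_(k | b0 k) (covP b k i x * beM k c x + beM b k x * covP k c i x) = 0.
Proof.
move=> Ox bb bc.
have h : 'D_(e i x) (fun y => \sum_(k | b0 k) beM b k y * beM k c y) x =
    'D_(e i x) (fun y => (b == c)%:R * (coefB y * coefB y)) x.
  by apply: (derive_eq_on Oo) => // y Oy; rewrite beM_sqr// expr2.
move: h; rewrite derive_fsum; last first.
  by move=> k _; apply: differentiable_fM; exact: beM_diff.
rewrite derive_fM; [|exact: differentiable_cst|by apply: differentiable_fM; exact: coefB_diff].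
rewrite derive_fM; [|exact: coefB_diff..].
rewrite derive_cst mul0r add0r derive_coefB//.
have -> : \sum_(k | b0 k) 'D_(e i x) (fun y => beM b k y * beM k c y) x =
  \sum_(k | b0 k) ('D_(e i x) (beM b k) x * beM k c x + beM b k x * 'D_(e i x) (beM k c) x).
  by apply: eq_bigr => k _; rewrite derive_fM//; exact: beM_diff.
move=> h.
have -> : \sum_(k | b0 k) (covP b k i x * beM k c x + beM b k x * covP k c i x) =
   \sum_(k | b0 k) ('D_(e i x) (beM b k) x * beM k c x + beM b k x * 'D_(e i x) (beM k c) x)
   + 4 * phi x (e i x) * \sum_(k | b0 k) beM b k x * beM k c x
   - \sum_(k | b0 k) \sum_(l | b0 l) (beM b l x * om k l x (e i x) * beM k c x
        + om b l x (e i x) * beM l k x * beM k c x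
        + beM b k x * beM k l x * om c l x (e i x) + beM b k x * om k l x (e i x) * beM l c x).
  rewrite mulr_sumr -big_split -sumrB /=; apply: eq_bigr => k bk.
  rewrite /covP.
  have -> : \sum_(l | b0 l) (beM b l x * om k l x (e i x) * beM k c x
        + om b l x (e i x) * beM l k x * beM k c x
        + beM b k x * beM k l x * om c l x (e i x) + beM b k x * om k l x (e i x) * beM l c x) =
    (\sum_(l | b0 l) (beM b l x * om k l x (e i x) + om b l x (e i x) * beM l k x)) * beM k c x
    + beM b k x * (\sum_(l | b0 l) (beM k l x * om c l x (e i x) + om k l x (e i x) * beM l c
      x)).
    rewrite mulr_suml mulr_sumr -big_split /=; apply: eq_bigr => l _.
    by ring.
  by ring.
rewrite h beM_sqr//.
have -> : \sum_(k | b0 k) \sum_(l | b0 l) (beM b l x * om k l x (e i x) * beM k c x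
        + om b l x (e i x) * beM l k x * beM k c x
        + beM b k x * beM k l x * om c l x (e i x) + beM b k x * om k l x (e i x) * beM l c
          x) = 0.
  have -> : \sum_(k | b0 k) \sum_(l | b0 l) (beM b l x * om k l x (e i x) * beM k c x
        + om b l x (e i x) * beM l k x * beM k c x
        + beM b k x * beM k l x * om c l x (e i x) + beM b k x * om k l x (e i x) * beM l c x) =
    \sum_(k | b0 k) \sum_(l | b0 l) beM b l x * om k l x (e i x) * beM k c x
    + \sum_(k | b0 k) \sum_(l | b0 l) om b l x (e i x) * beM l k x * beM k c x
    + \sum_(k | b0 k) \sum_(l | b0 l) beM b k x * beM k l x * om c l x (e i x)
    + \sum_(k | b0 k) \sum_(l | b0 l) beM b k x * om k l x (e i x) * beM l c x.
    by rewrite -!big_split /=; apply: eq_bigr => k _; rewrite -!big_split /=.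
  have -> : \sum_(k | b0 k) \sum_(l | b0 l) beM b l x * om k l x (e i x) * beM k c x =
     - \sum_(k | b0 k) \sum_(l | b0 l) beM b k x * om k l x (e i x) * beM l c x.
    rewrite exchange_big -sumrN /=; apply: eq_bigr => k _; rewrite -sumrN; apply: eq_bigr =>
      l _.
    by rewrite (omC _ k l)//; ring.
  have -> : \sum_(k | b0 k) \sum_(l | b0 l) om b l x (e i x) * beM l k x * beM k c x =
      om b c x (e i x) * coefB x ^+ 2.
    rewrite exchange_big /=.
    transitivity (\sum_(l | b0 l) (l == c)%:R * (om b l x (e i x) * coefB x ^+ 2)).
      2: by rewrite (sum_delta0 (fun l => om b l x (e i x) * coefB x ^+ 2) bc).
    apply: eq_bigr => l bl0; under eq_bigr do rewrite -mulrA.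
    by rewrite -mulr_sumr beM_sqr//; ring.
  have -> : \sum_(k | b0 k) \sum_(l | b0 l) beM b k x * beM k l x * om c l x (e i x) =
      om c b x (e i x) * coefB x ^+ 2.
    rewrite exchange_big /=.
    transitivity (\sum_(l | b0 l) (l == b)%:R * (om c l x (e i x) * coefB x ^+ 2)).
      2: by rewrite (sum_delta0 (fun l => om c l x (e i x) * coefB x ^+ 2) bb).
    apply: eq_bigr => l bl0.
    by rewrite -mulr_suml beM_sqr// [b == l]eq_sym; ring.
  by rewrite (omC _ b c)//; ring.
by ring.
Qed.

(* covP is totally symmetric, and P, applied to one of its three slots,
   anticommutes with P applied to another one. *)
Lemma covP_eq0 x b c i : O x -> coefB x != 0 -> b0 b -> b0 c -> covP b c i x = 0.
Proof.
move=> Ox B0 bb bc; case: (boolP (b0 i)) => bi; last by rewrite covP_swap// (negPf bi).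
pose U b c i := \sum_(k | b0 k) beM b k x * covP k c i x.
have U1 b' c' i' : b0 b' -> b0 c' -> U b' c' i' = - U c' b' i'.
  move=> bb' bc'; have := covP_anticomm i' Ox bb' bc'; rewrite big_split /= => h.
  rewrite /U.
  have -> : \sum_(k | b0 k) beM c' k x * covP k b' i' x = \sum_(k | b0 k) covP b' k i' x *
    beM k c' x.
    by apply: eq_bigr => k _; rewrite (beM_sym c' k Ox) (covP_sym k b' i' Ox); ring.
  by lra.
have U2 b' c' i' : b0 c' -> b0 i' -> U b' c' i' = U b' i' c'.
  by move=> bc' bi'; apply: eq_bigr => k bk; rewrite covP_swap// bi'.
(* U is skew in its first two slots and symmetric in its last two; six alternating transpositions
   return it to itself with three changes of sign. *)
have U0 b' : b0 b' -> U b' c i = 0.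
  move=> bb'.
  have : U b' c i = - U b' c i.
    by rewrite {1}U1// U2// (U1 c)// (U2 i)// (U1 i)// (U2 b')//; ring.
  by lra.
(* Applying P once more replaces P^2 by B^2, which can be cancelled. *)
have : \sum_(k | b0 k) beM b k x * U k c i = 0 by apply: big1 => k bk; rewrite U0// mulr0.
have -> : \sum_(k | b0 k) beM b k x * U k c i = coefB x ^+ 2 * covP b c i x.
  under eq_bigr do rewrite mulr_sumr.
  rewrite exchange_big /=.
  transitivity (\sum_(l | b0 l) (l == b)%:R * (coefB x ^+ 2 * covP l c i x)).
    2: by rewrite (sum_delta0 (fun l => coefB x ^+ 2 * covP l c i x) bb).
  apply: eq_bigr => l bl0; under eq_bigr do rewrite mulrA.
  by rewrite -mulr_suml beM_sqr// [b == l]eq_sym; ring.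
by move=> /eqP; rewrite mulf_eq0 sqrf_eq0 (negPf B0) => /eqP.
Qed.

Lemma derive_beM x b c X : O x -> coefB x != 0 -> b0 b -> b0 c ->
  'D_X (beM b c) x = - 2 * phi x X * beM b c x
    + \sum_(k | b0 k) (beM b k x * om c k x X + om b k x X * beM k c x).
Proof.
move=> Ox B0 bb bc; rewrite (derive_basis X Ox (beM_diff b c Ox)).
have -> : \sum_(k | b0 k) (beM b k x * om c k x X + om b k x X * beM k c x) =
  \sum_i th i x X *
    \sum_(k | b0 k) (beM b k x * om c k x (e i x) + om b k x (e i x) * beM k c x).
  under [RHS]eq_bigr do rewrite mulr_sumr.
  rewrite exchange_big /=; apply: eq_bigr => k _.
  rewrite (form_basis X (omF c k) Ox) (form_basis X (omF b k) Ox) mulr_sumr mulr_suml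
    -big_split /=.
  by apply: eq_bigr => i _; ring.
have -> : - 2 * phi x X * beM b c x = \sum_i th i x X * (- 2 * beM b c x * phi x (e i x)).
  move: (beM b c x) => p; rewrite (form_basis X phiF Ox) mulr_sumr mulr_suml.
  by apply: eq_bigr => i _; ring.
rewrite -big_split /=; apply: eq_bigr => i _; have := covP_eq0 i Ox B0 bb bc; rewrite /covP
  => h.
have -> : 'D_(e i x) (beM b c) x = - 2 * beM b c x * phi x (e i x)
  + \sum_(k | b0 k) (beM b k x * om c k x (e i x) + om b k x (e i x) * beM k c x) by lra.
by ring.
Qed.

(* The equations satisfied by z_A = <Y_A, v> for a constant vector v. *)
Definition frame_functions (z0 z1 zN zM : E -> R) (z : 'I_d -> E -> R) : Prop :=
  [/\ forall x, O x -> [/\ differentiable z0 x, differentiable z1 x, differentiable zN x &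
        forall i, differentiable (z i) x],
      forall x X, O x -> 'D_X z0 x = phi x X * z0 x + \sum_i blx i * th i x X * z i x,
      forall x X, O x -> 'D_X z1 x = phi x X * z1 x + \sum_i bly i * th i x X * z i x,
      forall x X i, O x -> 'D_X (z i) x = al i x X * z0 x + be i x X * z1 x
        + \sum_k om i k x X * z k x + bly i * th i x X * zN x + blx i * th i x X * zM x &
      forall x X, O x -> 'D_X zN x = kap x X * z0 x + \sum_i be i x X * z i x - phi x X * zN x].

(** * The linear system of Z and the columns of q *)

Section Parallel.
Variables (O1 : set E) (O1o : open O1) (O1O : O1 `<=` O) (x0 : E) (O1x0 : O1 x0).
(** Covers both cases at once: q = P + B with [lam] = - 2 phi and r = 1, and q = 1 with [lam] = 0
    and r = 0. *)
Variables (q : 'I_d -> 'I_d -> E -> R) (lam : E -> E -> R) (r : R).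
Hypothesis q_diff : forall b c x, O1 x -> differentiable (q b c) x.
Hypothesis lamF : form_on O1 lam.
Hypothesis dq : forall b c x X, O1 x -> b0 b -> b0 c ->
  'D_X (q b c) x = lam x X * q b c x
    + \sum_(k | b0 k) (q b k x * om c k x X + om b k x X * q k c x).
Hypothesis q_ker : forall c j k x, O1 x -> b0 c -> ~~ b0 j -> ~~ b0 k ->
  \sum_(b | b0 b) q b c x * S b j k x = 0.
Hypothesis q_P : forall b c x, O1 x -> b0 b -> b0 c ->
  beM b c x + (b == c)%:R * coefB x = r * q b c x.

(** The columns of q lie in K, on which the matrices of omega_b^0 and omega_b^1 act as the scalars A
    and B by [kerS_kerPQ]. *)
Lemma q_albe c x X : O1 x -> b0 c ->
  \sum_(b | b0 b) q b c x * al b x X = coefA x * \sum_(b | b0 b) q b c x * th b x X /\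
  \sum_(b | b0 b) q b c x * be b x X = coefB x * \sum_(b | b0 b) q b c x * th b x X.
Proof.
move=> O1x bc; have Ox := O1O O1x.
have h c' (bc' : b0 c') := kerS_kerPQ Ox (v := fun b => q b c x)
  (fun j k bj bk => q_ker O1x bc bj bk) bc'.
have gen (C : R) (m : 'I_d -> 'I_d -> R) :
    (forall c', b0 c' -> \sum_(b | b0 b) q b c x * (m b c' - (b == c')%:R * C) = 0) ->
    \sum_(b | b0 b) q b c x * \sum_(c' | b0 c') m b c' * th c' x X =
    C * \sum_(b | b0 b) q b c x * th b x X.
  move=> hm; under eq_bigr do rewrite mulr_sumr.
  rewrite exchange_big /= mulr_sumr; apply: eq_bigr => c' bc'.
  under eq_bigr do rewrite mulrA; rewrite -mulr_suml mulrA; congr (_ * _).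
  have := hm _ bc'; under eq_bigr do rewrite mulrBr mulrCA.
  rewrite sumrB sum_deltaP// => /eqP; rewrite subr_eq0 => /eqP ->.
  by rewrite mulrC.
split.
  rewrite -(gen (coefA x) (fun b c' => alM b c' x)).
    by apply: eq_bigr => b bb; rewrite al_block0.
  by move=> c' /h[_].
rewrite -(gen (coefB x) (fun b c' => beM b c' x)).
  by apply: eq_bigr => b bb; rewrite be_block0.
by move=> c' /h[].
Qed.

Lemma q_om c k x X : O1 x -> b0 c -> ~~ b0 k ->
  \sum_(b | b0 b) q b c x * om b k x X = 0.
Proof.
move=> O1x bc bk; have Ox := O1O O1x.
have -> : \sum_(b | b0 b) q b c x * om b k x X =
    \sum_(b | b0 b) \sum_l (q b c x * S b k l x) * - th l x X.
  apply: eq_bigr => b bb; rewrite om_block0// mulr_sumr; apply: eq_bigr => l _.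
  by ring.
rewrite exchange_big big1//= => l _; rewrite -mulr_suml.
case: (boolP (b0 l)) => bl0; last by rewrite q_ker// mul0r.
rewrite big1 ?mul0r// => b bb.
by rewrite (S_eq13 k x (etrans (eqP bb) (esym (eqP bl0)))) mulr0.
Qed.

Lemma form_onS eta : form_on O eta -> form_on O1 eta.
Proof.
move=> h; split=> x /O1O Ox; first exact: (form_lin h).
by move=> X; exact: (form_diff h).
Qed.

(** The matrix of dZ = - phi Z + r sum_c theta^c q_c and dq_c = (sum_b q_bc theta^b) Z + sum_k
    (omega_c^k + delta_kc lam) q_k, where q_c = sum_b q_bc Y_b. The entries at indices outside {1}
    are zero padding. *)
Definition conn (j k : unit + 'I_d) : E -> E -> R :=
  match j, k with
  | inl _, inl _ => fun x X => - 1 * phi x X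
  | inl _, inr c => if b0 c then fun x X => r * th c x X else fun _ _ => 0
  | inr c, inl _ =>
      if b0 c then fun x X => \sum_(b | b0 b) q b c x * th b x X else fun _ _ => 0
  | inr c, inr k => if b0 c && b0 k then fun x X => om c k x X + (k == c)%:R * lam x X
                    else fun _ _ => 0
  end.

(* <Z, v> and <sum_b q_bc Y_b, v> for a constant vector v. *)
Definition gen_vec (z0 z1 zN : E -> R) (z : 'I_d -> E -> R) (j : unit + 'I_d) : E -> R :=
  match j with
  | inl _ => fun x => zN x + coefA x * z0 x + coefB x * z1 x
  | inr c => if b0 c then fun x => \sum_(b | b0 b) q b c x * z b x else fun _ => 0
  end.

Lemma conn_form j k : form_on O1 (conn j k).
Proof.
have cst (c : R) x : O1 x -> differentiable (fun _ : E => c) x.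
  by move=> _; exact: differentiable_cst.
case: j k => [_|c] [_|k] /=.
- by apply: form_onM; [exact: cst|exact: form_onS].
- case: ifP => _; last exact: form_on0.
  by apply: form_onM; [exact: cst|exact: form_onS].
- case: ifP => _; last exact: form_on0.
  by apply: form_on_sum => b _; apply: form_onM; [exact: q_diff|exact: form_onS].
- case: ifP => _; last exact: form_on0.
  by apply: form_onD; [exact: form_onS|apply: form_onM; [exact: cst|]].
Qed.

Lemma sum_unit_or (f : unit + 'I_d -> R) :
  \sum_j f j = f (inl tt) + \sum_c f (inr c).
Proof.
by rewrite big_sumType /=; congr (_ + _); rewrite (big_pred1 tt)// => -[].
Qed.

Lemma gen_vec_diff z0 z1 zN zM z : frame_functions z0 z1 zN zM z ->
  forall j x, O1 x -> differentiable (gen_vec z0 z1 zN z j) x.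
Proof.
move=> [df _ _ _ _] j x O1x; have Ox := O1O O1x; have [d0 d1 dN dz] := df x Ox.
case: j => [_|c] /=.
  apply: differentiable_fD; last by apply: differentiable_fM => //; exact: coefB_diff.
  by apply: differentiable_fD => //; apply: differentiable_fM => //; exact: coefA_diff.
case: ifP => _; last exact: differentiable_cst.
by apply: differentiable_fsum => b _; apply: differentiable_fM => //; exact: q_diff.
Qed.

(** The kap term of dY_(n+1) is cancelled by dA, and the weights -2 of A and B and +1 of Y_0 and Y_1
    add up to the weight -1 of Y_(n+1). In dq_c the terms in Y_0, Y_1 and Y_(n+1) combine to a
    multiple of Z by [q_albe]. *)
Lemma derive_gen_vec z0 z1 zN zM z : frame_functions z0 z1 zN zM z ->
  forall j x X, O1 x -> 'D_X (gen_vec z0 z1 zN z j) x =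
    \sum_k conn j k x X * gen_vec z0 z1 zN z k x.
Proof.
move=> [df D0 D1 Dz DN] j x X O1x; have Ox := O1O O1x; have [d0 d1 dN dz] := df x Ox.
rewrite sum_unit_or; case: j => [_|c] /=.
  have dA := coefA_diff Ox; have dB := coefB_diff Ox.
  have dAz := differentiable_fM dA d0; have dBz := differentiable_fM dB d1.
  rewrite (derive_fD _ (differentiable_fD dN dAz) dBz) (derive_fD _ dN dAz).
  rewrite (derive_fM _ dA d0) (derive_fM _ dB d1) derive_coefA// derive_coefB// D0// D1// DN//.
  (* Outside {1} the coefficients of z_i cancel, as omega_i^1 = - (A + y_i B) theta^i; inside {1}
     they are those of P + B = r q. *)
  have -> : \sum_c (if b0 c then fun x X => r * th c x X else fun _ _ => 0) x X *
      (if b0 c then fun x => \sum_(b | b0 b) q b c x * z b x else fun _ => 0) x =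
    \sum_i be i x X * z i x + coefA x * (\sum_i blx i * th i x X * z i x)
      + coefB x * (\sum_i bly i * th i x X * z i x).
    rewrite !mulr_sumr -!big_split /=.
    transitivity (\sum_(c | b0 c) \sum_(b | b0 b) r * th c x X * (q b c x * z b x)).
      rewrite [RHS]big_mkcond; apply: eq_bigr => c _; case: ifP => _; last by rewrite mul0r.
      by rewrite mulr_sumr.
    rewrite exchange_big big_mkcond /=; apply: eq_bigr => b _.
    case: ifPn => bb; last first.
      by rewrite be_nonprime// (blx1 bb) /coefH; ring.
    rewrite (blx0 bb) (bly0 bb) be_block0//.
    have -> : \sum_(c | b0 c) r * th c x X * (q b c x * z b x) =
        (\sum_(c | b0 c) (beM b c x * th c x X + (c == b)%:R * (coefB x * th c x X))) * z b x.
      rewrite mulr_suml; apply: eq_bigr => c bc.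
      have -> : r * th c x X * (q b c x * z b x) = (r * q b c x) * th c x X * z b x by ring.
      by rewrite -q_P// [c == b]eq_sym; ring.
    by rewrite big_split /= (sum_delta0 (fun c => coefB x * th c x X) bb); ring.
  by ring.
case: ifPn => bc; last first.
  by rewrite derive_cst mul0r big1 ?addr0// => k _; rewrite mul0r.
rewrite derive_fsum; last by move=> b _; apply: differentiable_fM => //; exact: q_diff.
have [hal hbe] := q_albe X O1x bc.
transitivity (\sum_(b | b0 b) (q b c x * al b x X) * z0 x
   + \sum_(b | b0 b) (q b c x * be b x X) * z1 x
   + \sum_(b | b0 b) (q b c x * th b x X) * zN x
   + \sum_(b | b0 b) lam x X * (q b c x * z b x)
   + \sum_(b | b0 b) \sum_(k | b0 k) q b k x * om c k x X * z b x
   + (\sum_(b | b0 b) \sum_(k | b0 k) om b k x X * q k c x * z b x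
     + \sum_(b | b0 b) \sum_k q b c x * om b k x X * z k x)).
  rewrite -!big_split /=; apply: eq_bigr => b bb.
  rewrite derive_fM//; last exact: q_diff.
  rewrite dq// Dz// (blx0 bb) (bly0 bb).
  have -> : \sum_k q b c x * om b k x X * z k x = q b c x * \sum_k om b k x X * z k x.
    by rewrite mulr_sumr; apply: eq_bigr => k _; rewrite mulrA.
  rewrite -!mulr_suml big_split /=.
  by ring.
rewrite -!mulr_suml hal hbe -mulr_sumr.
(* The part staying in {1} will cancel the derivative of q by skew-symmetry; the part leaving {1}
   vanishes by [q_om]. *)
have -> : \sum_(b | b0 b) \sum_k q b c x * om b k x X * z k x =
    - \sum_(b | b0 b) \sum_(k | b0 k) om b k x X * q k c x * z b x.
  rewrite exchange_big /= -sumrN (bigID (fun k => b0 k)) /= addrC big1 ?add0r.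
    apply: eq_bigr => k bk; rewrite -sumrN; apply: eq_bigr => b bb.
    by rewrite (omC _ k b)//; ring.
  by move=> k bk; rewrite -mulr_suml q_om// mul0r.
have -> : \sum_c0 (if true && b0 c0 then fun x X => om c c0 x X + (c0 == c)%:R * lam x X
      else fun _ _ => 0) x X *
      (if b0 c0 then fun x => \sum_(b | b0 b) q b c0 x * z b x else fun _ => 0) x =
    \sum_(b | b0 b) \sum_(k | b0 k) q b k x * om c k x X * z b x
    + lam x X * \sum_(b | b0 b) q b c x * z b x.
  transitivity (\sum_(k | b0 k) (om c k x X * (\sum_(b | b0 b) q b k x * z b x)
     + (k == c)%:R * (lam x X * \sum_(b | b0 b) q b k x * z b x))).
    rewrite [RHS]big_mkcond; apply: eq_bigr => k _ /=; case: ifP => _; last by rewrite mul0r.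
    by ring.
  rewrite big_split /= (sum_delta0 (fun k => lam x X * \sum_(b | b0 b) q b k x * z b x) bc).
  congr (_ + _); rewrite exchange_big /=; apply: eq_bigr => k _.
  by rewrite mulr_sumr; apply: eq_bigr => b _; ring.
by ring.
Qed.

Lemma parallel_span : exists O', [/\ open O', O' x0, O' `<=` O1 &
  forall z0 z1 zN zM z, frame_functions z0 z1 zN zM z ->
  forall x1, O' x1 -> z0 x1 = 0 -> z1 x1 = 0 -> zN x1 = 0 -> (forall b, b0 b -> z b x1 = 0) ->
  zN x0 + coefA x0 * z0 x0 + coefB x0 * z1 x0 = 0 /\
  forall c, b0 c -> \sum_(b | b0 b) q b c x0 * z b x0 = 0].
Proof.
have [W [oW Wx0 sW h]] := parallel_vanish O1o O1x0 conn_form.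
exists W; split=> // z0 z1 zN zM z fz x1 Wx1 e0 e1 eN ez.
have {}h := h _ (gen_vec_diff fz) (derive_gen_vec fz) x1 Wx1.
have {}h : forall j, gen_vec z0 z1 zN z j x0 = 0.
  apply: h => -[_|c] /=; first by rewrite e0 e1 eN !mulr0 !addr0.
  by case: ifP => // bc; apply: big1 => b bb; rewrite ez// mulr0.
split; first exact: (h (inl tt)).
by move=> c bc; have := h (inr c); rewrite /= bc.
Qed.
End Parallel.

(** If B is nonzero somewhere, x0 is such a point, so that P is parallel on a ball around it;
    otherwise x0 = x. *)
Lemma dupin_core x : O x -> exists x0 O' (A0 B0 : R), [/\ open O', O' x0, O' `<=` O &
  forall z0 z1 zN zM z, frame_functions z0 z1 zN zM z ->
  forall x1, O' x1 -> z0 x1 = 0 -> z1 x1 = 0 -> zN x1 = 0 -> (forall b, b0 b -> z b x1 = 0) ->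
  zN x0 + A0 * z0 x0 + B0 * z1 x0 = 0 /\ z a x0 = 0].
Proof.
move=> Ox.
have cst (c : R) (O1 : set E) y : O1 y -> differentiable (fun _ : E => c) y.
  by move=> _; exact: differentiable_cst.
have [ [x0 [Ox0 B0]] | B0 ] := pselect (exists x0, O x0 /\ coefB x0 != 0).
  have : \forall y \near x0, O y /\ coefB y != 0.
    apply: filterI; first exact: open_nbhs_nbhs.
    by have /differentiable_continuous/cvgr_neq0 := coefB_diff Ox0; apply.
  move=> /nbhs_ballP[r /= r0 br].
  pose q b c y := beM b c y + (b == c)%:R * coefB y.
  have bO : ball x0 r `<=` O by move=> y /br[].
  have dq b c y X : ball x0 r y -> b0 b -> b0 c -> 'D_X (q b c) y = - 2 * phi y X * q b c y
      + \sum_(k | b0 k) (q b k y * om c k y X + om b k y X * q k c y).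
    move=> yb bb bc; have Oy := bO _ yb; have [_ By] := br _ yb.
    rewrite derive_fD; [|exact: beM_diff|by apply: differentiable_fM; [exact:
      differentiable_cst|exact: coefB_diff]].
    rewrite derive_fM; [|exact: differentiable_cst|exact: coefB_diff].
    rewrite derive_cst derive_coefB// derive_beM// /q.
    have -> : \sum_(k | b0 k) ((beM b k y + (b == k)%:R * coefB y) * om c k y X
        + om b k y X * (beM k c y + (k == c)%:R * coefB y)) =
      \sum_(k | b0 k) (beM b k y * om c k y X + om b k y X * beM k c y)
       + coefB y * om c b y X + coefB y * om b c y X.
      rewrite -(sum_delta0 (fun k => coefB y * om c k y X) bb).
      rewrite -(sum_delta0 (fun k => coefB y * om b k y X) bc) -!big_split /=.
      by apply: eq_bigr => k _; rewrite [b == k]eq_sym; ring.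
    by rewrite (omC _ b c)//; ring.
  have [W [oW Wx0 sW h]] := @parallel_span (ball x0 r) (ball_open _ _) bO x0 (ballxx _ r0)
    q (fun y X => - 2 * phi y X) 1
    (fun b c y yb => differentiable_fD (beM_diff b c (bO _ yb))
        (differentiable_fM (differentiable_cst _ _) (coefB_diff (bO _ yb))))
    (form_onM (@cst _ _) (form_onS bO phiF)) dq
    (fun c j k y yb bc bj bk => beM_ker (bO _ yb) bc bj bk)
    (fun b c y _ _ _ => esym (mul1r _)).
  exists x0, W, (coefA x0), (coefB x0); split=> //; first exact: subset_trans bO.
  move=> z0 z1 zN zM z fz x1 Wx1 e0 e1 eN ez.
  have [-> /(_ a a0) ha] := h _ _ _ _ _ fz x1 Wx1 e0 e1 eN ez; split=> //.
  (* The unit vector of the index a lies in K by [Sa], so P acts on it as B, and column a of q is 2B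
     times this vector. *)
  have Pa c : b0 c -> beM c a x0 = (c == a)%:R * coefB x0.
    have fa j k : ~~ b0 j -> ~~ b0 k -> kerS x0 (fun b => (b == a)%:R) j k = 0.
      by move=> bj bk; rewrite /kerS (sum_delta0 (fun b => S b j k x0) a0) Sa.
    move=> bc; have [+ _] := kerS_kerPQ Ox0 fa bc.
    rewrite /kerP (sum_delta0 (fun b => beM b c x0 - (b == c)%:R * coefB x0) a0) => /eqP.
    by rewrite subr_eq0 (beM_sym a c Ox0) eq_sym => /eqP; rewrite eq_sym.
  move: ha; rewrite /q.
  have -> : \sum_(b | b0 b) (beM b a x0 + (b == a)%:R * coefB x0) * z b x0 = 2 * coefB x0 * z
    a x0.
    rewrite -(sum_delta0 (fun b => 2 * coefB x0 * z b x0) a0); apply: eq_bigr => b bb.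
    by rewrite Pa//; ring.
  by move=> /eqP; rewrite !mulf_eq0 (negPf B0) pnatr_eq0 /= => /eqP.
have {}B0 y : O y -> coefB y = 0.
  by move=> Oy; apply/eqP; apply: contrapT => /negP By; apply: B0; exists y.
(* P is symmetric, so the diagonal entries of P^2 = 0 are sums of squares. *)
have P0 b c y : O y -> b0 b -> b0 c -> beM b c y = 0.
  move=> Oy bb bc; have := beM_sqr Oy bb bb; rewrite B0// expr0n mulr0.
  have -> : \sum_(k | b0 k) beM b k y * beM k b y = \sum_(k | b0 k) beM b k y ^+ 2.
    by apply: eq_bigr => k _; rewrite (beM_sym k b Oy) expr2.
  move=> /psumr_eq0P h; apply/eqP; rewrite -sqrf_eq0; apply/eqP; apply: h => // k _.
  exact: sqr_ge0.
(* With P = B = 0 every vector satisfies the hypothesis of [kerP_kerS]; K is everything and q = 1 is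
   admissible. *)
have S_0 c j k y : O y -> b0 c -> ~~ b0 j -> ~~ b0 k ->
    \sum_(b | b0 b) (b == c)%:R * S b j k y = 0.
  move=> Oy bc bj bk; apply: (kerP_kerS Oy (v := fun b => (b == c)%:R)) => // c' bc'.
  by rewrite /kerP big1// => b bb; rewrite P0// B0//; ring.
have dq b c y X : O y -> b0 b -> b0 c -> 'D_X (fun _ : E => (b == c)%:R : R) y =
    0 * (b == c)%:R + \sum_(k | b0 k) ((b == k)%:R * om c k y X + om b k y X * (k == c)%:R).
  move=> Oy bb bc; rewrite derive_cst mul0r add0r.
  have -> : \sum_(k | b0 k) ((b == k)%:R * om c k y X + om b k y X * (k == c)%:R) =
      om c b y X + om b c y X.
    rewrite -(sum_delta0 (fun k => om c k y X) bb) -(sum_delta0 (fun k => om b k y X) bc).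
    by rewrite -big_split /=; apply: eq_bigr => k _; rewrite [b == k]eq_sym; ring.
  by rewrite (omC _ b c)//; ring.
have qP b c y : O y -> b0 b -> b0 c -> beM b c y + (b == c)%:R * coefB y = 0 * (b == c)%:R.
  by move=> Oy bb bc; rewrite P0// B0//; ring.
have [W [oW Wx0 sW h]] := @parallel_span O Oo (@subset_refl _ O) x Ox
  (fun b c _ => (b == c)%:R) (fun _ _ => 0) 0
  (fun b c y _ => differentiable_cst _ _) (form_on0 O) dq S_0 qP.
exists x, W, (coefA x), (coefB x); split=> //.
move=> z0 z1 zN zM z fz x1 Wx1 e0 e1 eN ez.
have [-> /(_ a a0) ha] := h _ _ _ _ _ fz x1 Wx1 e0 e1 eN ez; split=> //.
by move: ha; rewrite (sum_delta0 (fun b => z b x) a0).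
Qed.

End Core.

(** * Differentiability of derivatives, determinants and inverses *)

Section Calculus3.
Context {R : realType} {d : nat}.
Local Notation E := 'rV[R]_d.
Implicit Types (O : set E) (f g : E -> R) (x X : E).

Lemma differentiable_eq_on O f g x : open O -> O x ->
  (forall y, O y -> f y = g y) -> differentiable g x -> differentiable f x.
Proof.
move=> Oo Ox fg dg.
have nO : \forall y \near x, O y by exact: (open_nbhs_nbhs (conj Oo Ox)).
have n0 : \forall w \near (0 : E), O (x + w) by exact: (near_shift nO).
have /diff_locallyP[dc _] := dg.
have ex : f \o shift x = cst (f x) + 'd g x +o_ (0 : E) id.
  apply/eqaddoP => e e0.
  have /diff_locally/eqaddoP/(_ e e0) := dg.
  by apply: filterS2 n0 => w Ow; rewrite !fctE /= !fg// addrC.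
have df := diff_unique dc ex.
by apply/diff_locallyP; rewrite df.
Qed.

Lemma differentiable_derive O f x X : open O -> O x ->
  (forall y, O y -> differentiable f y) ->
  (forall k y, O y -> differentiable ('D_(delta_mx 0 k) f) y) ->
  differentiable ('D_X f) x.
Proof.
move=> Oo Ox df ddf.
apply: (@differentiable_eq_on O _ (fun y => \sum_k X 0 k * 'D_(delta_mx 0 k) f y)) => //.
  move=> y Oy; rewrite (deriveE _ (df y Oy)) {1}(row_sum_delta X) linear_sum.
  by apply: eq_bigr => k _; rewrite linearZ (deriveE _ (df y Oy)).
apply: differentiable_fsum => k _; apply: differentiable_fM; first exact: differentiable_cst.
exact: ddf.
Qed.

Lemma differentiable_det n (A : E -> 'M[R]_n) x :
  (forall i j, differentiable (fun y => A y i j) x) -> differentiable (fun y => \det (A y)) x.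
Proof.
move=> dA; apply: differentiable_fsum => s _; apply: differentiable_fM; first exact:
  differentiable_cst.
by apply: differentiable_fprod => i _.
Qed.

Lemma differentiable_invmx n (A : E -> 'M[R]_n) O x i j : open O -> O x ->
  (forall y, O y -> A y \in unitmx) ->
  (forall k l, differentiable (fun y => A y k l) x) ->
  differentiable (fun y => invmx (A y) i j) x.
Proof.
move=> Oo Ox uA dA.
apply: (@differentiable_eq_on O _ (fun y => (\det (A y))^-1 * cofactor (A y) j i)) => //.
  by move=> y Oy; rewrite /invmx uA// !mxE.
apply: differentiable_fM.
  apply: differentiableV; first exact: differentiable_det.
  by have := uA x Ox; rewrite unitmxE unitfE.
apply: differentiable_fM; first exact: differentiable_cst.
apply: differentiable_det => k l.
by under eq_fun do rewrite !mxE; exact: dA.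
Qed.

Lemma derive_mulmx n m p (A : E -> 'M[R]_(n, m)) (B : E -> 'M[R]_(m, p)) x X i j :
  (forall k l, differentiable (fun y => A y k l) x) ->
  (forall k l, differentiable (fun y => B y k l) x) ->
  'D_X (fun y => (A y *m B y) i j) x =
  \sum_k ('D_X (fun y => A y i k) x * B x k j + A x i k * 'D_X (fun y => B y k j) x).
Proof.
move=> dA dB; under eq_fun do rewrite mxE.
rewrite derive_fsum; last by move=> k _; exact: differentiable_fM.
by apply: eq_bigr => k _; rewrite derive_fM.
Qed.

Lemma derive_entries n m (A : E -> 'M[R]_(n, m)) x X :
  (forall k l, differentiable (fun y => A y k l) x) ->
  'D_X A x = \matrix_(i, j) 'D_X (fun y => A y i j) x.
Proof.
by move=> dA; apply: derive_mx; apply/derivable_mxP => i j; exact: diff_derivable.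
Qed.

End Calculus3.

(** * Structure equations of a moving frame *)

Section MaurerCartan.
Context {R : realType} {d n : nat}.
Local Notation E := 'rV[R]_d.
Variables (O : set E) (Oo : open O) (y : E -> 'M[R]_n).
Hypothesis dy : forall A B x, O x -> differentiable (fun t => y t A B) x.
Hypothesis ddy : forall A B k x, O x ->
  differentiable ('D_(delta_mx 0 k) (fun t => y t A B)) x.
Hypothesis uy : forall x, O x -> y x \in unitmx.

Definition mc_form A B x X : R := ('D_X y x *m invmx (y x)) A B.

Lemma mc_formE A B x X : O x ->
  mc_form A B x X = \sum_C 'D_X (fun t => y t A C) x * invmx (y x) C B.
Proof.
move=> Ox; rewrite /mc_form derive_entries; last by move=> *; exact: dy.
by rewrite mxE; apply: eq_bigr => C _; rewrite mxE.
Qed.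

Lemma ddyX A B x X : O x -> differentiable ('D_X (fun t => y t A B)) x.
Proof. by move=> Ox; apply: (differentiable_derive (O := O)) => //; [exact: dy|exact: ddy]. Qed.

Lemma dinv A B x : O x -> differentiable (fun t => invmx (y t) A B) x.
Proof. by move=> Ox; apply: (differentiable_invmx _ _ Oo Ox uy) => k l; exact: dy. Qed.

Lemma mc_form_on A B : form_on O (mc_form A B).
Proof.
split=> x Ox.
  move=> c X X'; rewrite !mc_formE// mulr_sumr -big_split /=; apply: eq_bigr => C _.
  rewrite !(deriveE _ (dy A C Ox)) linearP /=.
  by rewrite mulrDl mulrA.
move=> X; apply: (differentiable_eq_on Oo Ox (fun t Ot => mc_formE A B X Ot)).
by apply: differentiable_fsum => C _; apply: differentiable_fM; [exact: ddyX|exact: dinv].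
Qed.

Lemma derive_row A B x X : O x ->
  'D_X (fun t => y t A B) x = \sum_C mc_form A C x X * y x C B.
Proof.
move=> Ox; have -> : \sum_C mc_form A C x X * y x C B = ('D_X y x *m invmx (y x) *m y x) A B.
  by rewrite mxE.
rewrite -mulmxA mulVmx ?uy// mulmx1 derive_entries; last by move=> *; exact: dy.
by rewrite mxE.
Qed.

Lemma derive_inv A B x X : O x ->
  'D_X (fun t => invmx (y t) A B) x = - \sum_C invmx (y x) A C * mc_form C B x X.
Proof.
move=> Ox.
pose Dg := \matrix_(i, j) 'D_X (fun t => invmx (y t) i j) x.
have yDg : y x *m Dg = - ('D_X y x *m invmx (y x)).
  apply/matrixP => i j.
  have : 'D_X (fun t => (y t *m invmx (y t)) i j) x = 0.
    rewrite (derive_eq_on Oo (g := cst ((1%:M : 'M[R]_n) i j)) X Ox) ?derive_cst//.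
    by move=> t Ot; rewrite mulmxV ?uy.
  rewrite derive_mulmx; [|by move=> *; exact: dy|by move=> *; exact: dinv].
  rewrite big_split /= => /eqP; rewrite addrC addr_eq0 => /eqP h.
  rewrite [LHS]mxE [RHS]mxE -/(mc_form i j x X) mc_formE//.
  by rewrite -h; apply: eq_bigr => k _; rewrite mxE.
have : Dg = - (invmx (y x) *m ('D_X y x *m invmx (y x))).
  by rewrite -mulmxN -yDg mulmxA mulVmx ?uy// mul1mx.
move=> /matrixP/(_ A B); rewrite mxE => ->; rewrite mxE; congr (- _).
by rewrite mxE.
Qed.

(** Differentiate omega = dy y^-1: the second derivatives of y drop out by [schwarz], and d(y^-1) =
    - y^-1 omega produces the products. The sign is that of dy = omega y, the frame vectors being
    rows. *)
Lemma maurer_cartan A B x X X' : O x ->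
  dform (mc_form A B) x X X' = \sum_C wedge (mc_form A C) (mc_form C B) x X X'.
Proof.
move=> Ox; rewrite /dform.
pose D2 (Z Z' : E) : R := \sum_C 'D_Z ('D_Z' (fun t => y t A C)) x * invmx (y x) C B.
pose W (Z Z' : E) : R := \sum_C mc_form A C x Z * mc_form C B x Z'.
have half Z Z' : 'D_Z (mc_form A B ^~ Z') x =
   D2 Z Z' - W Z' Z.
  rewrite (derive_eq_on Oo Z Ox (fun t Ot => mc_formE A B Z' Ot)).
  rewrite derive_fsum; last first.
    by move=> C _; apply: differentiable_fM; [exact: ddyX|exact: dinv].
  have -> : W Z' Z = - \sum_C 'D_Z' (fun t => y t A C) x * 'D_Z (fun t => invmx (y t) C B) x.
    rewrite -sumrN; under [RHS]eq_bigr do rewrite derive_inv// mulrN opprK mulr_sumr.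
    rewrite exchange_big /=; apply: eq_bigr => C _.
    by rewrite mc_formE// mulr_suml; apply: eq_bigr => D _; rewrite mulrA.
  rewrite opprK -big_split /=; apply: eq_bigr => C _.
  by rewrite derive_fM//; [exact: ddyX|exact: dinv].
have sw : D2 X X' = D2 X' X.
  apply: eq_bigr => C _.
  have nx : \forall t \near x, differentiable (fun t => y t A C) t.
    have : \forall t \near x, O t by exact: (open_nbhs_nbhs (conj Oo Ox)).
    by apply: filterS => t; exact: dy.
  exact: (congr1 (fun r => r * invmx (y x) C B) (schwarz nx (ddyX A C X' Ox) (ddyX A C X Ox))).
apply: (etrans (congr2 (fun u v => u - v) (half X X') (half X' X))).
rewrite sw; move: (D2 X' X) => u.
have -> : \sum_C wedge (mc_form A C) (mc_form C B) x X X' = W X X' - W X' X.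
  by rewrite -sumrB.
by move: (W X X') (W X' X) => v w; ring.
Qed.

End MaurerCartan.

(** * Lie frames *)

Section FrameIndices.
Context {d : nat}.
Local Notation I4 := 'I_d.+1.+3.

Lemma tg_proof (i : 'I_d) : (i.+2 < d.+1.+3)%N.
Proof. by have := ltn_ord i; lia. Qed.
(** With n = d + 1, these are the indices 2, .., n that the four blocks partition. *)
Definition tg (i : 'I_d) : I4 := Ordinal (tg_proof i).
(* Locked, as unification otherwise compares the indices 1, n + 1 and i + 2 by computation. *)
Definition c1 : I4 := locked (@ord_one d.+1).
Definition cN : I4 := locked (inord d.+2).

Lemma c1E : c1 = ord_one. Proof. by rewrite /c1 -lock. Qed.
Lemma val_c1 : val c1 = 1%N. Proof. by rewrite c1E /= inordK. Qed.
Lemma val_cN : val cN = d.+2. Proof. by rewrite /cN -lock /= inordK. Qed.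

Lemma sum_frame (V : nmodType) (F : I4 -> V) :
  \sum_C F C = F ord0 + F c1 + \sum_i F (tg i) + F cN + F ord_max.
Proof.
rewrite big_ord_recl big_ord_recl big_ord_recr big_ord_recr /= !addrA.
congr (_ + F _ + _ + F _ + F _).
- by apply: val_inj; rewrite val_c1.
- by apply: eq_bigr => i _; congr F; apply: val_inj.
- by apply: val_inj; rewrite val_cN.
- exact: val_inj.
Qed.

Variant idx_spec : I4 -> Prop :=
  | Idx0 : idx_spec ord0 | Idx1 : idx_spec c1 | IdxT i : idx_spec (tg i)
  | IdxN : idx_spec cN | IdxM : idx_spec ord_max.

Lemma idxP (A : I4) : idx_spec A.
Proof.
have [h0|h0] := eqVneq (val A) 0%N.
  have -> : A = ord0 by exact: val_inj.
  by constructor.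
have [h1|h1] := eqVneq (val A) 1%N.
  have -> : A = c1 by apply: val_inj; rewrite val_c1.
  by constructor.
have [hN|hN] := eqVneq (val A) d.+2.
  have -> : A = cN by apply: val_inj; rewrite val_cN.
  by constructor.
have [hM|hM] := eqVneq (val A) d.+3.
  have -> : A = ord_max by exact: val_inj.
  by constructor.
have hA : (val A - 2 < d)%N by have := ltn_ord A; move: h0 h1 hN hM => /=; lia.
have -> : A = tg (Ordinal hA) by apply: val_inj => /=; move: h0 h1 => /=; lia.
exact: IdxT.
Qed.
End FrameIndices.

Section LieFrame.
Context {R : realType} {d : nat}.
Local Notation I4 := 'I_d.+1.+3.
Implicit Types (Y : 'M[R]_d.+1.+3).

(** The Gram matrix J of a Lie frame: a symmetric involution that exchanges 0 with n + 2 and 1 with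
    n + 1 up to sign. *)
Definition lie_gram (A B : I4) : R :=
  if (minn A B <= 1)%N && (A + B == d.+1.+2)%N then -1
  else if (A == B) && (2 <= A <= d.+1)%N then 1 else 0.

Lemma lie_gram0 A : lie_gram A ord0 = - (A == ord_max)%:R.
Proof.
rewrite /lie_gram -!val_eqE /= addn0.
by case: (eqVneq (nat_of_ord A) d.+3) => // _; case: eqP => [->|_] /=; rewrite ?oppr0.
Qed.

Lemma lie_gram1 A : lie_gram A c1 = - (A == cN)%:R.
Proof.
rewrite /lie_gram -!val_eqE val_c1 val_cN /= val_c1 geq_minr addn1 eqSS /=.
by case: (eqVneq (nat_of_ord A) d.+2) => // _; case: eqP => [->|_] /=; rewrite ?oppr0.
Qed.

Lemma lie_gramN A : lie_gram A cN = - (A == c1)%:R.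
Proof.
rewrite /lie_gram -!val_eqE val_c1 val_cN /= val_cN.
case: (eqVneq (nat_of_ord A) 1%N) => [->|h]; first by rewrite add1n eqxx.
have -> : (minn A d.+2 <= 1)%N && (A + d.+2 == d.+3)%N = false by apply/negP; lia.
by case: eqP => [->|_] /=; rewrite ?ltnn ?ltnS ?ltnn ?oppr0 ?andbF//; case: ifP => //; lia.
Qed.

Lemma lie_gramM A : lie_gram A ord_max = - (A == ord0)%:R.
Proof.
rewrite /lie_gram -!val_eqE /=.
case: (eqVneq (nat_of_ord A) 0%N) => [->|h]; first by rewrite add0n eqxx min0n.
have -> : (minn A d.+3 <= 1)%N && (A + d.+3 == d.+3)%N = false by apply/negP; lia.
by case: eqP => [->|_] /=; rewrite ?oppr0//; case: ifP => //; lia.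
Qed.

Lemma lie_gramT A i : lie_gram A (tg i) = (A == tg i)%:R.
Proof.
rewrite /lie_gram -!val_eqE /=; have := ltn_ord i => hi.
have -> : (minn A i.+2 <= 1)%N && (A + i.+2 == d.+3)%N = false by apply/negP; lia.
case: eqP => [->|_] //=.
by case: ifP => //; lia.
Qed.

Definition lie_sign (k : I4) : R := (-1) ^+ ((k == ord0) || (k == ord_max)).

Lemma lie_formE (u v : 'rV[R]_d.+1.+3) : lie_form u v = \sum_k lie_sign k * (u 0 k * v 0 k).
Proof. by []. Qed.

Lemma lie_formC (u v : 'rV[R]_d.+1.+3) : lie_form u v = lie_form v u.
Proof. by apply: eq_bigr => k _; rewrite [u 0 k * _]mulrC. Qed.

(** With D the diagonal matrix of the signs, Y D Y^T = J and J^2 = 1, so D Y^T J is a right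
    inverse. *)
Lemma lie_frame_unit Y : lie_frame Y -> Y \in unitmx.
Proof.
move=> hY.
pose Z := \matrix_(k, B) (\sum_C lie_sign k * Y C k * lie_gram C B).
suff : Y *m Z = 1%:M by case/mulmx1_unit.
apply/matrixP => A B; rewrite !mxE.
have -> : \sum_j Y A j * Z j B = \sum_C lie_gram A C * lie_gram C B.
  under eq_bigr do rewrite mxE mulr_sumr.
  rewrite exchange_big /=; apply: eq_bigr => C _.
  rewrite [lie_gram A C](_ : _ = lie_form (row A Y) (row C Y)); last by rewrite hY.
  by rewrite mulr_suml; apply: eq_bigr => k _; rewrite !mxE /lie_sign; ring.
have dl (c : R) (D : I4) : \sum_C lie_gram A C * (c * (C == D)%:R) = c * lie_gram A D.
  rewrite -(sum_deltaL (fun C => c * lie_gram A C)); apply: eq_bigr => C _; ring.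
case: (idxP B) => [||i||].
- have := dl (-1) ord_max; rewrite lie_gramM => h.
  by rewrite (eq_bigr (fun C => lie_gram A C * (-1 * (C == ord_max)%:R))) ?h => [|C _];
    rewrite ?lie_gram0; ring.
- have := dl (-1) cN; rewrite lie_gramN => h.
  by rewrite (eq_bigr (fun C => lie_gram A C * (-1 * (C == cN)%:R))) ?h => [|C _]; rewrite
    ?lie_gram1; ring.
- have := dl 1 (tg i); rewrite lie_gramT => h.
  by rewrite (eq_bigr (fun C => lie_gram A C * (1 * (C == tg i)%:R))) ?h => [|C _]; rewrite
    ?lie_gramT; ring.
- have := dl (-1) c1; rewrite lie_gram1 => h.
  by rewrite (eq_bigr (fun C => lie_gram A C * (-1 * (C == c1)%:R))) ?h => [|C _]; rewrite
    ?lie_gramN; ring.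
- have := dl (-1) ord0; rewrite lie_gram0 => h.
  by rewrite (eq_bigr (fun C => lie_gram A C * (-1 * (C == ord0)%:R))) ?h => [|C _]; rewrite
    ?lie_gramM; ring.
Qed.

End LieFrame.

(** * Connection forms of a second order Lie frame *)

Section LocalFrame.
Context {R : realType} {d : nat}.
Local Notation E := 'rV[R]_d.
Local Notation I4 := 'I_d.+1.+3.
Variables (O : set E) (Oo : open O) (y : E -> 'M[R]_d.+1.+3).
Hypothesis dy : forall A B x, O x -> differentiable (fun t => y t A B) x.
Hypothesis hframe : forall x, O x -> lie_frame (y x).
Variable w : I4 -> I4 -> E -> E -> R.
Hypothesis w_form : forall A B, form_on O (w A B).
Hypothesis w_row : forall A B x X, O x ->
  'D_X (fun t => y t A B) x = \sum_C w A C x X * y x C B.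
Hypothesis w_mc : forall A B x X X', O x ->
  dform (w A B) x X X' = \sum_C wedge (w A C) (w C B) x X X'.
Local Notation c0 := (@ord0 d.+1.+2).
Local Notation cM := (@ord_max d.+1.+2).

Lemma derive_row_lie A (v : 'rV[R]_d.+1.+3) x X : O x ->
  'D_X (fun t => lie_form (row A (y t)) v) x =
  \sum_C w A C x X * lie_form (row C (y x)) v.
Proof.
move=> Ox; transitivity ('D_X (fun t => \sum_k (lie_sign k * v 0 k) * y t A k) x).
  by apply: (derive_eq_on Oo) => // t _; apply: eq_bigr => k _; rewrite mxE /lie_sign; ring.
rewrite derive_fsum; last first.
  by move=> k _; apply: differentiable_fM; [exact: differentiable_cst|exact: dy].
transitivity (\sum_k \sum_C w A C x X * (lie_sign k * (y x C k * v 0 k))).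
  apply: eq_bigr => k _; rewrite derive_fM; [|exact: differentiable_cst|exact: dy].
  rewrite derive_cst mul0r add0r w_row// mulr_sumr.
  by apply: eq_bigr => C _; ring.
rewrite exchange_big; apply: eq_bigr => C _ /=; rewrite -mulr_sumr; congr (_ * _).
by apply: eq_bigr => k _; rewrite mxE.
Qed.

Lemma lie_row_diff A (v : 'rV[R]_d.+1.+3) x : O x ->
  differentiable (fun t => lie_form (row A (y t)) v) x.
Proof.
move=> Ox; apply: differentiable_fsum => k _; apply: differentiable_fM; first exact:
  differentiable_cst.
apply: differentiable_fM; last exact: differentiable_cst.
by under eq_fun do rewrite mxE; exact: dy.
Qed.

Lemma w_skew A B x X : O x ->
  \sum_C w A C x X * lie_gram C B + \sum_C w B C x X * lie_gram C A = 0.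
Proof.
move=> Ox.
have h0 : 'D_X (fun t => \sum_k lie_sign k * (y t A k * y t B k)) x = 0.
  rewrite (derive_eq_on Oo (g := cst (lie_gram A B)) X Ox) ?derive_cst// => t Ot.
  by rewrite -[RHS](hframe Ot A B); apply: eq_bigr => k _; rewrite !mxE.
have dyy k : differentiable (fun t => y t A k * y t B k) x.
  by apply: differentiable_fM; exact: dy.
rewrite -[RHS]h0 derive_fsum; last first.
  by move=> k _; apply: differentiable_fM; [exact: differentiable_cst|exact: dyy].
have half D C : lie_gram C D = \sum_k lie_sign k * (y x C k * y x D k).
  by rewrite -[LHS](hframe Ox C D); apply: eq_bigr => k _; rewrite !mxE.
have swap D D' : \sum_C w D C x X * lie_gram C D' =
    \sum_k lie_sign k * ('D_X (fun t => y t D k) x * y x D' k).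
  under eq_bigr do rewrite half mulr_sumr.
  rewrite exchange_big; apply: eq_bigr => k _ /=.
  rewrite w_row// mulr_suml mulr_sumr.
  by apply: eq_bigr => C _; ring.
rewrite !swap -big_split /=; apply: eq_bigr => k _.
rewrite derive_fM; [|exact: differentiable_cst|exact: dyy].
by rewrite derive_cst derive_fM; [ring|exact: dy..].
Qed.

Lemma sumJ (f : I4 -> R) :
  ((\sum_C f C * lie_gram C ord0 = - f cM) * (\sum_C f C * lie_gram C c1 = - f cN) *
   (\sum_C f C * lie_gram C cN = - f c1) * (\sum_C f C * lie_gram C cM = - f c0) *
   (forall i, \sum_C f C * lie_gram C (tg i) = f (tg i)))%type.
Proof.
have h (D B : I4) (s : R) : (forall C, lie_gram C B = s * (C == D)%:R) ->
    \sum_C f C * lie_gram C B = s * f D.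
  move=> JB; rewrite -(sum_deltaL (fun C => s * f C)); apply: eq_bigr => C _.
  by rewrite JB; ring.
have J0 : \sum_C f C * lie_gram C ord0 = - f cM by rewrite (h cM _ (-1)) => [|C]; rewrite
  ?lie_gram0; ring.
have J1 : \sum_C f C * lie_gram C c1 = - f cN by rewrite (h cN _ (-1)) => [|C]; rewrite
  ?lie_gram1; ring.
have JN : \sum_C f C * lie_gram C cN = - f c1 by rewrite (h c1 _ (-1)) => [|C]; rewrite
  ?lie_gramN; ring.
have JM : \sum_C f C * lie_gram C cM = - f c0 by rewrite (h c0 _ (-1)) => [|C]; rewrite
  ?lie_gramM; ring.
have JT i : \sum_C f C * lie_gram C (tg i) = f (tg i).
  by rewrite (h (tg i) _ 1) => [|C]; rewrite ?lie_gramT; ring.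
exact: (J0, J1, JN, JM, JT).
Qed.

Hypothesis contact : forall x X, O x -> w c0 cN x X = 0.
Hypothesis w01 : forall x X, O x -> w c0 c1 x X = 0.
Hypothesis w10 : forall x X, O x -> w c1 c0 x X = 0.
Hypothesis w11 : forall x X, O x -> w c1 c1 x X = w c0 c0 x X.

Section Skew.
Variables (x X : E).
Hypothesis Ox : O x.

Lemma w0M : w c0 cM x X = 0.
Proof. by have := w_skew c0 c0 X Ox; rewrite !sumJ; lra. Qed.
Lemma w1N : w c1 cN x X = 0.
Proof. by have := w_skew c1 c1 X Ox; rewrite !sumJ; lra. Qed.
Lemma w1M : w c1 cM x X = 0.
Proof. by have := w_skew c0 c1 X Ox; rewrite !sumJ contact//; lra. Qed.
Lemma wTM i : w (tg i) cM x X = w c0 (tg i) x X.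
Proof. by have := w_skew (tg i) c0 X Ox; rewrite !sumJ; lra. Qed.
Lemma wTN i : w (tg i) cN x X = w c1 (tg i) x X.
Proof. by have := w_skew (tg i) c1 X Ox; rewrite !sumJ; lra. Qed.
Lemma wNT i : w cN (tg i) x X = w (tg i) c1 x X.
Proof. by have := w_skew (tg i) cN X Ox; rewrite !sumJ; lra. Qed.
Lemma wMT i : w cM (tg i) x X = w (tg i) c0 x X.
Proof. by have := w_skew (tg i) cM X Ox; rewrite !sumJ; lra. Qed.
Lemma wN1 : w cN c1 x X = 0.
Proof. by have := w_skew cN cN X Ox; rewrite !sumJ; lra. Qed.
Lemma wNN : w cN cN x X = - w c0 c0 x X.
Proof. by have := w_skew c1 cN X Ox; rewrite !sumJ w11//; lra. Qed.
Lemma wNM : w cN cM x X = 0.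
Proof. by have := w_skew cN c0 X Ox; rewrite !sumJ w01//; lra. Qed.
Lemma wM1 : w cM c1 x X = - w cN c0 x X.
Proof. by have := w_skew cM cN X Ox; rewrite !sumJ; lra. Qed.
Lemma wTT i j : w (tg j) (tg i) x X = - w (tg i) (tg j) x X.
Proof. by have := w_skew (tg i) (tg j) X Ox; rewrite !sumJ; lra. Qed.
End Skew.

Variable bl : 'I_d -> nat.
Hypothesis bl_lt : forall i, (bl i < 4)%N.
Hypothesis fo0 : forall x X i, O x -> bl i = 0%N -> w c0 (tg i) x X = 0.
Hypothesis fo1 : forall x X i, O x -> bl i = 1%N -> w c1 (tg i) x X = 0.
Hypothesis fo2 : forall x X i, O x -> bl i = 2%N -> w c0 (tg i) x X + w c1 (tg i) x X = 0.
Hypothesis fo3 : forall x X i, O x -> bl i = 3%N -> - 1 * w c0 (tg i) x X + w c1 (tg i) x X = 0.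

Definition coframe i : E -> E -> R := if bl i == 0%N then w c1 (tg i) else w c0 (tg i).

Lemma w0T x X i : O x -> w c0 (tg i) x X = blx bl i * coframe i x X.
Proof.
move=> Ox; rewrite /coframe /blx; case: eqP => [b|_]; first by rewrite fo0// mul0r.
by rewrite mul1r.
Qed.

Lemma w1T x X i : O x -> w c1 (tg i) x X = bly bl i * coframe i x X.
Proof.
move=> Ox; rewrite /coframe /bly; have := bl_lt i.
case b: (bl i) => [|[|[|[|//]]]] _ /=; first by rewrite mul1r.
- by rewrite fo1// mul0r.
- by have := fo2 X Ox b; lra.
- by have := fo3 X Ox b; lra.
Qed.

Lemma th_form i : form_on O (coframe i).
Proof. by rewrite /coframe; case: ifP => _; exact: w_form. Qed.

Hypothesis immersed : forall x X, O x -> (forall i, coframe i x X = 0) -> X = 0.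
Hypothesis dw00 : forall x X X', O x -> dform (w c0 c0) x X X' = 0.

Lemma mc_split A B x X X' : O x -> dform (w A B) x X X' =
  wedge (w A c0) (w c0 B) x X X' + wedge (w A c1) (w c1 B) x X X'
  + \sum_i wedge (w A (tg i)) (w (tg i) B) x X X'
  + wedge (w A cN) (w cN B) x X X' + wedge (w A cM) (w cM B) x X X'.
Proof.
by move=> Ox; rewrite w_mc// sum_frame.
Qed.

Lemma str0 (B : I4) x X X' : O x ->
  dform (w c0 B) x X X' = wedge (w c0 c0) (w c0 B) x X X'
  + \sum_i blx bl i * wedge (coframe i) (w (tg i) B) x X X'.
Proof.
move=> Ox; rewrite mc_split//.
have -> : \sum_i wedge (w c0 (tg i)) (w (tg i) B) x X X' =
    \sum_i blx bl i * wedge (coframe i) (w (tg i) B) x X X'.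
  by apply: eq_bigr => i _; rewrite /wedge !w0T//; ring.
by rewrite /wedge !w01// !contact// !w0M//; ring.
Qed.

Lemma str1 (B : I4) x X X' : O x ->
  dform (w c1 B) x X X' = wedge (w c0 c0) (w c1 B) x X X'
  + \sum_i bly bl i * wedge (coframe i) (w (tg i) B) x X X'.
Proof.
move=> Ox; rewrite mc_split//.
have -> : \sum_i wedge (w c1 (tg i)) (w (tg i) B) x X X' =
    \sum_i bly bl i * wedge (coframe i) (w (tg i) B) x X X'.
  by apply: eq_bigr => i _; rewrite /wedge !w1T//; ring.
by rewrite /wedge !w10// !w1N// !w1M// !w11//; ring.
Qed.

Definition Theta x : 'M[R]_d := \matrix_(k, l) coframe l x (delta_mx 0 k).

Lemma mul_Theta x X : O x -> X *m Theta x = \row_l coframe l x X.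
Proof.
move=> Ox; apply/rowP => l; rewrite !mxE (form_coord (th_form l) X Ox).
by apply: eq_bigr => k _; rewrite mxE.
Qed.

Lemma Theta_unit x : O x -> Theta x \in unitmx.
Proof.
move=> Ox; rewrite -row_free_unit -kermx_eq0; apply/eqP/row_matrixP => i.
rewrite row0; apply: (immersed Ox) => l.
have : row i (kermx (Theta x)) *m Theta x = 0 by rewrite -row_mul mulmx_ker row0.
by rewrite mul_Theta// => /rowP/(_ l); rewrite !mxE.
Qed.

Definition dualframe i x : E := row i (invmx (Theta x)).

Lemma th_dual x i j : O x -> coframe i x (dualframe j x) = (i == j)%:R.
Proof.
move=> Ox; have := mul_Theta (dualframe j x) Ox.
rewrite -row_mul mulVmx ?Theta_unit// => /rowP/(_ i); rewrite !mxE => <-.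
by rewrite eq_sym.
Qed.

Lemma dual_basis x X : O x -> X = \sum_i coframe i x X *: dualframe i x.
Proof.
move=> Ox; rewrite -[LHS]mulmx1 -(mulmxV (Theta_unit Ox)) mulmxA mul_Theta//.
by rewrite mulmx_sum_row; apply: eq_bigr => i _; rewrite mxE.
Qed.

Lemma dual_diff i k x : O x -> differentiable (fun t => dualframe i t 0 k) x.
Proof.
move=> Ox; under eq_fun do rewrite mxE.
apply: (differentiable_invmx _ _ Oo Ox Theta_unit) => j l.
under eq_fun do rewrite mxE.
exact: (form_diff (th_form l)).
Qed.

Variable S : 'I_d -> 'I_d -> 'I_d -> E -> R.
Hypothesis dS : forall i j k x, O x -> differentiable (S i j k) x.
Hypothesis wS : forall x X i j, O x ->
  Delta bl i j * w (tg i) (tg j) x X = \sum_k S i j k x * coframe k x X.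
Hypothesis SC12 : forall i j k x, S j i k x = S i j k x.
Hypothesis SC23 : forall i j k x, S i k j x = S i j k x.
Hypothesis S0 : forall i j k x, bl i = bl j -> S i j k x = 0.
Variable a : 'I_d.
Hypothesis a0 : bl a == 0%N.
Hypothesis Sa : forall x j k, O x -> S a j k x = 0.
Variables i1 i2 i3 : 'I_d.
Hypothesis bi1 : bl i1 = 1%N.
Hypothesis bi2 : bl i2 = 2%N.
Hypothesis bi3 : bl i3 = 3%N.

Lemma dform_cstM (c : R) (eta : E -> E -> R) x X X' : form_on O eta -> O x ->
  dform (fun t Z => c * eta t Z) x X X' = c * dform eta x X X'.
Proof.
move=> h Ox; rewrite (@dformM _ _ O (fun=> c) eta x X X' (differentiable_cst c x) h Ox).
by rewrite !derive_cst; ring.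
Qed.

Lemma str_th0 x X X' i : O x -> blx bl i * dform (coframe i) x X X' =
  blx bl i * wedge (w c0 c0) (coframe i) x X X'
  + \sum_j blx bl j * wedge (coframe j) (w (tg j) (tg i)) x X X'.
Proof.
move=> Ox; rewrite -(dform_cstM _ _ _ (th_form i) Ox).
rewrite -(dform_eq_on Oo X X' Ox (fun t Z Ot => w0T Z i Ot)) str0//; congr (_ + _).
by rewrite /wedge !w0T//; ring.
Qed.

Lemma str_th1 x X X' i : O x -> bly bl i * dform (coframe i) x X X' =
  bly bl i * wedge (w c0 c0) (coframe i) x X X'
  + \sum_j bly bl j * wedge (coframe j) (w (tg j) (tg i)) x X X'.
Proof.
move=> Ox; rewrite -(dform_cstM _ _ _ (th_form i) Ox).
rewrite -(dform_eq_on Oo X X' Ox (fun t Z Ot => w1T Z i Ot)) str1//; congr (_ + _).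
by rewrite /wedge !w1T//; ring.
Qed.

(** Here d omega_0^0 = 0 enters; in [str_11] it does so through omega_1^1 = omega_0^0. *)
Lemma str_00 x X X' : O x -> \sum_i blx bl i * wedge (coframe i) (w (tg i) c0) x X X' = 0.
Proof.
move=> Ox; have := str0 c0 X X' Ox; rewrite dw00//.
by move: (\sum_i _) => s; rewrite /wedge; lra.
Qed.

Lemma str_01 x X X' : O x -> \sum_i blx bl i * wedge (coframe i) (w (tg i) c1) x X X' = 0.
Proof.
move=> Ox; have := str0 c1 X X' Ox.
rewrite (dform_eq0_on Oo _ _ Ox); last by move=> t Z Ot; exact: w01.
by move: (\sum_i _) => s; rewrite /wedge !w01//; lra.
Qed.

Lemma str_10 x X X' : O x -> \sum_i bly bl i * wedge (coframe i) (w (tg i) c0) x X X' = 0.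
Proof.
move=> Ox; have := str1 c0 X X' Ox.
rewrite (dform_eq0_on Oo _ _ Ox); last by move=> t Z Ot; exact: w10.
by move: (\sum_i _) => s; rewrite /wedge !w10//; lra.
Qed.

Lemma str_11 x X X' : O x -> \sum_i bly bl i * wedge (coframe i) (w (tg i) c1) x X X' = 0.
Proof.
move=> Ox; have := str1 c1 X X' Ox.
rewrite (dform_eq_on Oo X X' Ox (fun t Z Ot => w11 Z Ot)) dw00//.
by move: (\sum_i _) => s; rewrite /wedge !w11//; lra.
Qed.

Lemma str_om x X X' i j : O x ->
  dform (w (tg i) (tg j)) x X X' =
    blx bl j * wedge (w (tg i) c0) (coframe j) x X X' + bly bl j * wedge (w (tg i) c1)
      (coframe j) x X X'
    + bly bl i * wedge (coframe i) (w (tg j) c1) x X X' + blx bl i * wedge (coframe i) (w (tg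
      j) c0) x X X'
    + \sum_k wedge (w (tg i) (tg k)) (w (tg k) (tg j)) x X X'.
Proof.
move=> Ox; rewrite mc_split// /wedge !wTN// !wTM// !wNT// !wMT// !w0T// !w1T//.
by ring.
Qed.

Lemma str_be x X X' j : O x ->
  dform (w (tg j) c1) x X X' =
    wedge (w (tg j) c1) (w c0 c0) x X X'
    + \sum_k wedge (w (tg j) (tg k)) (w (tg k) c1) x X X'
    - blx bl j * wedge (coframe j) (w cN c0) x X X'.
Proof.
move=> Ox; rewrite mc_split// /wedge !wTN// !wTM// !wN1// !wM1// !w01// !w11// !w0T//.
by ring.
Qed.

Lemma frame_functions_lie (v : 'rV[R]_d.+1.+3) :
  frame_functions O bl (w c0 c0) (w cN c0) coframe (fun i => w (tg i) c0) (fun i => w (tg i) c1)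
    (fun i j => w (tg i) (tg j))
    (fun t => lie_form (row c0 (y t)) v) (fun t => lie_form (row c1 (y t)) v)
    (fun t => lie_form (row cN (y t)) v) (fun t => lie_form (row cM (y t)) v)
    (fun i t => lie_form (row (tg i) (y t)) v).
Proof.
split=> [x Ox|x X Ox|x X Ox|x X i Ox|x X Ox].
- by split=> *; exact: lie_row_diff.
- rewrite derive_row_lie// sum_frame w01// contact// w0M//.
  have -> : \sum_i w c0 (tg i) x X * lie_form (row (tg i) (y x)) v =
      \sum_i blx bl i * coframe i x X * lie_form (row (tg i) (y x)) v.
    by apply: eq_bigr => i _; rewrite w0T.
  by ring.
- rewrite derive_row_lie// sum_frame w10// w11// w1N// w1M//.
  have -> : \sum_i w c1 (tg i) x X * lie_form (row (tg i) (y x)) v =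
      \sum_i bly bl i * coframe i x X * lie_form (row (tg i) (y x)) v.
    by apply: eq_bigr => i _; rewrite w1T.
  by ring.
- by rewrite derive_row_lie// sum_frame wTN// wTM// w0T// w1T//.
- rewrite derive_row_lie// sum_frame wN1// wNN// wNM//.
  have -> : \sum_i w cN (tg i) x X * lie_form (row (tg i) (y x)) v =
      \sum_i w (tg i) c1 x X * lie_form (row (tg i) (y x)) v.
    by apply: eq_bigr => i _; rewrite wNT.
  by ring.
Qed.

Lemma frame_core x : O x -> exists x0 W (A0 B0 : R),
  [/\ open W, W x0, W `<=` O & forall x1, W x1 ->
    lie_form (row cN (y x0) + A0 *: row c0 (y x0) + B0 *: row c1 (y x0)) (row c0 (y x1)) = 0 /\
    lie_form (row (tg a) (y x0)) (row c0 (y x1)) = 0].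
Proof.
move=> Ox.
have [x0 [W [A0 [B0 [oW Wx0 sW h]]]]] := @dupin_core R d O Oo bl bl_lt (w c0 c0) (w cN c0)
  coframe
  (fun i => w (tg i) c0) (fun i => w (tg i) c1) (fun i j => w (tg i) (tg j)) S dualframe
  (w_form _ _) (w_form _ _) th_form (fun i => w_form _ _) (fun i => w_form _ _)
  (fun i j => w_form _ _) dS dual_diff th_dual dual_basis
  (fun t Z i j Ot => wTT Z Ot i j) wS SC12 SC23 S0 str_th0 str_th1 str_00 str_01 str_10 str_11
  str_om str_be a a0 Sa i1 i2 i3 bi1 bi2 bi3 x Ox.
exists x0, W, A0, B0; split=> // x1 Wx1.
have Ox1 := sW _ Wx1.
(* The test vector is v = Y_0(x1). At x1 only Y_(n+2) has a nonzero product with it, so all initial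
   values required by [dupin_core] vanish. *)
have J0 A : lie_form (row A (y x1)) (row c0 (y x1)) = lie_gram A c0 by rewrite hframe.
have z A : val A != d.+3 -> lie_form (row A (y x1)) (row c0 (y x1)) = 0.
  by move=> nA; rewrite J0 lie_gram0 -val_eqE (negPf nA) oppr0.
have z0 := z c0 isT.
have z1 : lie_form (row c1 (y x1)) (row c0 (y x1)) = 0 by apply: z; rewrite val_c1.
have zN : lie_form (row cN (y x1)) (row c0 (y x1)) = 0.
  by apply: z; rewrite val_cN; apply/negP; lia.
have zT i : lie_form (row (tg i) (y x1)) (row c0 (y x1)) = 0.
  by apply: z => /=; have := ltn_ord i; lia.
have [h1 h2] := h _ _ _ _ _ (frame_functions_lie (row c0 (y x1))) x1 Wx1 z0 z1 zN (fun i _ =>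
  zT i).
split=> //; rewrite -[RHS]h1 !lie_formE !mulr_sumr -!big_split /=; apply: eq_bigr => k _.
by rewrite !mxE; ring.
Qed.
End LocalFrame.

(** * The second order frame field *)

Section Blocks.
Context {d : nat}.
Variables (m1 m2 m3 m4 : nat).
Hypothesis dm : d = (m1 + m2 + m3 + m4)%N.
Local Notation m := [:: m1; m2; m3; m4].

Definition block_of (i : 'I_d) : nat :=
  if (i < m1)%N then 0%N else if (i < m1 + m2)%N then 1%N
  else if (i < m1 + m2 + m3)%N then 2%N else 3%N.

Lemma block_of_lt i : (block_of i < 4)%N.
Proof. by rewrite /block_of; case: ifP => // _; case: ifP => // _; case: ifP. Qed.

Lemma block_tg j i : (j < 4)%N -> block m j (tg i) = (block_of i == j).
Proof.
have hi := ltn_ord i; rewrite /block_of /block.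
by case: j => [|[|[|[|//]]]] _ /=; case: (ltnP i m1) => ?; case: (ltnP i (m1 + m2)) => ?;
  case: (ltnP i (m1 + m2 + m3)) => ? /=; lia.
Qed.

Lemma block_idx j A : (j < 4)%N -> block m j A ->
  exists2 i : 'I_d, A = tg i & block_of i = j.
Proof.
move=> hj; case: (idxP A) => [||i||].
- by rewrite /block.
- by rewrite /block val_c1.
- by rewrite block_tg// => /eqP; exists i.
- rewrite /block val_cN; case: j hj => [|[|[|[|//]]]] _ /=; lia.
- rewrite /block; case: j hj => [|[|[|[|//]]]] _ /=; lia.
Qed.

Lemma sum_block (V : nmodType) j (G : 'I_d.+1.+3 -> V) : (j < 4)%N ->
  \sum_(A | block m j A) G A = \sum_(i | block_of i == j) G (tg i).
Proof.
move=> hj; rewrite big_mkcond sum_frame.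
have nb (A : 'I_d.+1.+3) : (forall i : 'I_d, A <> tg i) -> block m j A = false.
  by move=> nA; apply/negP => h; have [i /nA] := block_idx hj h.
have Ntg (i : 'I_d) : [/\ ord0 <> tg i, c1 <> tg i, cN <> tg i & ord_max <> tg i].
  have hi := ltn_ord i.
  by split=> /(congr1 val); rewrite ?val_c1 ?val_cN /=; lia.
rewrite !nb ?add0r ?addr0; try by move=> i; have [] := Ntg i.
rewrite [RHS]big_mkcond.
by apply: eq_bigr => i _; rewrite block_tg.
Qed.

Context {R : realType} {M : analytic_manifold R d}.
Variable F : @frame_coeffs R d d.+1 M.

(* The tensor S with Delta_ij omega_i^j = sum_k S_ijk theta^k: its components are
   those of the F's up to signs and factors 2, first for ordered blocks. *)
Definition coeffT (p : M) (i j k : 'I_d) : R :=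
  match block_of i, block_of j, block_of k with
  | 0%N, 1%N, 2%N => - F3_21 F (tg k) (tg j) (tg i) p
  | 0%N, 1%N, 3%N => F4_21 F (tg k) (tg j) (tg i) p
  | 0%N, 2%N, 3%N => 2 * F4_31 F (tg k) (tg j) (tg i) p
  | 1%N, 2%N, 3%N => 2 * F4_32 F (tg k) (tg j) (tg i) p
  | _, _, _ => 0
  end.

(** At most one of the six terms is nonzero, the one whose block numbers increase. *)
Definition coeffS (p : M) (i j k : 'I_d) : R :=
  coeffT p i j k + coeffT p i k j + coeffT p j i k + coeffT p j k i
  + coeffT p k i j + coeffT p k j i.

Lemma coeffSC12 p i j k : coeffS p j i k = coeffS p i j k.
Proof. by rewrite /coeffS; ring. Qed.

Lemma coeffSC23 p i j k : coeffS p i k j = coeffS p i j k.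
Proof. by rewrite /coeffS; ring. Qed.

Lemma coeffS0 p i j k : block_of i = block_of j -> coeffS p i j k = 0.
Proof.
move=> ij; rewrite /coeffS /coeffT ij.
have := block_of_lt j; have := block_of_lt k.
case: (block_of j) => [|[|[|[|//]]]]; case: (block_of k) => [|[|[|[|//]]]] _ _; ring.
Qed.

Section Expansion.
Variables (p : M) (om : 'I_d -> 'I_d -> R) (th : 'I_d -> R).
Hypothesis omC : forall i j, om j i = - om i j.
Local Notation b := block_of.
Hypothesis om01 : forall i j, b i = 0%N -> b j = 1%N -> om i j =
  (\sum_(k | b k == 2%N) F3_21 F (tg k) (tg j) (tg i) p * th k)
  - (\sum_(k | b k == 3%N) F4_21 F (tg k) (tg j) (tg i) p * th k).
Hypothesis om02 : forall i j, b i = 0%N -> b j = 2%N -> om i j =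
  (\sum_(k | b k == 1%N) F3_21 F (tg j) (tg k) (tg i) p * th k)
  - 2 * (\sum_(k | b k == 3%N) F4_31 F (tg k) (tg j) (tg i) p * th k).
Hypothesis om12 : forall i j, b i = 1%N -> b j = 2%N -> om i j =
  (\sum_(k | b k == 0%N) F3_21 F (tg j) (tg i) (tg k) p * th k)
  - 2 * (\sum_(k | b k == 3%N) F4_32 F (tg k) (tg j) (tg i) p * th k).
Hypothesis om03 : forall i j, b i = 0%N -> b j = 3%N -> om i j =
  - (\sum_(k | b k == 1%N) F4_21 F (tg j) (tg k) (tg i) p * th k)
  - 2 * (\sum_(k | b k == 2%N) F4_31 F (tg j) (tg k) (tg i) p * th k).
Hypothesis om13 : forall i j, b i = 1%N -> b j = 3%N -> om i j =
  (\sum_(k | b k == 0%N) F4_21 F (tg j) (tg i) (tg k) p * th k)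
  + 2 * (\sum_(k | b k == 2%N) F4_32 F (tg j) (tg k) (tg i) p * th k).
Hypothesis om23 : forall i j, b i = 2%N -> b j = 3%N -> om i j =
  (\sum_(k | b k == 0%N) F4_31 F (tg j) (tg i) (tg k) p * th k)
  + (\sum_(k | b k == 1%N) F4_32 F (tg j) (tg i) (tg k) p * th k).

(** [Delta] is -1 on the block pairs 12, 13, 14, 23, is 1 on 24 and 2 on 34. These factors absorb
    the signs and the 2s in the definition of the F's and make the three occurrences of each F
    agree. *)
Lemma coeffS_expansion i j : Delta b i j * om i j = \sum_k coeffS p i j k * th k.
Proof.
have lt_case i' j' : (b i' < b j')%N -> Delta b i' j' * om i' j' = \sum_k coeffS p i' j' k *
  th k.
  have cv (n : nat) (G : 'I_d -> R) : (\sum_(k | b k == n) G k) = \sum_k (if b k == n then G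
    k else 0).
    by rewrite big_mkcond.
  have cv2 (n : nat) (G : 'I_d -> R) : (2 : R) * (\sum_(k | b k == n) G k) = \sum_k (if b k
    == n then 2 * G k else 0).
    by rewrite mulr_sumr big_mkcond.
  have cvN (n : nat) (G : 'I_d -> R) : - (\sum_(k | b k == n) G k) = \sum_k (if b k == n then
    - G k else 0).
    by rewrite -sumrN big_mkcond.
  have bk := block_of_lt.
  have := bk j'; case hi: (b i') => [|[|[|[|//]]]]; case hj: (b j') => [|[|[|[|//]]]] // _ _.
  - rewrite om01// !cv -sumrB mulr_sumr; apply: eq_bigr => k _; have := bk k.
    by case hk: (b k) => [|[|[|[|//]]]] _; rewrite /Delta /blx /bly /coeffS /coeffT hi hj hk
      /=; ring.
  - rewrite om02// cv2 cv -sumrB mulr_sumr; apply: eq_bigr => k _; have := bk k.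
    by case hk: (b k) => [|[|[|[|//]]]] _; rewrite /Delta /blx /bly /coeffS /coeffT hi hj hk
      /=; ring.
  - rewrite om03// cv2 cvN -sumrB mulr_sumr; apply: eq_bigr => k _; have := bk k.
    by case hk: (b k) => [|[|[|[|//]]]] _; rewrite /Delta /blx /bly /coeffS /coeffT hi hj hk
      /=; ring.
  - rewrite om12// cv2 cv -sumrB mulr_sumr; apply: eq_bigr => k _; have := bk k.
    by case hk: (b k) => [|[|[|[|//]]]] _; rewrite /Delta /blx /bly /coeffS /coeffT hi hj hk
      /=; ring.
  - rewrite om13// cv2 cv -big_split mulr_sumr; apply: eq_bigr => k _; have := bk k.
    by case hk: (b k) => [|[|[|[|//]]]] _; rewrite /Delta /blx /bly /coeffS /coeffT hi hj hk
      /=; ring.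
  - rewrite om23// !cv -big_split mulr_sumr; apply: eq_bigr => k _; have := bk k.
    by case hk: (b k) => [|[|[|[|//]]]] _; rewrite /Delta /blx /bly /coeffS /coeffT hi hj hk
      /=; ring.
case: (ltngtP (b i) (b j)) => [/lt_case//|ji|ij].
  rewrite omC DeltaC mulrNN (lt_case _ _ ji); apply: eq_bigr => k _.
  by rewrite coeffSC12.
rewrite Delta_eq0// mul0r big1// => k _.
by rewrite coeffS0// mul0r.
Qed.
End Expansion.
End Blocks.

Lemma analytic_onS (R : realType) d (O O' : set 'rV[R]_d) (f : 'rV[R]_d -> R) :
  O' `<=` O -> analytic_on O f -> analytic_on O' f.
Proof. by move=> sO [h1 h2]; split=> [s x /sO|x /sO]; [exact: h1|exact: h2]. Qed.

(** A curvature sphere has a nonzero principal vector by definition, so its principal space is not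
    0. *)
Lemma multiplicity_gt0 (R : realType) (n d : nat) (M : analytic_manifold R d)
    (lam : M -> {vspace 'rV[R]_n.+3}) (m : seq nat) (r : M -> R) (p : M) i :
  lie_curvature lam m r -> (i < 4)%N -> nth 0%N m i != 0%N.
Proof.
move=> /(_ p)[Z0 [Z1 /= [_ cs mult]]] i4.
have /cs[c [X [ac dc X0 pX]]] : nth 0%VS (four_points (r p) Z0 Z1) i \in four_points (r p) Z0
  Z1.
  by rewrite mem_nth.
have [V dV /(_ X)[_ /(_ pX) XV]] := mult i i4 c ac dc.
apply/eqP => m0; move: XV; move/eqP: dV; rewrite m0 dimv_eq0 => /eqP ->.
by rewrite memv0 (negPf X0).
Qed.

(** * Subspaces cut out by two orthogonality conditions *)

Section Codim2.
Context {R : realType} {k : nat}.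
Implicit Types (u v : 'rV[R]_k.+3).

Lemma lie_form_linear v : exists N : 'cV[R]_k.+3, forall u, u *m N = (lie_form u v)%:M.
Proof.
exists (\col_i ((-1) ^+ ((i == ord0) || (i == ord_max)) * v 0 i)) => u.
apply/matrixP => i j; rewrite !ord1 !mxE eqxx mulr1n; apply: eq_bigr => l _.
by rewrite mxE; ring.
Qed.

(** S is the kernel of u -> (<u, e1>, <u, e2>); u1 and u2 are mapped to nonzero vectors on the two
    axes, so the map is onto. *)
Lemma lie_orthogonal2 e1 e2 u1 u2 :
  lie_form u1 e1 != 0 -> lie_form u1 e2 = 0 -> lie_form u2 e1 = 0 -> lie_form u2 e2 != 0 ->
  exists S : {vspace 'rV[R]_k.+3}, (\dim S + 2 <= k.+3)%N /\
    forall u, lie_form u e1 = 0 -> lie_form u e2 = 0 -> u \in S.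
Proof.
move=> h11 h12 h21 h22.
have [N1 hN1] := lie_form_linear e1; have [N2 hN2] := lie_form_linear e2.
pose f := linfun (mulmxr (row_mx N1 N2)) : 'Hom('rV[R]_k.+3, 'rV[R]_(1 + 1)).
have fE u : f u = row_mx (lie_form u e1)%:M (lie_form u e2)%:M.
  by rewrite lfunE /= mul_mx_row hN1 hN2.
exists (lker f); split; last first.
  move=> u ue1 ue2; rewrite memv_ker fE ue1 ue2.
  by rewrite !raddf0 row_mx0.
have himg : (f @: fullv)%VS = fullv.
  apply/eqP; rewrite eqEsubv subvf; apply/subvP => w _.
have -> : w = f ((w 0 (lshift 1 0) / lie_form u1 e1) *: u1 + (w 0 (rshift 1 0) / lie_form u2
  e2) *: u2).
  rewrite linearD !linearZ /= !fE h12 h21; apply/rowP => j.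
  rewrite !mxE; case: (split_ordP j) => l ->; rewrite !mxE ord1 eqxx !mulr1n.
    by rewrite mulr0 addr0 divfK.
  by rewrite mulr0 add0r divfK.
  by apply: memv_img; exact: memvf.
have := limg_ker_dim f fullv; rewrite capfv himg !dimvf /dim /= !mul1n => ->.
exact: leqnn.
Qed.
End Codim2.

(** * The frame field in a chart *)

Section Main.
Context {R : realType} {d : nat}.
Variables (m1 m2 m3 m4 : nat).
Hypothesis dm : d = (m1 + m2 + m3 + m4)%N.
Hypothesis mpos : [/\ m2 != 0, m3 != 0 & m4 != 0]%N.
Variables (M : analytic_manifold R d) (lam : M -> {vspace 'rV[R]_d.+1.+3}).
Local Notation m := [:: m1; m2; m3; m4].
Hypothesis lamL : legendre lam.
Variables (U : set M) (Y : M -> 'M[R]_d.+1.+3).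
Hypothesis Y2 : second_order lam m (fun=> -1) U Y.
Hypothesis dw00 : forall c p X X', atlas c -> chart_dom c p -> U p ->
  ext_deriv c (omega Y c ord0 ord0) p X X' = 0.
Variable F : @frame_coeffs R d d.+1 M.
Hypothesis YF : frame_coeffs_of m U Y F.
Variable a : 'I_d.
Hypothesis a0 : block_of m1 m2 m3 a = 0%N.
Hypothesis Fa : forall p, U p ->
  [/\ forall t s, block m 2 t -> block m 1 s -> F3_21 F t s (tg a) p = 0,
      forall u s, block m 3 u -> block m 1 s -> F4_21 F u s (tg a) p = 0 &
      forall u t, block m 3 u -> block m 2 t -> F4_31 F u t (tg a) p = 0].
Local Notation b := (block_of m1 m2 m3).

Section Chart.
Variable c : chart R M d.
Hypothesis ac : atlas c.
Let O := chart_cod c `&` chart_inv c @^-1` U.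
Let y := Y \o chart_inv c.

Lemma frame_field : lie_frame_field lam U Y.
Proof. by case: Y2 => -[]. Qed.

Lemma chart_O_open : open O.
Proof.
have [oU _ _ _] := frame_field.
rewrite openE => x [cx Ux]; apply: filterI.
  by apply: open_nbhs_nbhs; split=> //; exact: chart_cod_open.
by apply: (chart_inv_continuous cx); apply: open_nbhs_nbhs.
Qed.

Lemma chart_frame_diff A B x : O x -> differentiable (fun t => y t A B) x.
Proof. by have [_ aY _ _] := frame_field; move=> Ox; exact: ((aY A B c ac).1 [::] x Ox). Qed.

Lemma chart_frame_diff2 A B k x : O x ->
  differentiable ('D_(delta_mx 0 k) (fun t => y t A B)) x.
Proof. by have [_ aY _ _] := frame_field; move=> Ox; exact: ((aY A B c ac).1 [:: k] x Ox). Qed.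

Lemma chart_frame x : O x -> lie_frame (y x).
Proof. by have [_ _ lf _] := frame_field; move=> [_ Ux]; exact: lf. Qed.

Lemma chart_unit x : O x -> y x \in unitmx.
Proof. by move=> /chart_frame/lie_frame_unit. Qed.

Definition chart_w := locked (mc_form y).
Local Notation w := chart_w.

Lemma chart_wE : w = mc_form y. Proof. by rewrite /chart_w -lock. Qed.

Lemma chart_w_form A B : form_on O (w A B).
Proof. rewrite chart_wE; exact: (mc_form_on chart_O_open chart_frame_diff chart_frame_diff2
  chart_unit). Qed.

Lemma chart_w_row A B x X : O x -> 'D_X (fun t => y t A B) x = \sum_C w A C x X * y x C B.
Proof. rewrite chart_wE; exact: (derive_row chart_frame_diff chart_unit). Qed.

Lemma chart_w_mc A B x X X' : O x -> dform (w A B) x X X' = \sum_C wedge (w A C) (w C B) x X X'.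
Proof. rewrite chart_wE; exact: (maurer_cartan chart_O_open chart_frame_diff
  chart_frame_diff2 chart_unit). Qed.

Lemma omega_mc A B x X : O x -> omega Y c A B (chart_inv c x) X = w A B x X.
Proof. by move=> [cx _]; rewrite chart_wE /omega /chart_diff chart_invK. Qed.

Lemma chart_lam x : O x -> lam (chart_inv c x) = <<[:: row ord0 (y x); row c1 (y x)]>>%VS.
Proof. by have [_ _ _ hl] := frame_field; move=> [_ Ux]; rewrite c1E; exact: hl. Qed.

Lemma frame_lift : lift_on lam U (fun p => row ord0 (Y p)) (fun p => row c1 (Y p)).
Proof.
have [oU aY _ hl] := frame_field; split=> //; last by rewrite c1E.
  move=> i j; rewrite /analytic_fun.
  by under eq_fun do rewrite mxE; exact: aY.
move=> i j; rewrite /analytic_fun.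
by under eq_fun do rewrite mxE; exact: aY.
Qed.

Lemma chart_diff_row A x X : O x ->
  chart_diff c (fun p => row A (Y p)) (chart_inv c x) X =
  \sum_C w A C x X *: row C (y x).
Proof.
move=> Ox; have [cx _] := Ox; rewrite /chart_diff chart_invK//.
rewrite (derive_entries (A := fun t => row A (y t))); last first.
  by move=> k l; under eq_fun do rewrite mxE; exact: chart_frame_diff.
apply/matrixP => i j; rewrite ord1 mxE summxE.
under eq_fun do rewrite mxE.
rewrite chart_w_row//.
by apply: eq_bigr => C _; rewrite !mxE.
Qed.

(** Only Y_(n+1) pairs with Y_1, so <dY_0, Y_1> = - omega_0^(n+1). *)
Lemma chart_contact x X : O x -> w ord0 cN x X = 0.
Proof.
move=> Ox; have [cx Ux] := Ox; have [_ _ _ ct] := lamL.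
have := ct _ _ _ frame_lift c (chart_inv c x) X ac (chart_invP cx) Ux.
rewrite chart_diff_row//.
have -> : lie_form (\sum_C w ord0 C x X *: row C (y x)) (row c1 (Y (chart_inv c x))) =
    \sum_C w ord0 C x X * lie_gram C c1.
  under [RHS]eq_bigr do rewrite -[lie_gram _ _](chart_frame Ox) lie_formE mulr_sumr.
  rewrite exchange_big; apply: eq_bigr => k _ /=.
  rewrite summxE mulr_suml mulr_sumr; apply: eq_bigr => C _.
  by rewrite !mxE /lie_sign; ring.
by rewrite !sumJ => /eqP; rewrite oppr_eq0 => /eqP.
Qed.

Lemma chart_second x X : O x -> [/\ w ord0 c1 x X = 0, w c1 ord0 x X = 0 &
  w c1 c1 x X = w ord0 ord0 x X].
Proof.
move=> Ox; have [cx Ux] := Ox; have [_ so] := Y2.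
by have := so c (chart_inv c x) X ac (chart_invP cx) Ux; rewrite -c1E /= !omega_mc.
Qed.

Lemma chart_first x X i : O x ->
  [/\ b i = 0%N -> w ord0 (tg i) x X = 0, b i = 1%N -> w c1 (tg i) x X = 0,
      b i = 2%N -> w ord0 (tg i) x X + w c1 (tg i) x X = 0 &
      b i = 3%N -> - 1 * w ord0 (tg i) x X + w c1 (tg i) x X = 0].
Proof.
move=> Ox; have [cx Ux] := Ox; have [[_ _ fo] _] := Y2.
have := fo c (chart_inv c x) X ac (chart_invP cx) Ux; rewrite -c1E => -[f0 f1 f2 f3].
have bt j : (j < 4)%N -> b i = j -> block m j (tg i).
  by move=> j4 bj; rewrite (block_tg dm)// bj.
split=> bi; rewrite -!omega_mc//.
- by apply: f0; exact: (bt 0%N).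
- by apply: f1; exact: (bt 1%N).
- by apply: f2; exact: (bt 2%N).
- by apply: f3; exact: (bt 3%N).
Qed.

Let theta := coframe w b.

(** If every theta^i kills X, then dY_0(X) and dY_1(X) lie in the span of Y_0 and Y_1, and the
    immersion condition applies. *)
Lemma chart_immersed x X : O x -> (forall i, theta i x X = 0) -> X = 0.
Proof.
move=> Ox t0; have [cx Ux] := Ox; have [_ _ im _] := lamL.
have fo0 x X i Ox := let: And4 h _ _ _ := @chart_first x X i Ox in h.
have fo1 x X i Ox := let: And4 _ h _ _ := @chart_first x X i Ox in h.
have fo2 x X i Ox := let: And4 _ _ h _ := @chart_first x X i Ox in h.
have fo3 x X i Ox := let: And4 _ _ _ h := @chart_first x X i Ox in h.
have w0 i : w ord0 (tg i) x X = 0.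
  by rewrite (w0T fo0)// -/theta t0 mulr0.
have w1 i : w c1 (tg i) x X = 0.
  by rewrite (w1T (block_of_lt m1 m2 m3) fo1 fo2 fo3)// -/theta t0 mulr0.
have [h01 h10 h11] := chart_second X Ox.
apply: (im _ _ _ frame_lift c (chart_inv c x) X ac (chart_invP cx) Ux).
all: rewrite chart_diff_row// sum_frame chart_lam//.
all: rewrite [\sum_i _]big1; last by move=> i _; rewrite ?w0 ?w1 scale0r.
- rewrite chart_contact// (w0M chart_O_open chart_frame_diff chart_frame chart_w_row)//.
  by rewrite !scale0r !addr0; apply: rpredD; apply: rpredZ; apply: memv_span; rewrite !inE
    eqxx ?orbT.
- rewrite (w1N chart_O_open chart_frame_diff chart_frame chart_w_row)//.
  rewrite (w1M chart_O_open chart_frame_diff chart_frame chart_w_row chart_contact)//.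
  by rewrite !scale0r !addr0; apply: rpredD; apply: rpredZ; apply: memv_span; rewrite !inE
    eqxx ?orbT.
Qed.

Lemma chart_dw00 x X X' : O x -> dform (w ord0 ord0) x X X' = 0.
Proof.
move=> Ox; have [cx Ux] := Ox.
have E Z Z' : chart_diff c (fun q => omega Y c ord0 ord0 q Z' : R^o) (chart_inv c x) Z =
    'D_Z (w ord0 ord0 ^~ Z') x.
  rewrite /chart_diff (chart_invK cx).
  apply: (derive_eq_on chart_O_open Z Ox) => t Ot.
  exact: omega_mc.
exact: (etrans (congr2 (fun u v : R => u - v) (esym (E X X')) (esym (E X' X)))
  (dw00 X X' ac (chart_invP cx) Ux)).
Qed.

Let S i j k x := coeffS m1 m2 m3 F (chart_inv c x) i j k.

Lemma coeffT_diff i j k x : O x ->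
  differentiable (fun t => coeffT m1 m2 m3 F (chart_inv c t) i j k) x.
Proof.
move=> Ox; have [[h1 h2 h3 h4] _] := YF.
have bt (l : 'I_d) n : (n < 4)%N -> b l = n -> block m n (tg l).
  by move=> n4 bj; rewrite (block_tg dm)// bj.
have cst : differentiable (fun _ : 'rV[R]_d => 0 : R) x by exact: differentiable_cst.
have c2 : differentiable (fun _ : 'rV[R]_d => 2 : R) x by exact: differentiable_cst.
rewrite /coeffT.
case bi: (b i) => [|[|n]] //; case bj: (b j) => [|[|[|n']]] //; case bk: (b k) =>
  [|[|[|[|n'']]]] //.
- apply: differentiable_fN.
  exact: ((h1 _ _ _ (bt _ 2%N isT bk) (bt _ 1%N isT bj) (bt _ 0%N isT bi) c ac).1 [::] x Ox).
- exact: ((h2 _ _ _ (bt _ 3%N isT bk) (bt _ 1%N isT bj) (bt _ 0%N isT bi) c ac).1 [::] x Ox).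
- apply: differentiable_fM => //.
  exact: ((h3 _ _ _ (bt _ 3%N isT bk) (bt _ 2%N isT bj) (bt _ 0%N isT bi) c ac).1 [::] x Ox).
- apply: differentiable_fM => //.
  exact: ((h4 _ _ _ (bt _ 3%N isT bk) (bt _ 2%N isT bj) (bt _ 1%N isT bi) c ac).1 [::] x Ox).
Qed.

Lemma coeffS_diff i j k x : O x -> differentiable (S i j k) x.
Proof.
move=> Ox; rewrite /S /coeffS.
do 5![apply: differentiable_fD; last exact: coeffT_diff].
exact: coeffT_diff.
Qed.

Lemma coeffS_a j k x : O x -> S a j k x = 0.
Proof.
move=> [_ Ux]; have [f1 f2 f3] := Fa Ux.
have bt (l : 'I_d) n : (n < 4)%N -> b l = n -> block m n (tg l).
  by move=> n4 bj; rewrite (block_tg dm)// bj.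
have T0 j' k' : coeffT m1 m2 m3 F (chart_inv c x) a j' k' = 0.
  rewrite /coeffT a0; case bj: (b j') => [|[|[|n']]] //; case bk: (b k') => [|[|[|[|n'']]]] //.
  - by rewrite f1 ?oppr0//; [exact: (bt _ 2%N)|exact: (bt _ 1%N)].
  - by rewrite f2//; [exact: (bt _ 3%N)|exact: (bt _ 1%N)].
  - by rewrite f3 ?mulr0//; [exact: (bt _ 3%N)|exact: (bt _ 2%N)].
(* Block {1} has the smallest number, so [coeffT] vanishes when a is not in first place. *)
have T1 j' k' : coeffT m1 m2 m3 F (chart_inv c x) j' a k' = 0.
  by rewrite /coeffT a0; case: (b j') => [|[|[|[|?]]]].
have T2 j' k' : coeffT m1 m2 m3 F (chart_inv c x) j' k' a = 0.
  by rewrite /coeffT a0; case: (b j') => [|[|?]] //; case: (b k') => [|[|[|?]]].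
by rewrite /S /coeffS !T0 !T1 !T2; ring.
Qed.

Lemma chart_coeffS x X i j : O x ->
  Delta b i j * w (tg i) (tg j) x X = \sum_k S i j k x * theta k x X.
Proof.
move=> Ox; have [cx Ux] := Ox; have [_ eqs] := YF.
have := eqs c (chart_inv c x) X ac (chart_invP cx) Ux.
rewrite -c1E => /= -[[e1 e2 e3] [e4 e5 e6]].
have bt (l : 'I_d) n : (n < 4)%N -> b l = n -> block m n (tg l).
  by move=> n4 bj; rewrite (block_tg dm)// bj.
have wC i' j' : w (tg j') (tg i') x X = - w (tg i') (tg j') x X.
  exact: (wTT chart_O_open chart_frame_diff chart_frame chart_w_row).
have sb j' (G : 'I_d.+1.+3 -> R) (H : 'I_d -> R) : (j' < 4)%N ->
    (forall k, b k = j' -> G (tg k) = H k) ->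
    \sum_(A | block m j' A) G A = \sum_(k | b k == j') H k.
  by move=> j4 GH; rewrite (sum_block dm)//; apply: eq_bigr => k /eqP /GH.
have t1 k : b k = 0%N -> omega Y c c1 (tg k) (chart_inv c x) X = theta k x X.
  by move=> bk; rewrite omega_mc// /theta /coframe bk.
have t0 k l : b k = l.+1 -> omega Y c ord0 (tg k) (chart_inv c x) X = theta k x X.
  by move=> bk; rewrite omega_mc// /theta /coframe bk.
apply: (coeffS_expansion (th := fun k => theta k x X) (om := fun i j => w (tg i) (tg j) x X)).
- exact: wC.
- move=> i' j' bi bj; rewrite -omega_mc// (e1 _ _ (bt _ 0%N isT bi) (bt _ 1%N isT bj)).
  by congr (_ - _); apply: sb => // k bk; rewrite (t0 _ _ bk).
- move=> i' j' bi bj; rewrite -omega_mc// (e2 _ _ (bt _ 0%N isT bi) (bt _ 2%N isT bj)).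
  by congr (_ - _ * _); apply: sb => // k bk; rewrite (t0 _ _ bk).
- move=> i' j' bi bj; rewrite -omega_mc// (e3 _ _ (bt _ 1%N isT bi) (bt _ 2%N isT bj)).
  congr (_ - _ * _); apply: sb => // k bk; last by rewrite (t0 _ _ bk).
  by rewrite (t1 _ bk).
- move=> i' j' bi bj; rewrite -omega_mc// (e4 _ _ (bt _ 0%N isT bi) (bt _ 3%N isT bj)).
  by congr (- _ - _ * _); apply: sb => // k bk; rewrite (t0 _ _ bk).
- move=> i' j' bi bj; rewrite -omega_mc// (e5 _ _ (bt _ 1%N isT bi) (bt _ 3%N isT bj)).
  congr (_ + _ * _); apply: sb => // k bk; last by rewrite (t0 _ _ bk).
  by rewrite (t1 _ bk).
- move=> i' j' bi bj; rewrite -omega_mc// (e6 _ _ (bt _ 2%N isT bi) (bt _ 3%N isT bj)).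
  congr (_ + _); apply: sb => // k bk; last by rewrite (t0 _ _ bk).
  by rewrite (t1 _ bk).
Qed.

Lemma chart_core x : O x -> exists x0 W (A0 B0 : R),
  [/\ open W, W x0, W `<=` O & forall x1, W x1 ->
    lie_form (row cN (y x0) + A0 *: row ord0 (y x0) + B0 *: row c1 (y x0)) (row ord0 (y x1))
      = 0 /\
    lie_form (row (tg a) (y x0)) (row ord0 (y x1)) = 0].
Proof.
have [n2 n3 n4] := mpos.
(* The first elements of the blocks {2}, {3}, {4}, counted from 0, serve as [i1], [i2], [i3]. *)
have d1 : (m1 < d)%N by rewrite dm; lia.
have d2 : (m1 + m2 < d)%N by rewrite dm; lia.
have d3 : (m1 + m2 + m3 < d)%N by rewrite dm; lia.
have b1 : b (Ordinal d1) = 1%N by rewrite /block_of /= ltnn; case: ltnP => //; lia.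
have b2 : b (Ordinal d2) = 2%N.
  by rewrite /block_of /= ltnn; do 2?[case: ltnP => //]; lia.
have b3 : b (Ordinal d3) = 3%N.
  by rewrite /block_of /= ltnn; do 2?[case: ltnP => //]; lia.
have fo0 x' X i Ox := let: And4 h _ _ _ := @chart_first x' X i Ox in h.
have fo1 x' X i Ox := let: And4 _ h _ _ := @chart_first x' X i Ox in h.
have fo2 x' X i Ox := let: And4 _ _ h _ := @chart_first x' X i Ox in h.
have fo3 x' X i Ox := let: And4 _ _ _ h := @chart_first x' X i Ox in h.
have w01 x' X Ox := let: And3 h _ _ := @chart_second x' X Ox in h.
have w10 x' X Ox := let: And3 _ h _ := @chart_second x' X Ox in h.
have w11 x' X Ox := let: And3 _ _ h := @chart_second x' X Ox in h.
exact: (@frame_core R d O chart_O_open y chart_frame_diff chart_frame w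
  chart_w_form chart_w_row chart_w_mc chart_contact w01 w10 w11 b (block_of_lt m1 m2 m3) fo0
    fo1 fo2 fo3
  chart_immersed chart_dw00 S coeffS_diff chart_coeffS
  (fun i j k x => coeffSC12 _ _ _ _ _ _ _ _) (fun i j k x => coeffSC23 _ _ _ _ _ _ _ _)
  (fun i j k x => @coeffS0 _ _ _ _ _ _ _ _ _ _ _) a (introT eqP a0)
  (fun x j k => @coeffS_a j k x)
  (Ordinal d1) (Ordinal d2) (Ordinal d3) b1 b2 b3 x).
Qed.
End Chart.
End Main.

Lemma theorem17_succ (R : realType) (d m1 m2 m3 m4 : nat)
    (dm : d = (m1 + m2 + m3 + m4)%N)
    (mpos : [/\ m2 != 0, m3 != 0 & m4 != 0]%N)
    (M : analytic_manifold R d) (lam : M -> {vspace 'rV[R]_d.+1.+3})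
    (lamL : legendre lam)
    (U : set M) (U0 : U !=set0) (Y : M -> 'M[R]_d.+1.+3)
    (Y2 : second_order lam [:: m1; m2; m3; m4] (fun=> -1) U Y)
    (dw00 : forall c p X X', atlas c -> chart_dom c p -> U p ->
       ext_deriv c (omega Y c ord0 ord0) p X X' = 0)
    (F : frame_coeffs) (YF : frame_coeffs_of [:: m1; m2; m3; m4] U Y F)
    (prime1 : block1' [:: m1; m2; m3; m4] U F !=set0) :
  exists W : set M,
    [/\ open W, W !=set0, W `<=` U,
        in_codim2 W (fun p => <[row ord0 (Y p)]>%VS) &
        reducible lam W].
Proof.
have [p0 Up0] := U0; have [c ac cp0] := atlas_cover p0.
have [_ [/(block_idx dm (isT : (0 < 4)%N))[a -> a0] Fa]] := prime1.
have [[[oU aY lf hl] cs _] _] := Y2.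
have Op0 : (chart_cod c `&` chart_inv c @^-1` U) (chart_map c p0).
  by split; [exact: chart_mapP|rewrite /= chart_mapK].
have [x0 [W [A0 [B0 [oW Wx0 sW orth]]]]] :=
  chart_core dm mpos lamL Y2 dw00 YF a0 Fa ac Op0.
have [cx0 Ux0] := sW _ Wx0.
pose V := chart_dom c `&` chart_map c @^-1` W.
have VU : V `<=` U by move=> p [cp /sW[_ /=]]; rewrite chart_mapK.
have oV : open V.
  rewrite openE => p [cp Wp]; apply: filterI.
    by apply: open_nbhs_nbhs; split=> //; exact: chart_dom_open.
  by apply: (chart_map_continuous cp); apply: open_nbhs_nbhs.
have Vx0 : V (chart_inv c x0) by split; [exact: chart_invP|rewrite /= chart_invK].
have codim : in_codim2 V (fun p => <[row ord0 (Y p)]>%VS).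
  set y0 := Y (chart_inv c x0).
  have J A B : lie_form (row A y0) (row B y0) = lie_gram A B by rewrite lf.
  set e1 := row cN y0 + A0 *: row ord0 y0 + B0 *: row c1 y0.
  have Je1 A : lie_form (row A y0) e1 = lie_gram A cN + A0 * lie_gram A ord0 + B0 * lie_gram
    A c1.
    rewrite -!J !lie_formE !mulr_sumr -!big_split /=; apply: eq_bigr => k _.
    by rewrite !mxE; ring.
  have N10 : (c1 == ord_max :> 'I_d.+1.+3) = false by rewrite -val_eqE val_c1.
  have N1N : (c1 == cN :> 'I_d.+1.+3) = false by rewrite -val_eqE val_c1 val_cN.
  have N1T : (c1 == tg a) = false by rewrite -val_eqE val_c1.
  have NT1 : (tg a == c1) = false by rewrite eq_sym.
  have NTM : (tg a == ord_max) = false.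
    by rewrite -val_eqE /=; apply/negP; have := ltn_ord a; lia.
  have NTN : (tg a == cN) = false.
    by rewrite -val_eqE val_cN /=; apply/negP; have := ltn_ord a; lia.
  (* Y_1 and Y_a are dual to Z and Y_a up to sign: <Y_1, Z> = -1, <Y_a, Y_a> = 1, and the mixed
     products vanish. *)
  have [|||| S [dimS hS]] := @lie_orthogonal2 R d.+1 e1 (row (tg a) y0) (row c1 y0) (row (tg
    a) y0).
  - by rewrite Je1 lie_gramN lie_gram0 lie_gram1 eqxx N10 N1N !oppr0 !mulr0 !addr0 oppr_eq0
    oner_eq0.
  - by rewrite J lie_gramT N1T.
  - by rewrite Je1 lie_gramN lie_gram0 lie_gram1 NT1 NTM NTN !oppr0 !mulr0 !addr0.
  - by rewrite J lie_gramT eqxx oner_eq0.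
  exists S; split=> // p [cp Wp]; rewrite -memvE; apply: hS.
    by have [h _] := orth _ Wp; rewrite lie_formC; move: h; rewrite /= chart_mapK.
  by have [_ h] := orth _ Wp; rewrite lie_formC; move: h; rewrite /= chart_mapK.
exists V; split=> //; first by exists (chart_inv c x0).
exists (fun p => <[row ord0 (Y p)]>%VS); split=> // p Vp; last first.
  by apply/cs; [exact: VU|rewrite inE eqxx].
exists V, (fun p => row ord0 (Y p)); split=> //.
  move=> i j c' ac'; under eq_fun do rewrite mxE.
  apply: analytic_onS (aY _ _ _ ac').
  by move=> x [cx Vx]; split=> //; exact: VU.
move=> q Vq; split=> //; apply/eqP => q0.
(* Y_0 is nonzero because its product with Y_(n+2) is -1. *)
have := lf q (VU _ Vq) ord0 ord_max; rewrite q0.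
have -> : lie_form 0 (row ord_max (Y q)) = 0.
  by apply: big1 => k _; rewrite mxE mul0r mulr0.
rewrite -/(lie_gram ord0 ord_max) lie_gramM eqxx => /eqP.
by rewrite eq_sym oppr_eq0 oner_eq0.
Qed.

Theorem theorem17 (R : realType) (n m1 m2 m3 m4 : nat)
    (hn : n.-1 = (m1 + m2 + m3 + m4)%N)
    (M : analytic_manifold R n.-1) (Mconn : connected [set: M])
    (lam : M -> {vspace 'rV[R]_n.+3})
    (lamD : proper_dupin lam 4)
    (lamr : lie_curvature lam [:: m1; m2; m3; m4] (fun=> -1))
    (m12 : m1 = m2) (m34 : m3 = m4)
    (U : set M) (U0 : U !=set0) (Y : M -> 'M[R]_n.+3)
    (Y2 : second_order lam [:: m1; m2; m3; m4] (fun=> -1) U Y)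
    (dw00 : forall c p X X', atlas c -> chart_dom c p -> U p ->
       ext_deriv c (omega Y c ord0 ord0) p X X' = 0)
    (F : frame_coeffs) (YF : frame_coeffs_of [:: m1; m2; m3; m4] U Y F)
    (prime1 : block1' [:: m1; m2; m3; m4] U F !=set0) :
  exists W : set M,
    [/\ open W, W !=set0, W `<=` U,
        in_codim2 W (fun p => <[row ord0 (Y p)]>%VS) &
        reducible lam W].
Proof.
have [p _] := U0.
have mi i (i4 : (i < 4)%N) := multiplicity_gt0 p lamr i4.
have mpos : [/\ m2 != 0, m3 != 0 & m4 != 0]%N.
  by split; [exact: (mi 1%N)|exact: (mi 2%N)|exact: (mi 3%N)].
(* For n = 0 the truncated n.-1 is 0, which is not a sum of positive multiplicities; so n = d +
   1. *)
case: n hn M Mconn lam lamD lamr U U0 Y Y2 dw00 F YF prime1 p mi => [|d] hn M Mconn lam lamD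
  lamr U U0 Y Y2 dw00 F YF prime1 p mi.
  by exfalso; move: mpos hn => /= [? ? ?]; lia.
by have [[lamL _] _] := lamD; exact: (theorem17_succ hn mpos lamL U0 Y2 dw00 YF prime1).
Qed.
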